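(* Let $T:\Sigma\to\Sigma$ be a topologically mixing two-sided subshift of finite type with $h_{top}(T)>0$, and let $\mathcal{A}\in\mathcal{W}$ be a typical cocycle with values in $GL(k,\mathbb{R})$. Then $$\overline{\{\vec{\alpha}\in\mathbb{R}^k:\ h_{top}(E(\vec{\alpha}))>0\}}=\vec{L}.$$
   Context: Subshift: for a $0$-$1$ matrix $Q$, $\Sigma=\{(x_i)_{i\in\mathbb{Z}}: Q_{x_i,x_{i+1}}=1\ \forall i\}$ with left shift $T$. Fix $\omega\in(0,1)$ and the metric $d(x,y)=\omega^{m}$, where $m$ is the largest integer with $x_i=y_i$ for all $|i|<m$. $W^s_{loc}(x)=\{y:y_n=x_n\ \forall n\ge0\}$, $W^u_{loc}(x)=\{y:y_n=x_n\ \forall n<0\}$; $W^s(x)=\{y: T^ny\in W^s_{loc}(T^nx)\text{ for some }n\ge0\}$, $W^u(x)=\{y:T^ny\in W^u_{loc}(T^nx)\text{ for some }n\le0\}$. Cocycles: for $\mathcal{A}:\Sigma\to GL(k,\mathbb{R})$, $\mathcal{A}^n(x)=\mathcal{A}(T^{n-1}x)\cdots\mathcal{A}(x)$ and $\mathcal{A}^{-n}(x)=\mathcal{A}(T^{-n}x)^{-1}\cdots\mathcal{A}(T^{-1}x)^{-1}$ for $n\ge1$; $\|\cdot\|$ is the Euclidean operator norm. Fix $r>0$. $H^r_b(\Sigma,GL(k,\mathbb{R}))$ is the set of $r$-Hölder maps $\mathcal{A}:\Sigma\to GL(k,\mathbb{R})$ that are fiber bunched: $\|\mathcal{A}(x)\|\,\|\mathcal{A}(x)^{-1}\|\,\omega^r<1$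 for all $x$. For such $\mathcal{A}$ the canonical holonomies $H^s_{y\leftarrow x}=\lim_{n\to\infty}\mathcal{A}^n(y)^{-1}\mathcal{A}^n(x)$ ($y\in W^s_{loc}(x)$) and $H^u_{y\leftarrow x}=\lim_{n\to-\infty}\mathcal{A}^n(y)^{-1}\mathcal{A}^n(x)$ ($y\in W^u_{loc}(x)$) exist; they extend to $y\in W^{s}(x)$ (resp. $W^u(x)$) by $H^{s/u}_{y\leftarrow x}=\mathcal{A}^n(y)^{-1}H^{s/u}_{T^ny\leftarrow T^nx}\mathcal{A}^n(x)$ with $n$ (resp. $-n$) large. Typical cocycles: $\mathcal{A}\in H^r_b(\Sigma,GL(k,\mathbb{R}))$ is 1-typical if there are a periodic point $p$ and a homoclinic point $z\in W^s(p)\cap W^u(p)$, $z\ne p$, such that (i) the eigenvalues of $P:=\mathcal{A}^{per(p)}(p)$ have multiplicity 1 and distinct absolute values, with eigenvectors $v_1,\dots,v_k$; (ii) with $\psi:=H^s_{p\leftarrow z}\circ H^u_{z\leftarrow p}$, for all $1\le i,j\le k$, $\psi(v_i)$ is not in the hyperplane spanned by all the $v_l$ with $l\ne j$. A 1-typical $\mathcal{A}$ is $t$-typical ($2\le t\le k-1$) if, for the same $p,z$: (I) all products of $t$ distinct eigenvalues of $P$ are distinct; (II) the induced map $\psi^{\wedge t}$ on $\wedge^t\mathbb{R}^k$ satisfies the analogue of (ii) with respect to the eigenvectors $\{v_{i_1}\wedge\dots\wedge v_{i_t}\}_{i_1<\dots<i_t}$ of $P^{\wedge t}$. $\mathcal{A}$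 is typical if it is $t$-typical for all $1\le t\le k-1$ (same $p,z$); $\mathcal{W}\subset H^r_b(\Sigma,GL(k,\mathbb{R}))$ is the set of typical maps. Spectrum: $\chi_i(\mathcal{A}(x))=\lim_{n\to\infty}\frac1n\log\|(\mathcal{A}^n(x))^{\wedge i}\|$ when the limit exists, $1\le i\le k$ ($B^{\wedge i}$ is the $i$-th exterior power). $E(\vec{\alpha})=\{x\in\Sigma:\chi_i(\mathcal{A}(x))=\alpha_i\text{ for all }1\le i\le k\}$ and $\vec{L}=\{\vec{\alpha}\in\mathbb{R}^k:E(\vec{\alpha})\neq\emptyset\}$. Topological entropy of a subset $Y\subset\Sigma$ (Bowen): let $d_n(x,y)=\max_{0\le j<n}d(T^jx,T^jy)$, $B_n(x,\epsilon)$ the open $d_n$-ball. $S(Y,s,N,\epsilon)=\inf\sum_ie^{-sn_i}$ over countable covers of $Y$ by balls $B_{n_i}(x_i,\epsilon)$ with all $n_i\ge N$; $S(Y,s,\epsilon)=\lim_{N\to\infty}S(Y,s,N,\epsilon)$; $h_{top}(T,Y,\epsilon)$ is the critical $s$ at which $S(Y,s,\epsilon)$ jumps from $\infty$ to $0$; $h_{top}(Y)=\lim_{\epsilon\to0}h_{top}(T,Y,\epsilon)$, and $h_{top}(T)=h_{top}(\Sigma)$. *)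

(* Defs.v *)
From HB Require Import structures.
From mathcomp Require Import all_boot all_order all_algebra.
From mathcomp Require Import all_classical all_reals all_analysis.
Set Implicit Arguments.
Unset Strict Implicit.
Unset Printing Implicit Defensive.
Import Order.TTheory GRing.Theory Num.Theory.
Import numFieldNormedType.Exports.
Local Open Scope classical_set_scope.
Local Open Scope ring_scope.

(** * Linear algebra *)

Section LinearAlgebra.
Context {R : realType}.

Definition enorm {n : nat} (v : 'cV[R]_n) : R :=
  Num.sqrt (\sum_(i < n) v i 0 ^+ 2).

Definition opnorm {m n : nat} (B : 'M[R]_(m, n)) : R :=
  sup [set enorm (B *m v) | v in [set v : 'cV[R]_n | enorm v <= 1]].

(** The [t]-th exterior power of R^k is modelled on its standard basis
    e_(s 0) /\ ... /\ e_(s (t-1)), with [s : 'I_t -> 'I_k] strictly increasing;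
    this basis is orthonormal for the induced inner product, so that [enorm]
    and [opnorm] in these coordinates are the Euclidean norms. *)
Definition incr (t k : nat) : {set {ffun 'I_t -> 'I_k}} :=
  [set s : {ffun 'I_t -> 'I_k} |
    [forall a : 'I_t, forall b : 'I_t, (a < b)%N ==> (s a < s b)%N]]%SET.

Definition incr_of {t k : nat} (s : 'I_#|incr t k|) : {ffun 'I_t -> 'I_k} :=
  enum_val s.

(** The coordinates of v_0 /\ ... /\ v_(t-1) are the t x t minors of the
    matrix with columns v_0, ..., v_(t-1). *)
Definition wedge {t k : nat} (v : 'I_t -> 'cV[R]_k) : 'cV[R]_#|incr t k| :=
  \col_s \det (\matrix_(a < t, b < t) v b (incr_of s a) 0).

(** The column of index [u] is B e_(u 0) /\ ... /\ B e_(u (t-1)). *)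
Definition extpow (t : nat) {k : nat} (B : 'M[R]_k) : 'M[R]_#|incr t k| :=
  \matrix_(s, u) wedge (fun b : 'I_t => col (incr_of u b) B) s 0.

End LinearAlgebra.

(** * Two-sided subshifts of finite type *)

(** A 0-1 matrix is encoded as a boolean matrix. *)
Definition subshift {q : nat} (Q : 'M[bool]_q) : Type :=
  {x : int -> 'I_q | forall i : int, Q (x i) (x (i + 1))}.

HB.instance Definition _ q (Q : 'M[bool]_q) := gen_eqMixin (subshift Q).
HB.instance Definition _ q (Q : 'M[bool]_q) := gen_choiceMixin (subshift Q).

Section Subshift.
Context {R : realType} {q : nat} {Q : 'M[bool]_q}.
Implicit Types x y : subshift Q.

Lemma shift_subproof (n : int) x (i : int) :
  Q (sval x (i + n)) (sval x (i + 1 + n)).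
Proof. by rewrite addrAC; exact: (svalP x). Qed.

(** The [n]-th iterate, for [n] an integer, of the left shift
    (T x)_i = x_(i + 1). *)
Definition Tpow (n : int) x : subshift Q :=
  exist _ (fun i : int => sval x (i + n)) (shift_subproof n x).

Definition agree x y (m : nat) : Prop :=
  forall i : int, `|i| < m%:Z -> sval x i = sval y i.

Definition separation x y : nat :=
  xget 0%N [set m | agree x y m /\ forall m', agree x y m' -> (m' <= m)%N].

Definition dist (omega : R) x y : R :=
  if x == y then 0 else omega ^+ separation x y.

Definition dopen (omega : R) (U : set (subshift Q)) : Prop :=
  forall x, U x ->
    exists2 e : R, 0 < e & forall y, dist omega x y < e -> U y.

Definition topologically_mixing (omega : R) : Prop :=
  forall U V : set (subshift Q),
    dopen omega U -> dopen omega V -> U !=set0 -> V !=set0 ->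
    exists N : nat, forall n : nat, (N <= n)%N ->
      (Tpow n%:Z @` U) `&` V !=set0.

Definition Wsloc x : set (subshift Q) :=
  [set y | forall n : int, 0 <= n -> sval y n = sval x n].

Definition Wuloc x : set (subshift Q) :=
  [set y | forall n : int, n < 0 -> sval y n = sval x n].

Definition Ws x : set (subshift Q) :=
  [set y | exists n : nat, Wsloc (Tpow n%:Z x) (Tpow n%:Z y)].

Definition Wu x : set (subshift Q) :=
  [set y | exists n : nat, Wuloc (Tpow (- n%:Z) x) (Tpow (- n%:Z) y)].

Definition is_period x (n : nat) : Prop := (0 < n)%N /\ Tpow n%:Z x = x.

Definition periodic x : Prop := exists n : nat, is_period x n.

Definition per x : nat :=
  xget 0%N [set n | is_period x n /\ forall m, is_period x m -> (n <= m)%N].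

(** ** Bowen's topological entropy *)

Definition bowen_dist (omega : R) (n : nat) x y : R :=
  \big[Num.max/0]_(j < n) dist omega (Tpow j%:Z x) (Tpow j%:Z y).

Definition bowen_ball (omega : R) (n : nat) x (eps : R) : set (subshift Q) :=
  [set y | bowen_dist omega n x y < eps].

(** The pair [(x, n)] stands for the ball B_n(x, eps). *)
Definition bowen_cover (omega : R) (Y : set (subshift Q)) (N : nat) (eps : R)
    (C : set (subshift Q * nat)) : Prop :=
  [/\ countable C,
      forall c, C c -> (N <= c.2)%N
    & Y `<=` \bigcup_(c in C) bowen_ball omega c.2 c.1 eps].

Definition bowen_SN (omega : R) (Y : set (subshift Q)) (s : R) (N : nat)
    (eps : R) : \bar R :=
  ereal_inf [set (\esum_(c in C) (expR (- (s * c.2%:R)))%:E)%E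
            | C in bowen_cover omega Y N eps].

Definition bowen_S (omega : R) (Y : set (subshift Q)) (s eps : R) : \bar R :=
  lim (bowen_SN omega Y s N eps @[N --> \oo]).

Definition htop_eps (omega : R) (Y : set (subshift Q)) (eps : R) : \bar R :=
  ereal_inf [set s%:E | s in [set s : R | bowen_S omega Y s eps = 0%E]].

Definition htop (omega : R) (Y : set (subshift Q)) : \bar R :=
  lim (htop_eps omega Y eps @[eps --> 0^'+]).

End Subshift.

(** * Cocycles *)

Section Cocycles.
Context {R : realType} {q : nat} {Q : 'M[bool]_q} {k : nat}.
Implicit Types (x y p z : subshift Q) (A : subshift Q -> 'M[R]_k).

Fixpoint cocycle_fwd A (n : nat) x : 'M[R]_k :=
  if n is m.+1 then A (Tpow m%:Z x) *m cocycle_fwd A m x else 1%:M.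

Fixpoint cocycle_bwd A (n : nat) x : 'M[R]_k :=
  if n is m.+1 then invmx (A (Tpow (- m.+1%:Z) x)) *m cocycle_bwd A m x
  else 1%:M.

(** A^n(x) for [n] an integer; [Negz m] is -(m + 1). *)
Definition cocycle A (n : int) x : 'M[R]_k :=
  match n with
  | Posz m => cocycle_fwd A m x
  | Negz m => cocycle_bwd A m.+1 x
  end.

Definition GL_valued A : Prop := forall x, A x \in unitmx.

Definition holder (omega r : R) A : Prop :=
  exists C : R, forall x y, opnorm (A x - A y) <= C * dist omega x y `^ r.

Definition fiber_bunched (omega r : R) A : Prop :=
  forall x, opnorm (A x) * opnorm (invmx (A x)) * omega `^ r < 1.

Definition Hrb (omega r : R) : set (subshift Q -> 'M[R]_k) :=
  [set A | [/\ GL_valued A, holder omega r A & fiber_bunched omega r A]].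

(** ** Canonical holonomies; [Hs A y x] is H^s_{y <- x} *)

Definition Hsloc A y x : 'M[R]_k :=
  lim (invmx (cocycle A n%:Z y) *m cocycle A n%:Z x @[n --> \oo]).

Definition Huloc A y x : 'M[R]_k :=
  lim (invmx (cocycle A (- n%:Z) y) *m cocycle A (- n%:Z) x @[n --> \oo]).

(** The extended holonomies do not depend on the time [n] at which the two
    orbits are brought into a common local set, so any such [n] is chosen. *)
Definition Hs A y x : 'M[R]_k :=
  let n := xget 0%N [set n : nat | Wsloc (Tpow n%:Z x) (Tpow n%:Z y)] in
  invmx (cocycle A n%:Z y) *m Hsloc A (Tpow n%:Z y) (Tpow n%:Z x)
    *m cocycle A n%:Z x.

Definition Hu A y x : 'M[R]_k :=
  let n := xget 0%N
    [set n : nat | Wuloc (Tpow (- n%:Z) x) (Tpow (- n%:Z) y)] in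
  invmx (cocycle A (- n%:Z) y) *m Huloc A (Tpow (- n%:Z) y) (Tpow (- n%:Z) x)
    *m cocycle A (- n%:Z) x.

(** ** Typical cocycles *)

Definition return_map A p : 'M[R]_k := cocycle A (per p)%:Z p.

Definition homoclinic_map A p z : 'M[R]_k := Hs A p z *m Hu A z p.

(** The eigenvalues of [P], with multiplicity, are the [lam i]. Those of a real
    matrix come in conjugate pairs, hence are real as soon as their absolute
    values are distinct. *)
Definition simple_spectrum (P : 'M[R]_k) (lam : 'I_k -> R)
    (v : 'I_k -> 'cV[R]_k) : Prop :=
  [/\ char_poly P = \prod_(i < k) ('X - (lam i)%:P),
      injective (fun i => `|lam i|)
    & forall i, v i != 0 /\ P *m v i = lam i *: v i].

Definition in_general_position {n m : nat} (psi : 'M[R]_n)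
    (v : 'I_m -> 'cV[R]_n) : Prop :=
  forall i j : 'I_m,
    psi *m v i \notin <<[seq v l | l <- enum 'I_m & l != j]>>%VS.

Definition one_typical A p z (lam : 'I_k -> R) (v : 'I_k -> 'cV[R]_k) : Prop :=
  [/\ periodic p, (Ws p `&` Wu p) z, z <> p,
      simple_spectrum (return_map A p) lam v
    & in_general_position (homoclinic_map A p z) v].

Definition eigenvalue_product (t : nat) (lam : 'I_k -> R)
    (s : 'I_#|incr t k|) : R :=
  \prod_(a < t) lam (incr_of s a).

Definition wedge_eigenvector (t : nat) (v : 'I_k -> 'cV[R]_k)
    (s : 'I_#|incr t k|) : 'cV[R]_#|incr t k| :=
  wedge (fun a : 'I_t => v (incr_of s a)).

Definition t_typical A (t : nat) p z (lam : 'I_k -> R)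
    (v : 'I_k -> 'cV[R]_k) : Prop :=
  one_typical A p z lam v /\
  ((2 <= t)%N ->
    injective (@eigenvalue_product t lam) /\
    in_general_position (extpow t (homoclinic_map A p z))
      (@wedge_eigenvector t v)).

Definition typical A : Prop :=
  exists p z (lam : 'I_k -> R) (v : 'I_k -> 'cV[R]_k),
    forall t : nat, (1 <= t <= k.-1)%N -> t_typical A t p z lam v.

Definition typical_cocycles (omega r : R) : set (subshift Q -> 'M[R]_k) :=
  Hrb omega r `&` [set A | typical A].

(** ** The Lyapunov spectrum *)

(** The coordinate of index [i : 'I_k] is the one numbered i + 1. *)
Definition level_set A (alpha : 'rV[R]_k) : set (subshift Q) :=
  [set x | forall i : 'I_k,
    (n%:R^-1 * ln (opnorm (extpow i.+1 (cocycle A n%:Z x))))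
      @[n --> \oo] --> alpha 0 i].

Definition Lspectrum A : set 'rV[R]_k :=
  [set alpha | level_set A alpha !=set0].

End Cocycles.

(* Main.v *)
(** Fiber bunching makes [A^n(y)^-1 A^n(x)] converge along stable and unstable sets, so two finite
    words can be joined by an orbit that shadows the periodic point [p], then the homoclinic point
    [z], then [p] again; the joining matrix is [Y P^l E P^l X] in an eigenbasis of [P], with [E]
    close to the holonomy loop.  Complete pivoting of the two words turns a lower bound on all
    exterior powers at once into the nonvanishing of leading minors of this matrix.  By echelon
    reduction and typicality these minors are nonzero for large [l]; compactness of the pivot
    factors makes [l] and the lower bound uniform.  Hence [log ||(A^n)^{/\ t}||] is, simultaneously
    for all [t], additive up to a bounded error under concatenation with bounded gaps.

    For such almost additive functions, concatenating ever better approximations of a rate along a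
    slowly growing schedule yields points whose rate is exactly that limit, so the spectrum is
    closed; and if exponentially many words approximate the rate at each stage, a light-subtree
    argument shows that no cheap Bowen cover exists, so the level set has positive entropy.
    Positive topological entropy provides a rate [beta] carried by exponentially many words, and
    [(N alpha + beta) / (N + 1)] approximates any [alpha] of the spectrum by rates of positive
    entropy. *)
Require Import Defs.
From mathcomp Require Import all_boot all_order all_algebra.
From mathcomp Require Import all_fingroup.
From mathcomp Require Import all_classical all_reals all_analysis.
From mathcomp Require Import zify ring lra.
Import Order.TTheory GRing.Theory Num.Theory.
Import numFieldNormedType.Exports.
Local Open Scope classical_set_scope.
Local Open Scope ring_scope.
Set Implicit Arguments.
Unset Strict Implicit.
Unset Printing Implicit Defensive.

(** * Euclidean and operator norms *)

Section Norms.
Context {R : realType}.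

(** Two obstacles shape the first half. One connecting word must serve all exterior powers at once.
    Leading minors allow this: the echelon form of an invertible [X] yields one injection [f] whose
    first [t] values select the dominant rows for every order [t] simultaneously. The top power is
    different, but there determinants multiply exactly. The other obstacle is the order of choices.
    The time [l] spent near [p] is found only after the outer factors [X] and [Y] are known, so
    these must not depend on [l]; the ratios entering them are therefore taken at one common long
    time, and all dependence on [l] is moved into the centre [E]. Since [E] approaches the loop only
    as [l] grows, its tolerance must be fixed before [l], while the lower bound on the minors may
    depend on [l]. As [l] varies with the words, only a bound [L] on the gaps is available. In the
    second half each count of words therefore loses a factor of order [L], and rates of entropy are
    halved to absorb such losses. *)

Lemma enorm_ge0 n (v : 'cV[R]_n) : 0 <= enorm v.
Proof. exact: sqrtr_ge0. Qed.

Lemma sumsq_ge0 n (v : 'cV[R]_n) : 0 <= \sum_(i < n) v i 0 ^+ 2.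
Proof. by apply: sumr_ge0 => i _; exact: sqr_ge0. Qed.

Lemma enorm_sq n (v : 'cV[R]_n) : enorm v ^+ 2 = \sum_(i < n) v i 0 ^+ 2.
Proof. by rewrite /enorm sqr_sqrtr // sumsq_ge0. Qed.

Lemma enorm0 n : enorm (0 : 'cV[R]_n) = 0.
Proof.
rewrite /enorm big1 ?sqrtr0 // => i _; by rewrite mxE expr0n.
Qed.

Lemma enorm_eq0 n (v : 'cV[R]_n) : enorm v = 0 -> v = 0.
Proof.
move=> v0; apply/matrixP => i j; rewrite ord1 mxE.
have: \sum_(i < n) v i 0 ^+ 2 = 0 by rewrite -enorm_sq v0 expr0n.
move/eqP; rewrite psumr_eq0; last by move=> *; exact: sqr_ge0.
by move/allP/(_ i); rewrite mem_index_enum => /(_ isT); rewrite sqrf_eq0 => /eqP.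
Qed.

Lemma enormZ n (c : R) (v : 'cV[R]_n) : enorm (c *: v) = `|c| * enorm v.
Proof.
rewrite /enorm -sqrtr_sqr -sqrtrM ?sqr_ge0//; congr Num.sqrt.
by rewrite mulr_sumr; apply: eq_bigr => i _; rewrite mxE exprMn.
Qed.

Lemma dot_le n (u v : 'cV[R]_n) :
  \sum_(i < n) u i 0 * v i 0 <= enorm u * enorm v.
Proof.
have [u0|u0] := eqVneq (enorm u) 0.
  rewrite u0 mul0r big1// => i _.
  by rewrite (enorm_eq0 u0) mxE mul0r.
have [v0|v0] := eqVneq (enorm v) 0.
  rewrite v0 mulr0 big1// => i _.
  by rewrite (enorm_eq0 v0) mxE mulr0.
have up : 0 < enorm u by rewrite lt_def u0 enorm_ge0.
have vp : 0 < enorm v by rewrite lt_def v0 enorm_ge0.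
have : 0 <= \sum_(i < n) (enorm v * u i 0 - enorm u * v i 0) ^+ 2.
  by apply: sumr_ge0 => i _; exact: sqr_ge0.
have -> : \sum_(i < n) (enorm v * u i 0 - enorm u * v i 0) ^+ 2 =
   enorm v ^+ 2 * \sum_(i < n) u i 0 ^+ 2 + enorm u ^+ 2 * \sum_(i < n) v i 0 ^+ 2
   - 2 * enorm u * enorm v * \sum_(i < n) u i 0 * v i 0.
  rewrite !mulr_sumr -big_split /= -sumrB; apply: eq_bigr => i _; ring.
rewrite -!enorm_sq => h.
have p : 0 < enorm u * enorm v by exact: mulr_gt0.
rewrite -(ler_pM2l p); nra.
Qed.

Lemma enormD n (u v : 'cV[R]_n) : enorm (u + v) <= enorm u + enorm v.
Proof.
rewrite -(ler_pXn2r (n := 2)) ?nnegrE ?addr_ge0 ?enorm_ge0// sqrrD !enorm_sq.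
have -> : \sum_(i < n) (u + v) i 0 ^+ 2 = \sum_(i < n) u i 0 ^+ 2 +
   2 * (\sum_(i < n) u i 0 * v i 0) + \sum_(i < n) v i 0 ^+ 2.
  rewrite mulr_sumr -!big_split /=; apply: eq_bigr => i _; rewrite mxE; ring.
have := dot_le u v; lra.
Qed.

Lemma entry_le_enorm n (v : 'cV[R]_n) i : `|v i 0| <= enorm v.
Proof.
rewrite -sqrtr_sqr ler_sqrt ?sumsq_ge0// (bigD1 i)//= lerDl.
by apply: sumr_ge0 => j _; exact: sqr_ge0.
Qed.

Lemma enorm_delta n (j : 'I_n) : enorm (delta_mx j 0 : 'cV[R]_n) = 1.
Proof.
rewrite /enorm (bigD1 j)//= big1 ?addr0 => [|i ij].
  by rewrite mxE !eqxx expr1n sqrtr1.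
by rewrite mxE (negbTE ij) expr0n.
Qed.

Lemma enorm_le_sum n (v : 'cV[R]_n) : enorm v <= \sum_i `|v i 0|.
Proof.
have -> : v = \sum_i v i 0 *: delta_mx i 0.
  apply/matrixP => i j; rewrite ord1 summxE (bigD1 i)//= big1 ?addr0.
    by rewrite !mxE !eqxx mulr1.
  by move=> l li; rewrite !mxE eq_sym (negbTE li) mulr0.
rewrite [X in _ <= X](eq_bigr (fun i => `|v i 0|)); last first.
  move=> i _; congr `|_|; rewrite summxE (bigD1 i)//= big1 ?addr0.
    by rewrite !mxE !eqxx mulr1.
  by move=> l li; rewrite !mxE eq_sym (negbTE li) mulr0.
elim/big_rec2 : _ => [|i y x _ h]; first by rewrite enorm0.
by apply: (le_trans (enormD _ _)); rewrite lerD // enormZ enorm_delta mulr1.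
Qed.

(** The entrywise l1 norm, a crude bound showing that the set whose supremum defines [opnorm] is
    bounded; the [sup] of an unbounded set would be a default value. *)
Definition asum m n (B : 'M[R]_(m, n)) : R := \sum_i \sum_j `|B i j|.

Lemma asum_ge0 m n (B : 'M[R]_(m, n)) : 0 <= asum B.
Proof. by apply: sumr_ge0 => i _; apply: sumr_ge0. Qed.

Lemma enorm_mul_le m n (B : 'M[R]_(m, n)) v : enorm (B *m v) <= asum B * enorm v.
Proof.
apply: (le_trans (enorm_le_sum _)); rewrite mulr_suml; apply: ler_sum => i _.
rewrite mxE mulr_suml; apply: (le_trans (ler_norm_sum _ _ _)).
by apply: ler_sum => j _; rewrite normrM ler_wpM2l// entry_le_enorm.
Qed.

Lemma opnorm_has_sup m n (B : 'M[R]_(m, n)) :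
  has_sup [set enorm (B *m v) | v in [set v : 'cV[R]_n | enorm v <= 1]].
Proof.
split; first by exists (enorm (B *m 0)), 0 => //=; rewrite enorm0.
exists (asum B) => _ /= [v v1 <-].
by apply: (le_trans (enorm_mul_le _ _)); rewrite ler_piMr// asum_ge0.
Qed.

Lemma opnorm_ub m n (B : 'M[R]_(m, n)) v : enorm v <= 1 -> enorm (B *m v) <= opnorm B.
Proof. by move=> v1; apply: sup_ubound; [case: (opnorm_has_sup B)|exists v]. Qed.

Lemma opnorm_ge0 m n (B : 'M[R]_(m, n)) : 0 <= opnorm B.
Proof. by apply: le_trans (@opnorm_ub _ _ B 0 _); rewrite ?enorm_ge0 ?enorm0. Qed.

Lemma opnorm_le m n (B : 'M[R]_(m, n)) c : 0 <= c ->
  (forall v, enorm (B *m v) <= c * enorm v) -> opnorm B <= c.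
Proof.
move=> c0 h; apply: ge_sup; first by case: (opnorm_has_sup B).
by move=> _ /= [v v1 <-]; apply: (le_trans (h v)); rewrite ler_piMr.
Qed.

Lemma opnormP m n (B : 'M[R]_(m, n)) v : enorm (B *m v) <= opnorm B * enorm v.
Proof.
have [v0|v0] := eqVneq (enorm v) 0.
  by rewrite v0 mulr0 (enorm_eq0 v0) mulmx0 enorm0.
have vp : 0 < enorm v by rewrite lt_def v0 enorm_ge0.
have := @opnorm_ub _ _ B ((enorm v)^-1 *: v).
rewrite -scalemxAr !enormZ ger0_norm ?invr_ge0 ?enorm_ge0// mulVf// lexx => /(_ isT).
by rewrite mulrC ler_pdivrMr.
Qed.

Lemma opnormM m n p (B : 'M[R]_(m, n)) (C : 'M[R]_(n, p)) :
  opnorm (B *m C) <= opnorm B * opnorm C.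
Proof.
apply: opnorm_le => [|v]; first by rewrite mulr_ge0 ?opnorm_ge0.
rewrite -mulmxA; apply: (le_trans (opnormP _ _)).
by rewrite -mulrA ler_wpM2l ?opnorm_ge0// opnormP.
Qed.

Lemma opnormD m n (B C : 'M[R]_(m, n)) : opnorm (B + C) <= opnorm B + opnorm C.
Proof.
apply: opnorm_le => [|v]; first by rewrite addr_ge0 ?opnorm_ge0.
rewrite mulmxDl mulrDl; apply: (le_trans (enormD _ _)).
by rewrite lerD ?opnormP.
Qed.

Lemma opnorm_le_asum m n (B : 'M[R]_(m, n)) : opnorm B <= asum B.
Proof. by apply: opnorm_le (enorm_mul_le B); exact: asum_ge0. Qed.

Lemma entry_le_opnorm m n (B : 'M[R]_(m, n)) i j : `|B i j| <= opnorm B.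
Proof.
have := @opnorm_ub _ _ B (delta_mx j 0); rewrite enorm_delta lexx => /(_ isT).
apply: le_trans; rewrite -colE.
by apply: le_trans (entry_le_enorm _ i); rewrite mxE.
Qed.

Lemma opnorm_le_entries m n (B : 'M[R]_(m, n)) c :
  (forall i j, `|B i j| <= c) -> opnorm B <= c * (m * n)%:R.
Proof.
move=> h; apply: (le_trans (opnorm_le_asum B)).
apply: (@le_trans _ _ (\sum_(i < m) \sum_(j < n) c)).
  by apply: ler_sum => i _; apply: ler_sum.
by rewrite !sumr_const !card_ord -mulrnA mulr_natr mulnC.
Qed.

Lemma opnormN m n (B : 'M[R]_(m, n)) : opnorm (- B) = opnorm B.
Proof.
rewrite /opnorm; congr sup; apply/seteqP; split => _ [v v1 <-]; exists v => //.
  by rewrite mulNmx -scaleN1r enormZ normrN1 mul1r.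
by rewrite mulNmx -scaleN1r enormZ normrN1 mul1r.
Qed.

Lemma opnormB m n (B C : 'M[R]_(m, n)) : opnorm (B - C) = opnorm (C - B).
Proof. by rewrite -opnormN opprB. Qed.

Lemma opnorm_triB m n (B C D : 'M[R]_(m, n)) :
  opnorm (B - D) <= opnorm (B - C) + opnorm (C - D).
Proof. by apply: le_trans (opnormD _ _); rewrite addrA subrK. Qed.

Lemma opnorm_triBD m n (B C : 'M[R]_(m, n)) : opnorm B <= opnorm C + opnorm (B - C).
Proof. by apply: le_trans (opnormD _ _); rewrite addrC subrK. Qed.

Lemma opnorm1 n : opnorm (1%:M : 'M[R]_n) <= 1.
Proof. by apply: opnorm_le => // v; rewrite mul1mx mul1r. Qed.

Lemma opnorm0 m n : opnorm (0 : 'M[R]_(m, n)) = 0.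
Proof.
apply: le_anti; rewrite opnorm_ge0 andbT.
by apply: opnorm_le => // v; rewrite mul0mx enorm0 mul0r.
Qed.

Lemma opnorm_unit_gt0 n (B : 'M[R]_n) : (0 < n)%N -> B \in unitmx -> 0 < opnorm B.
Proof.
case: n B => // n B _ Bu; rewrite lt_def opnorm_ge0 andbT; apply/eqP => B0.
have : B = 0.
  apply/matrixP => i j; rewrite mxE; apply/eqP; rewrite -normr_le0 -B0.
  exact: entry_le_opnorm.
move=> /(congr1 (mulmx (invmx B))); rewrite mulVmx// mulmx0.
by move=> /matrixP/(_ 0 0); rewrite !mxE eqxx => /eqP; rewrite oner_eq0.
Qed.

End Norms.

(** * Minors, exterior powers and the Cauchy-Binet formula *)

Section Minors.
Context {R : realType}.

(** Selections are arbitrary functions, so that minors can be summed over all of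
    [{ffun 'I_t -> 'I_k}] and permuted freely before being reduced to increasing selections. *)
Definition minor t m n (f : 'I_t -> 'I_m) (g : 'I_t -> 'I_n) (B : 'M[R]_(m, n)) : R :=
  \det (\matrix_(a < t, b < t) B (f a) (g b)).

Lemma extpowE t k (B : 'M[R]_k) s u :
  extpow t B s u = minor (incr_of s) (incr_of u) B.
Proof.
rewrite !mxE /minor; congr (\det _); apply/matrixP => a b; by rewrite !mxE.
Qed.

Lemma incrP t k (s : {ffun 'I_t -> 'I_k}) :
  reflect (forall a b : 'I_t, (a < b)%N -> (s a < s b)%N) (s \in incr t k).
Proof.
rewrite inE; apply: (iffP forallP) => [h a b ab|h a].
  by have /forallP/(_ b)/implyP := h a; apply.
by apply/forallP => b; apply/implyP; apply: h.
Qed.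

Lemma incr_mono t k (s : {ffun 'I_t -> 'I_k}) : s \in incr t k ->
  forall a b : 'I_t, (s a < s b)%N = (a < b)%N.
Proof.
move=> /incrP h a b; case: (ltngtP a b) => [/h->//|/h ba|/val_inj->].
  by apply/negbTE; rewrite -leqNgt ltnW.
by rewrite ltnn.
Qed.

Lemma incr_inj t k (s : {ffun 'I_t -> 'I_k}) : s \in incr t k -> injective s.
Proof.
move=> /incr_mono h a b e; apply: val_inj; apply/eqP; rewrite eqn_leq.
by rewrite leqNgt -h e ltnn leqNgt -h e ltnn.
Qed.

Definition fperm t k (s : {ffun 'I_t -> 'I_k}) (p : {perm 'I_t}) :
  {ffun 'I_t -> 'I_k} := [ffun a => s (p a)].

(** The position of [f a] among the sorted values of [f]. For injective [f] this is a permutation,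
    and [f] is the increasing enumeration of its image composed with it. *)
Definition frank t k (f : 'I_t -> 'I_k) (a : 'I_t) : nat :=
  #|[pred b | (f b < f a)%N]|.

Lemma frank_lt t k (f : 'I_t -> 'I_k) a : (frank f a < t)%N.
Proof.
rewrite -[X in (_ < X)%N]card_ord /frank; apply: proper_card.
by apply/properP; split; [exact/fintype.subsetP|exists a => //=; rewrite inE ltnn].
Qed.

Lemma frank_mono t k (f : 'I_t -> 'I_k) a b : (f a < f b)%N -> (frank f a < frank f b)%N.
Proof.
move=> ab; apply: proper_card; apply/properP; split.
  by apply/fintype.subsetP => c; rewrite !inE => /ltn_trans; exact.
by exists a; rewrite !inE ?ltnn.
Qed.

Lemma frank_inj t k (f : 'I_t -> 'I_k) : injective f ->
  injective (fun a => Ordinal (frank_lt f a)).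
Proof.
move=> fi a b /(congr1 val)/= e; apply: fi; apply: val_inj.
by case: (ltngtP (f a) (f b)) => // /frank_mono; rewrite e ltnn.
Qed.

Lemma frank_incr t k (s : {ffun 'I_t -> 'I_k}) (p : {perm 'I_t}) a :
  s \in incr t k -> frank (fperm s p) a = p a.
Proof.
move=> /incr_mono h; rewrite /frank.
rewrite (eq_card (B := [pred b | p b < p a]%N)); last first.
  by move=> b; rewrite !inE !ffunE h.
rewrite -(card_imset (mem [pred b | p b < p a]%N) (@perm_inj _ p)).
rewrite (eq_card (B := [pred b : 'I_t | b < p a]%N)); last first.
  move=> b; rewrite !inE; apply/imsetP/idP => [[c + ->]|bp]; first by rewrite !inE.
  by exists ((p^-1)%g b); rewrite ?inE ?permKV.
by rewrite -sum1_card (big_ord_narrow (ltnW (ltn_ord _))) sum1_card card_ord.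
Qed.

(** Together with [fperm_inj]: an injective selection factors in exactly one way through an
    increasing one, which is the bijection behind [sum_injective_ffun]. *)
Lemma fpermP t k (f : {ffun 'I_t -> 'I_k}) : injective f ->
  exists s p, s \in incr t k /\ f = fperm s p.
Proof.
move=> fi; pose p := perm (frank_inj fi).
exists [ffun a => f ((p^-1)%g a)], p; split; last by apply/ffunP => a; rewrite !ffunE permK.
apply/incrP => a b ab; rewrite !ffunE.
have pE c : val (p c) = frank f c by rewrite permE.
case: (ltngtP (f ((p^-1)%g a)) (f ((p^-1)%g b))) => //.
  move=> /frank_mono; rewrite -!pE !permKV /= => /(ltn_trans ab).
  by rewrite ltnn.
by move=> /val_inj/fi/perm_inj e; rewrite e ltnn in ab.
Qed.

Lemma fperm_injective t k (f : {ffun 'I_t -> 'I_k}) (p : {perm 'I_t}) :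
  injective f -> injective (fperm f p).
Proof. by move=> fi a b; rewrite !ffunE => /fi/perm_inj. Qed.

Lemma fperm_inj t k (x y : {ffun 'I_t -> 'I_k} * {perm 'I_t}) :
  x.1 \in incr t k -> y.1 \in incr t k -> fperm x.1 x.2 = fperm y.1 y.2 -> x = y.
Proof.
case: x y => [s p] [s' p'] /= hs hs' e.
have pp : p = p'.
  by apply/permP => a; apply: val_inj; rewrite /= -(frank_incr p a hs) e frank_incr.
subst p'; congr (_, _); apply/ffunP => a.
by move/ffunP/(_ ((p^-1)%g a)): e; rewrite !ffunE permKV.
Qed.

Lemma minor_permr t m n (f : 'I_t -> 'I_m) (g : {ffun 'I_t -> 'I_n}) p B :
  minor f (fperm g p) B = (-1) ^+ p * minor f g B.
Proof.
rewrite /minor -det_perm mulrC -det_mulmx.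
have -> : \matrix_(a < t, b < t) B (f a) (fperm g p b) =
  col_perm p (\matrix_(a < t, b < t) B (f a) (g b)).
  by apply/matrixP => a b; rewrite !mxE ffunE.
by rewrite col_permE !det_mulmx !det_perm odd_permV.
Qed.

Lemma minor_perml t m n (f : {ffun 'I_t -> 'I_m}) (g : 'I_t -> 'I_n) p B :
  minor (fperm f p) g B = (-1) ^+ p * minor f g B.
Proof.
rewrite /minor -det_perm -det_mulmx.
have -> : \matrix_(a < t, b < t) B (fperm f p a) (g b) =
  row_perm p (\matrix_(a < t, b < t) B (f a) (g b)).
  by apply/matrixP => a b; rewrite !mxE ffunE.
by rewrite row_permE !det_mulmx !det_perm.
Qed.

Lemma minor_noninjl t m n (f : {ffun 'I_t -> 'I_m}) (g : 'I_t -> 'I_n) B :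
  ~~ injectiveb f -> minor f g B = 0.
Proof.
move=> /injectivePn[a [b ab e]]; apply: (determinant_alternate ab) => c.
by rewrite !mxE e.
Qed.

Lemma det_mulmx_ffun t k (B : 'M[R]_(t, k)) (C : 'M[R]_(k, t)) :
  \det (B *m C) = \sum_(g : {ffun 'I_t -> 'I_k})
     (\prod_a B a (g a)) * \det (\matrix_(a < t, b < t) C (g a) b).
Proof.
rewrite /determinant.
under eq_bigr => s _.
  under eq_bigr => i _ do rewrite mxE.
  rewrite bigA_distr_bigA /= mulr_sumr.
  over.
rewrite exchange_big /=; apply: eq_bigr => g _.
rewrite mulr_sumr; apply: eq_bigr => s _.
rewrite big_split /= mulrCA; congr (_ * (_ * _)).
by apply: eq_bigr => a _; rewrite mxE.
Qed.

(** Each increasing selection is counted [t!] times, once per reordering. Expanding [minor f g B]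
    over permutations and reindexing [g] by the permutation turns every summand into the same
    expansion of [minor f h (B *m C)], the sign coming back from the rows of [C]. *)
Lemma minor_mul_full t m k n (f : 'I_t -> 'I_m) (h : 'I_t -> 'I_n)
    (B : 'M[R]_(m, k)) (C : 'M[R]_(k, n)) :
  \sum_(g : {ffun 'I_t -> 'I_k}) minor f g B * minor g h C =
  (t`!)%:R * minor f h (B *m C).
Proof.
have E : minor f h (B *m C) = \sum_(g : {ffun 'I_t -> 'I_k})
    (\prod_a B (f a) (g a)) * minor g h C.
  have -> : minor f h (B *m C) =
     \det ((\matrix_(a < t, j < k) B (f a) j) *m (\matrix_(j < k, b < t) C j (h b))).
    congr (\det _); apply/matrixP => a b; rewrite !mxE.
    by apply: eq_bigr => j _; rewrite !mxE.
  rewrite det_mulmx_ffun; apply: eq_bigr => g _; congr (_ * _).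
    by apply: eq_bigr => a _; rewrite mxE.
  by congr (\det _); apply/matrixP => a b; rewrite !mxE.
rewrite {2}/minor {1}/determinant.
under eq_bigr => g _ do rewrite [X in X * _]/minor /determinant mulr_suml.
rewrite exchange_big /= -[(t`!)%:R]/(1 *+ t`!) -card_Sn -sumr_const mulr_suml.
rewrite [RHS](eq_bigl xpredT); last by move=> p; rewrite inE.
apply: eq_bigr => p _; rewrite mul1r -/(minor f h (B *m C)) E.
rewrite [RHS](reindex_inj (h := fun g : {ffun 'I_t -> 'I_k} => fperm g p)); last first.
  move=> g g' /ffunP e; apply/ffunP => a; have := e ((p^-1)%g a); by rewrite !ffunE permKV.
apply: eq_bigr => g _; rewrite /= minor_perml mulrCA mulrA; congr (_ * _ * _).
by apply: eq_bigr => a _; rewrite mxE ffunE.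
Qed.

Lemma sum_injective_ffun t k (F : {ffun 'I_t -> 'I_k} -> R) :
  (forall s p, F (fperm s p) = F s) -> (forall g : {ffun 'I_t -> 'I_k}, ~~ injectiveb g -> F g = 0) ->
  \sum_g F g = (t`!)%:R * \sum_(s in incr t k) F s.
Proof.
move=> Fp F0.
rewrite (bigID (fun g : {ffun 'I_t -> 'I_k} => injectiveb g)) /= [X in _ + X]big1 ?addr0; last first.
  by move=> g /F0.
pose D := [set x : {ffun 'I_t -> 'I_k} * {perm 'I_t} | x.1 \in incr t k]%SET.
have DE x : (x \in D) = (x.1 \in incr t k) by rewrite inE.
transitivity (\sum_(g in [set fperm x.1 x.2 | x in D]%SET) F g).
  apply: eq_bigl => g; apply/idP/imsetP => [/injectiveP/fpermP[s [p [hs ->]]]|[[s p]]].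
    by exists (s, p) => //; rewrite DE.
  rewrite DE /= => /incr_inj hs ->; apply/injectiveP; exact: fperm_injective.
rewrite big_imset /=; last first.
  by move=> x y; rewrite !DE => hx hy; exact: (fperm_inj hx hy).
transitivity (\sum_(s in incr t k) \sum_(p : {perm 'I_t}) F (fperm s p)).
  by rewrite pair_big_dep /=; apply: eq_bigl => -[s p]; rewrite DE andbT.
rewrite mulr_sumr; apply: eq_bigr => s _.
under eq_bigr => p _ do rewrite Fp.
by rewrite sumr_const mulr_natl -card_Sn; congr (_ *+ _); apply: eq_card => p; rewrite !inE.
Qed.

Lemma cauchy_binet t m k n (f : 'I_t -> 'I_m) (h : 'I_t -> 'I_n)
    (B : 'M[R]_(m, k)) (C : 'M[R]_(k, n)) :
  minor f h (B *m C) =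
  \sum_(s < #|incr t k|) minor f (incr_of s) B * minor (incr_of s) h C.
Proof.
have t0 : (t`!)%:R != 0 :> R by rewrite pnatr_eq0 -lt0n fact_gt0.
apply: (mulfI t0); rewrite -minor_mul_full sum_injective_ffun; last 2 first.
- move=> s p; rewrite minor_perml minor_permr mulrACA -signr_addb addbb mul1r.
  by [].
- by move=> g /minor_noninjl ->; rewrite mulr0.
by rewrite [X in _ * X = _]big_enum_val.
Qed.

Lemma extpowM t k (B C : 'M[R]_k) : extpow t (B *m C) = extpow t B *m extpow t C.
Proof.
apply/matrixP => s u; rewrite extpowE cauchy_binet mxE.
by apply: eq_bigr => v _; rewrite !extpowE.
Qed.

(** Lets conditions on increasing selections, as in typicality, be applied to the unordered
    selections that the echelon form produces. *)
Lemma minor_inj_eq t m n (f : 'I_t -> 'I_m) (g : 'I_t -> 'I_n) B :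
  injective f -> injective g -> exists (s : 'I_#|incr t m|) (u : 'I_#|incr t n|),
  `|minor f g B| = `|minor (incr_of s) (incr_of u) B|.
Proof.
move=> fi gi.
have [s [p [hs fE]]] : exists s p, s \in incr t m /\ [ffun a => f a] = fperm s p.
  by apply: fpermP => a b; rewrite !ffunE => /fi.
have [u [v [hu gE]]] : exists s p, s \in incr t n /\ [ffun a => g a] = fperm s p.
  by apply: fpermP => a b; rewrite !ffunE => /gi.
exists (enum_rank_in hs s), (enum_rank_in hu u).
rewrite /incr_of !enum_rankK_in//.
have -> : minor f g B = minor [ffun a => f a] [ffun a => g a] B.
  by congr (\det _); apply/matrixP => a b; rewrite !mxE !ffunE.
by rewrite fE gE minor_perml minor_permr !normrM !normrX normrN1 !expr1n !mul1r.
Qed.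

Definition lead t k (tk : (t <= k)%N) : {ffun 'I_t -> 'I_k} := [ffun a => widen_ord tk a].

Lemma lead_incr t k (tk : (t <= k)%N) : lead tk \in incr t k.
Proof. by apply/incrP => a b ab; rewrite !ffunE. Qed.

Lemma incr_ge t k (s : {ffun 'I_t -> 'I_k}) : s \in incr t k -> forall a : 'I_t, (a <= s a)%N.
Proof.
move=> /incrP h [a at_]; elim: a at_ => // a IH at_ /=.
have at' : (a < t)%N by exact: ltnW.
by apply: (leq_ltn_trans (IH at')); apply: h.
Qed.

(** If no value reaches [t], strict monotonicity forces [s c <= c] by descending from the last
    index, while [incr_ge] gives the converse inequality. *)
Lemma incr_neq_lead t k (tk : (t <= k)%N) s : s \in incr t k -> s != lead tk ->
  exists a : 'I_t, (t <= s a)%N.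
Proof.
move=> hs ne; apply/existsP; apply: contraNT ne; rewrite negb_exists => /forallP h.
apply/eqP/ffunP => -[a at_]; rewrite ffunE; apply: val_inj => /=.
have h' : forall d c (ct : (c < t)%N), (d = t - c)%N -> (s (Ordinal ct) <= c)%N.
  elim=> [|d IH] c ct dE; first by lia.
  have [ct'|ct'] := ltnP c.+1 t; last first.
    by have := h (Ordinal ct); rewrite -ltnNge; lia.
  have := IH c.+1 ct'; have -> : (d = t - c.+1)%N by lia.
  move=> /(_ erefl) => h1.
  have : (s (Ordinal ct) < s (Ordinal ct'))%N by move/incrP: hs; apply => /=.
  by move=> h2; rewrite -ltnS; apply: leq_trans h1.
by apply/eqP; rewrite eqn_leq (h' _ _ at_ erefl) (incr_ge hs (Ordinal at_)).
Qed.

Lemma minor_row0 t m n (f : 'I_t -> 'I_m) (g : 'I_t -> 'I_n) (B : 'M[R]_(m, n)) a :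
  (forall b, B (f a) (g b) = 0) -> minor f g B = 0.
Proof.
move=> h; rewrite /minor (expand_det_row _ a) big1// => b _.
by rewrite mxE h mul0r.
Qed.

(** [U] adds to each column multiples of earlier columns only. In Cauchy-Binet, every selection
    other than the leading one meets a row of index at least [t], where the first [t] columns of [U]
    vanish. *)
Lemma minor_unitri_r t m k (tk : (t <= k)%N) (f : 'I_t -> 'I_m) (M : 'M[R]_(m, k)) (U : 'M[R]_k) :
  (forall i j : 'I_k, (j < i)%N -> U i j = 0) -> (forall i, U i i = 1) ->
  minor f (lead tk) (M *m U) = minor f (lead tk) M.
Proof.
move=> U0 U1; rewrite cauchy_binet.
pose s0 := enum_rank_in (lead_incr tk) (lead tk).
have s0E : incr_of s0 = lead tk by rewrite /incr_of enum_rankK_in// lead_incr.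
rewrite (bigD1 s0)//= big1 ?addr0; last first.
  move=> s ss0; have [] := @incr_neq_lead _ _ tk (incr_of s) (enum_valP s).
    apply: contra ss0 => /eqP e; apply/eqP; apply: enum_val_inj.
    by rewrite -/(incr_of s) e -s0E.
  move=> a ta; rewrite [X in _ * X](minor_row0 (a := a)) ?mulr0// => b.
  by apply: U0; rewrite ffunE /=; apply: leq_trans ta.
rewrite s0E [X in _ * X](_ : _ = 1) ?mulr1// /minor.
rewrite -det_tr det_trig.
  by rewrite big1// => a _; rewrite !mxE U1.
apply/is_trig_mxP => a b ab; rewrite !mxE; apply: U0; by rewrite !ffunE.
Qed.

Lemma minor_tr t m n (f : 'I_t -> 'I_m) (g : 'I_t -> 'I_n) B :
  minor g f B^T = minor f g B.
Proof.
by rewrite /minor -det_tr; congr (\det _); apply/matrixP => a b; rewrite !mxE.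
Qed.

Lemma minor_scale t m n (f : 'I_t -> 'I_m) (g : 'I_t -> 'I_n) (d : 'I_m -> R) (d' : 'I_n -> R)
   (M M' : 'M[R]_(m, n)) :
  (forall i j, M' i j = d i * M i j * d' j) ->
  minor f g M' = (\prod_a d (f a)) * minor f g M * \prod_a d' (g a).
Proof.
move=> h.
have -> : minor f g M' = \det (diag_mx (\row_a d (f a)) *m (\matrix_(a < t, b < t) M (f a) (g b))
   *m diag_mx (\row_a d' (g a))).
  congr (\det _); apply/matrixP => a b.
  by rewrite mul_mx_diag mul_diag_mx !mxE h.
rewrite !det_mulmx !det_diag; congr (_ * _ * _); by apply: eq_bigr => a _; rewrite mxE.
Qed.

End Minors.

(** * Complete pivoting with controlled factors *)

Section Pivoting.
Context {R : realType}.

(** Quantitative invertibility: for fixed [c] these matrices form a compact set, which later makes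
    the constants uniform over all words. *)
Definition controlled n (c : R) (K : 'M[R]_n) :=
  [/\ K \in unitmx, opnorm K <= c & opnorm (invmx K) <= c].

Lemma invmx_mul n (B C : 'M[R]_n) : B \in unitmx -> C \in unitmx ->
  invmx (B *m C) = invmx C *m invmx B.
Proof.
move=> Bu Cu; have BCu : B *m C \in unitmx by rewrite unitmx_mul Bu.
apply: (can_inj (mulmxK BCu)); rewrite mulVmx//.
by rewrite -mulmxA (mulmxA (invmx B)) mulVmx// mul1mx mulVmx.
Qed.

Lemma invmx_uniq n (B C : 'M[R]_n) : B *m C = 1%:M -> B \in unitmx /\ invmx B = C.
Proof.
move=> BC; have [Bu Cu] := mulmx1_unit BC; split => //.
by apply: (can_inj (mulKmx Bu)); rewrite BC mulmxV.
Qed.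

Lemma controlled_mul n c d (B C : 'M[R]_n) : controlled c B -> controlled d C ->
  controlled (c * d) (B *m C).
Proof.
move=> [Bu B1 B2] [Cu C1 C2]; split; first by rewrite unitmx_mul Bu.
  by apply: (le_trans (opnormM _ _)); rewrite ler_pM ?opnorm_ge0.
rewrite invmx_mul// mulrC; apply: (le_trans (opnormM _ _)).
by rewrite ler_pM ?opnorm_ge0.
Qed.

Lemma controlled_le n c d (B : 'M[R]_n) : c <= d -> controlled c B -> controlled d B.
Proof. by move=> cd [Bu B1 B2]; split => //; apply: (le_trans _ cd). Qed.

Lemma controlled_inv n c (B : 'M[R]_n) : controlled c B -> controlled c (invmx B).
Proof. by move=> [Bu B1 B2]; split; rewrite ?invmxK ?unitmx_inv. Qed.

Lemma controlled1 n : controlled 1 (1%:M : 'M[R]_n).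
Proof. by split; rewrite ?unitmx1 ?invmx1 ?opnorm1. Qed.

Lemma controlled_entries n c (K K' : 'M[R]_n) : K *m K' = 1%:M ->
  (forall i j, `|K i j| <= c) -> (forall i j, `|K' i j| <= c) ->
  controlled (c * (n * n)%:R) K.
Proof.
move=> KK' h h'; have [Ku Ki] := invmx_uniq KK'.
by split => //; rewrite ?Ki; apply: opnorm_le_entries.
Qed.

Lemma block_entries_le m1 m2 n1 n2 c (B1 : 'M[R]_(m1, n1)) (B2 : 'M[R]_(m1, n2))
    (B3 : 'M[R]_(m2, n1)) (B4 : 'M[R]_(m2, n2)) :
  (forall i j, `|B1 i j| <= c) -> (forall i j, `|B2 i j| <= c) ->
  (forall i j, `|B3 i j| <= c) -> (forall i j, `|B4 i j| <= c) ->
  forall i j, `|block_mx B1 B2 B3 B4 i j| <= c.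
Proof.
move=> h1 h2 h3 h4 i j.
by case: (split_ordP i) => i' ->; case: (split_ordP j) => j' ->;
  rewrite ?block_mxEul ?block_mxEur ?block_mxEdl ?block_mxEdr.
Qed.

Lemma scalar_entry_le n (c : R) : 1 <= c -> forall i j : 'I_n, `|(1%:M : 'M[R]_n) i j| <= c.
Proof. by move=> c1 i j; rewrite mxE; case: eqP; rewrite ?normr1 ?normr0 // (le_trans ler01). Qed.

Lemma zero_entry_le m n (c : R) : 1 <= c -> forall i j, `|(0 : 'M[R]_(m, n)) i j| <= c.
Proof. by move=> c1 i j; rewrite mxE normr0 (le_trans ler01). Qed.

Lemma controlled_block n c (K : 'M[R]_n) : 1 <= c -> controlled c K ->
  controlled (c * ((1 + n) * (1 + n))%:R) (block_mx (1%:M : 'M[R]_1) 0 0 K).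
Proof.
move=> c1 [Ku K1 K2].
apply: (@controlled_entries _ _ _ (block_mx 1%:M 0 0 (invmx K))).
- rewrite mulmx_block !mul0mx !mulmx0 !mul1mx mulmxV// !addr0 !add0r.
  by rewrite -scalar_mx_block.
- apply: block_entries_le => i j; rewrite ?scalar_entry_le ?zero_entry_le//.
  by rewrite (le_trans _ K1)// entry_le_opnorm.
- apply: block_entries_le => i j; rewrite ?scalar_entry_le ?zero_entry_le//.
  by rewrite (le_trans _ K2)// entry_le_opnorm.
Qed.

Lemma controlled_tperm n (i j : 'I_n) :
  controlled (n * n)%:R (tperm_mx i j : 'M[R]_n).
Proof.
have h (a b : 'I_n) : `|(tperm_mx i j : 'M[R]_n) a b| <= 1.
  by rewrite !mxE; case: (_ == _); rewrite ?normr1 ?normr0.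
rewrite -[(_)%:R]mul1r; apply: (@controlled_entries _ _ _ (tperm_mx i j)) => //.
by rewrite -perm_mxM tperm2 perm_mx1.
Qed.

(** Gaussian elimination with complete pivoting. Once an entry of largest modulus is in the corner,
    all multipliers are at most 1 and the Schur complement has entries at most twice the pivot. The
    induction thus keeps both factors controlled and the diagonal decreasing up to a constant that
    depends on [n] alone. *)
Lemma pivot_decomposition n : exists c : R, 1 <= c /\ forall M : 'M[R]_n,
  exists K1 K2 d, [/\ controlled c K1, controlled c K2,
    M = K1 *m diag_mx d *m K2 &
    forall i j : 'I_n, (i <= j)%N -> `|d 0 j| <= c * `|d 0 i|].
Proof.
elim: n => [|n [c [c1 IH]]].
  exists 1; split => // M; exists 1%:M, 1%:M, 0.
  by split; [exact: controlled1|exact: controlled1|rewrite [LHS]flatmx0 [RHS]flatmx0|case].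
have c0 : 0 <= c by exact: le_trans c1.
set m := 1 + n in IH *; pose N : R := (m * m)%:R.
have N1 : 1 <= N by rewrite ler1n.
(* [C] bounds each outer factor: a permutation, an elimination matrix and the extended factor of the
   smaller matrix contribute [N], [N] and [c * N]. [D] bounds the later diagonal entries relative to
   the pivot: [2 * N] comes from the Schur complement and a [c] from each inverse factor. *)
pose C := N * N * (c * N).
have C1 : 1 <= C by rewrite !mulr_ege1.
pose D := c * c * (2 * N).
have D1 : 1 <= D by rewrite !mulr_ege1// ler1n.
have CD : 1 <= C * D by rewrite mulr_ege1.
exists (C * D); split => // M.
have C0 : 0 <= C by rewrite (le_trans _ C1).
have D0 : 0 <= D by rewrite (le_trans _ D1).
have [M0|/eqP M0] := pselect (M = 0).
  exists 1%:M, 1%:M, 0; split; rewrite ?M0 ?mulmx1 ?mul1mx.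
  - exact: controlled_le CD (controlled1 _).
  - exact: controlled_le CD (controlled1 _).
  - by apply/matrixP => i j; rewrite !mxE mul0rn.
  - by move=> i j _; rewrite !mxE normr0 mulr0.
have [i0 [j0 Mm]] : exists i0 j0, forall i j, `|M i j| <= `|M i0 j0|.
  pose x := [arg max_(x > (0, 0) : 'I_m * 'I_m) `|M x.1 x.2|]%O.
  exists x.1, x.2 => i j; rewrite /x; case: arg_maxP => //= y _ /(_ (i, j)).
  exact.
have p0 : M i0 j0 != 0.
  apply: contraNN M0 => /eqP p0; apply/eqP/matrixP => i j; rewrite mxE.
  by apply/eqP; rewrite -normr_le0 (le_trans (Mm _ _))// p0 normr0.
pose P1 : 'M[R]_m := tperm_mx i0 0; pose P2 : 'M[R]_m := tperm_mx j0 0.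
have [M' M'def] : exists M' : 'M[R]_(1 + n), M' = P1 *m M *m P2 by eexists.
have PP (i : 'I_m) : tperm_mx i 0 *m tperm_mx i 0 = 1%:M :> 'M[R]_m.
  by rewrite -perm_mxM tperm2 perm_mx1.
have ME : M = P1 *m M' *m P2.
  by rewrite M'def !mulmxA PP mul1mx -mulmxA PP mulmx1.
have M'E i j : M' i j = M (tperm i0 0 i) (tperm j0 0 j).
  have -> : M' = col_perm (tperm j0 0) (row_perm (tperm i0 0) M).
    by rewrite M'def col_permE row_permE tpermV.
  by rewrite !mxE.
pose p := M i0 j0.
have M'00 : M' 0 0 = p by rewrite M'E !tpermR.
have M'le i j : `|M' i j| <= `|p| by rewrite M'E.
pose r := ursubmx M'; pose cc := dlsubmx M'.
pose S := drsubmx M' - p^-1 *: (cc *m r).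
have [K1 [K2 [d [K1c K2c SE dd]]]] := IH S.
pose L := block_mx (1%:M : 'M[R]_1) 0 (p^-1 *: cc) (1%:M : 'M[R]_n).
pose U := block_mx (1%:M : 'M[R]_1) (p^-1 *: r) 0 (1%:M : 'M[R]_n).
have split0 : lshift n (0 : 'I_1) = 0 by exact: val_inj.
have M'block : M' = block_mx p%:M r cc (drsubmx M').
  rewrite -[LHS]submxK; congr block_mx; apply/matrixP => i j.
  by rewrite !ord1 !mxE split0 M'00 eqxx mulr1n.
have M'LU : M' = L *m block_mx p%:M 0 0 S *m U.
  rewrite /L /U !mulmx_block !mul0mx !mulmx0 !mul1mx !mulmx1 !addr0 !add0r.
  rewrite -!scalemxAl -!scalemxAr mul_scalar_mx mul_mx_scalar !scalerA.
  rewrite ?mulVf ?divff// !scale1r.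
  rewrite M'block; congr block_mx; by rewrite /S -scalemxAl scalerA divfK// addrC subrK.
have Lc : controlled N L.
  rewrite -[N]mul1r; apply: (@controlled_entries _ _ _ (block_mx 1%:M 0 (- (p^-1 *: cc)) 1%:M)).
  - rewrite /L mulmx_block !mul0mx !mulmx0 !mul1mx !mulmx1 !addr0 !add0r subrr.
    by rewrite -scalar_mx_block.
  - apply: block_entries_le => i j; rewrite ?scalar_entry_le ?zero_entry_le//.
    by rewrite !mxE normrM normfV ler_pdivrMl ?normr_gt0// mulr1 M'le.
  - apply: block_entries_le => i j; rewrite ?scalar_entry_le ?zero_entry_le//.
    by rewrite !mxE normrN normrM normfV ler_pdivrMl ?normr_gt0// mulr1 M'le.
have Uc : controlled N U.
  rewrite -[N]mul1r; apply: (@controlled_entries _ _ _ (block_mx 1%:M (- (p^-1 *: r)) 0 1%:M)).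
  - rewrite /U mulmx_block !mul0mx !mulmx0 !mul1mx !mulmx1 !addr0 !add0r addNr.
    by rewrite -scalar_mx_block.
  - apply: block_entries_le => i j; rewrite ?scalar_entry_le ?zero_entry_le//.
    by rewrite !mxE normrM normfV ler_pdivrMl ?normr_gt0// mulr1 M'le.
  - apply: block_entries_le => i j; rewrite ?scalar_entry_le ?zero_entry_le//.
    by rewrite !mxE normrN normrM normfV ler_pdivrMl ?normr_gt0// mulr1 M'le.
pose d' : 'rV[R]_(1 + n) := row_mx p%:M d.
exists (P1 *m L *m block_mx 1%:M 0 0 K1), (block_mx 1%:M 0 0 K2 *m (U *m P2)), d'.
split.
- apply: (@controlled_le _ C); first by rewrite ler_peMr.
  apply: controlled_mul; last exact: controlled_block.
  by apply: controlled_mul => //; exact: controlled_tperm.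
- apply: (@controlled_le _ C); first by rewrite ler_peMr.
  rewrite /C mulrC; apply: controlled_mul; first exact: controlled_block.
  by apply: controlled_mul => //; exact: controlled_tperm.
- rewrite {1}ME M'LU.
  have -> : block_mx p%:M 0 0 S = block_mx (1%:M : 'M[R]_1) 0 0 K1 *m diag_mx d' *m block_mx 1%:M 0 0 K2.
    rewrite /d' diag_mx_row !mulmx_block !mul0mx !mulmx0 !mul1mx !mulmx1 !addr0 !add0r SE.
    congr block_mx; rewrite ?mul0mx//; apply/matrixP => i j; by rewrite !ord1 !mxE eqxx.
  by rewrite !mulmxA.
- have dle j : `|d 0 j| <= D * `|p|.
    have dE : diag_mx d = invmx K1 *m S *m invmx K2.
      case: K1c K2c => K1u _ _ [K2u _ _].
      by rewrite SE !mulmxA mulVmx// mul1mx mulmxK.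
    have -> : d 0 j = diag_mx d j j by rewrite mxE eqxx mulr1n.
    apply: (le_trans (entry_le_opnorm _ _ _)); rewrite dE.
    apply: (le_trans (opnormM _ _)).
    have -> : D * `|p| = c * (2 * `|p| * N) * c by rewrite /D; ring.
    case: K1c K2c => _ _ h1 [_ _ h2].
    apply: ler_pM; rewrite ?opnorm_ge0//.
    apply: (le_trans (opnormM _ _)).
    apply: ler_pM; rewrite ?opnorm_ge0//.
    apply: (@le_trans _ _ (2 * `|p| * (n * n)%:R)).
      apply: opnorm_le_entries => a b; rewrite /S mxE mxE.
      apply: (le_trans (ler_normD _ _)).
      rewrite mulr_natl mulr2n lerD//; first by rewrite ?mxE M'le.
      rewrite !mxE normrN big_ord1 normrM normfV ler_pdivrMl ?normr_gt0//.
      by rewrite normrM ler_pM// !mxE M'le.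
    by rewrite ler_wpM2l ?mulr_ge0// ler_nat leq_mul// /m add1n.
  have dC j : c * `|d 0 j| <= C * D * `|d 0 j|.
    apply: ler_wpM2r => //; rewrite -[c]mulr1; apply: ler_pM => //.
    rewrite /C -[c in X in X <= _]mul1r; apply: ler_pM => //.
      by rewrite mulr_ege1.
    by rewrite ler_peMr.
  suff hd (i j : 'I_(1 + n)) : (i <= j)%N -> `|d' 0 j| <= C * D * `|d' 0 i| by exact: hd.
  rewrite /d'; case: (@split_ordP 1 n i) => i' ->; case: (@split_ordP 1 n j) => j' ->;
    rewrite ?row_mxEl ?row_mxEr ?ord1.
  + by move=> _; rewrite ler_peMl.
  + move=> _; rewrite mxE eqxx mulr1n (le_trans (dle _))//.
    by rewrite ler_wpM2r// ler_peMl.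
  + by rewrite /= add1n.
  + by rewrite /= !add1n ltnS => h; apply: (le_trans (dd _ _ h)).
Qed.

End Pivoting.

(** * Entrywise convergence of matrices *)

Section Convergence.
Context {R : realType} {T : Type} {F : set_system T} {FF : Filter F}.

Lemma cvg_sumR (I : Type) (r : seq I) (P : pred I) (f : I -> T -> R) (a : I -> R) :
  (forall i, P i -> f i x @[x --> F] --> a i) ->
  \sum_(i <- r | P i) f i x @[x --> F] --> \sum_(i <- r | P i) a i.
Proof. by move=> h; apply: (cvg_big add_continuous). Qed.

Lemma cvg_prodR (I : Type) (r : seq I) (P : pred I) (f : I -> T -> R) (a : I -> R) :
  (forall i, P i -> f i x @[x --> F] --> a i) ->
  \prod_(i <- r | P i) f i x @[x --> F] --> \prod_(i <- r | P i) a i.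
Proof. by move=> h; apply: (cvg_big mul_continuous). Qed.

(** Working entry by entry, minors converge by continuity of finite sums and products alone. *)
Definition entrywise_cvg m n (f : T -> 'M[R]_(m, n)) (B : 'M[R]_(m, n)) :=
  forall i j, f x i j @[x --> F] --> B i j.

Lemma entrywise_cst m n (B : 'M[R]_(m, n)) : entrywise_cvg (fun=> B) B.
Proof. by move=> i j; exact: cvg_cst. Qed.

Lemma entrywise_mul m n p (f : T -> 'M[R]_(m, n)) (g : T -> 'M[R]_(n, p)) B C :
  entrywise_cvg f B -> entrywise_cvg g C ->
  entrywise_cvg (fun x => f x *m g x) (B *m C).
Proof.
move=> fB gC i j; rewrite mxE.
under eq_cvg do rewrite mxE.
by apply: cvg_sumR => l _; exact: cvgM.
Qed.

Lemma entrywise_minor t m n (f : T -> 'M[R]_(m, n)) B (g : 'I_t -> 'I_m) (h : 'I_t -> 'I_n) :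
  entrywise_cvg f B -> minor g h (f x) @[x --> F] --> minor g h B.
Proof.
move=> fB; rewrite /minor /determinant.
apply: cvg_sumR => s _; apply: cvgM; first exact: cvg_cst.
under eq_cvg => x do under eq_bigr do rewrite mxE.
under eq_bigr do rewrite mxE.
by apply: cvg_prodR => i _; exact: fB.
Qed.

End Convergence.

(** * Echelon reduction by column operations *)

Section Echelon.
Context {R : realType} {k : nat}.

(** A Bruhat-type reduction with the rows ordered by [h]. For each [j], among the combinations of
    columns of [X] with coefficient 1 on column [j] and none on later columns, take one whose
    highest nonzero row is as low as possible. Two columns cannot share their top row: subtracting a
    multiple of the earlier one from the later one would lower the top row of the latter. *)
Lemma echelon (h : 'I_k -> R) (X : 'M[R]_k) : injective h -> X \in unitmx ->
  exists (U : 'M[R]_k) (f : 'I_k -> 'I_k),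
  [/\ forall i j : 'I_k, (j < i)%N -> U i j = 0, forall i, U i i = 1,
      injective f, forall j, (X *m U) (f j) j != 0 &
      forall i j, (X *m U) i j != 0 -> h i <= h (f j)].
Proof.
move=> hi Xu.
pose lead_at (u : 'cV[R]_k) i := u i 0 != 0 /\ forall i', u i' 0 != 0 -> h i' <= h i.
have lead_ex (u : 'cV[R]_k) : u != 0 -> exists i, lead_at u i.
  move=> u0; have /existsP[i0 ui0] : [exists i, u i 0 != 0].
    apply: contraNT u0; rewrite negb_exists => /forallP u0.
    by apply/eqP/matrixP => i j; rewrite ord1 mxE; apply/eqP; have := u0 i; rewrite negbK.
  exists [arg max_(i > i0 | u i 0 != 0) h i]%O.
  by case: arg_maxP => // i ui hmax; split => // i' /hmax.
pose cand j (w : 'cV[R]_k) := w j 0 = 1 /\ forall i : 'I_k, (j < i)%N -> w i 0 = 0.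
have X0 w j : cand j w -> X *m w != 0.
  move=> [w1 _]; apply/eqP => /(congr1 (mulmx (invmx X))); rewrite mulKmx// mulmx0.
  by move=> /matrixP/(_ j 0); rewrite w1 mxE => /eqP; rewrite oner_eq0.
pose P j i := exists2 w, cand j w & lead_at (X *m w) i.
have best j : exists wi : 'cV[R]_k * 'I_k, [/\ cand j wi.1, lead_at (X *m wi.1) wi.2 &
    forall w i, cand j w -> lead_at (X *m w) i -> h wi.2 <= h i].
  have cd : cand j (delta_mx j 0).
    by split=> [|i ji]; rewrite !mxE ?eqxx// -val_eqE gtn_eqF.
  have [i0 li0] := lead_ex _ (X0 _ _ cd).
  have Pi0 : `[<P j i0>] by apply/asboolP; exists (delta_mx j 0).
  case: (arg_minP (P := fun i => `[<P j i>]) h Pi0) => i /asboolP[w cw lw] hmin.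
  exists (w, i); split => // w' i' cw' lw'; apply: hmin; apply/asboolP; by exists w'.
have {best}[g gP] := choice best.
pose U : 'M[R]_k := \matrix_(i, j) (g j).1 i 0.
have XU i j : (X *m U) i j = (X *m (g j).1) i 0.
  by rewrite !mxE; apply: eq_bigr => l _; rewrite mxE.
exists U, (fun j => (g j).2); split.
- by move=> i j ji; rewrite mxE; have [[_ +] _ _] := gP j; exact.
- by move=> i; rewrite mxE; have [[+ _] _ _] := gP i.
- suff H (i j : 'I_k) : (i < j)%N -> (g i).2 <> (g j).2.
    by move=> i j e; apply: val_inj; case: (ltngtP i j) => // /H; rewrite e.
  move=> ij e; have [ci [li _] _] := gP i; have [cj [lj lj'] mj] := gP j.
  pose c := (X *m (g j).1) (g j).2 0 / (X *m (g i).1) (g i).2 0.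
  pose w := (g j).1 - c *: (g i).1.
  have cw : cand j w.
    split=> [|l jl]; rewrite !mxE; case: ci cj => _ ci [cj1 cj2].
      by rewrite cj1 ci// mulr0 subr0.
    by rewrite cj2// ci ?mulr0 ?subr0// (ltn_trans ij).
  have [l [l1 l2]] := lead_ex _ (X0 _ _ cw).
  have XwE i' : (X *m w) i' 0 = (X *m (g j).1) i' 0 - c * (X *m (g i).1) i' 0.
    by rewrite /w mulmxBr -scalemxAr; move: (X *m _) (X *m _) => B C; rewrite !mxE.
  have := mj w l cw (conj l1 l2); rewrite leNgt => /negP; apply.
  rewrite lt_neqAle; apply/andP; split.
    apply/eqP => /hi le; move: l1; rewrite XwE le /c -e divfK ?subrr ?eqxx//.
  have [//|] := eqVneq ((X *m (g j).1) l 0) 0; last by move/lj'.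
  move=> jl0; have {}l1 : (X *m (g i).1) l 0 != 0.
    apply: contraNN l1 => /eqP il0; by rewrite XwE jl0 il0 mulr0 subr0.
  by have [_ [_ /(_ _ l1)]] := gP i; rewrite e.
- by move=> j; rewrite XU; have [_ [+ _] _] := gP j.
- by move=> i j; rewrite XU; have [_ [_ +] _] := gP j; exact.
Qed.

End Echelon.

(** * Leading minors of products with high powers of a diagonal matrix *)

Section PowerMinors.
Context {R : realType} {k : nat}.
Variable lam : 'I_k -> R.
Hypothesis lam_inj : injective (fun i => `|lam i|).
Hypothesis lam_neq0 : forall i, lam i != 0.

Definition diag_pow (l : nat) : 'M[R]_k := diag_mx (\row_i lam i ^+ l).

(** Put [X] in echelon form with rows ordered by [|lam i|] and divide column [j] by
    [lam (f j) ^+ l]. Off the top rows the entries decay geometrically, because the absolute values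
    are distinct. The unitriangular factor leaves leading minors unchanged, and the same [f] serves
    all orders [t]. *)
Lemma power_minor (X : 'M[R]_k) : X \in unitmx ->
  exists (f : 'I_k -> 'I_k) (Xh : nat -> 'M[R]_k) (nu : 'I_k -> R),
  [/\ injective f, forall j, nu j != 0,
    entrywise_cvg (F := \oo) Xh (\matrix_(i, j) (nu j *+ (i == f j))) &
    forall l t (tk : (t <= k)%N) m (g : 'I_t -> 'I_m) (M : 'M[R]_(m, k)),
      minor g (lead tk) (M *m diag_pow l *m X) =
      (\prod_a lam (f (lead tk a)) ^+ l) * minor g (lead tk) (M *m Xh l)].
Proof.
move=> Xu; have [U [f [U0 U1 fi f0 fmax]]] := echelon lam_inj Xu.
exists f, (fun l => \matrix_(i, j) (lam i ^+ l * (X *m U) i j / lam (f j) ^+ l)),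
  (fun j => (X *m U) (f j) j); split => //.
- move=> i j; rewrite mxE.
  under eq_cvg do rewrite mxE.
  have [->|ij] := eqVneq i (f j).
    rewrite mulr1n; apply: cvg_near_cst; near=> l.
    by rewrite mulrAC divff ?mul1r ?expf_neq0//.
  rewrite mulr0n; have [->|Xij] := eqVneq ((X *m U) i j) 0.
    by apply: cvg_near_cst; near=> l; rewrite mulr0 mul0r.
  have lt1 : `|lam i / lam (f j)| < 1.
    rewrite normrM normfV ltr_pdivrMr ?normr_gt0// mul1r lt_neqAle (fmax _ _ Xij) andbT.
    by apply/eqP => /lam_inj e; rewrite e eqxx in ij.
  have := cvg_geometric ((X *m U) i j) lt1.
  apply: cvg_trans; apply: near_eq_cvg; near=> l.
  by rewrite /geometric /= exprMn exprVn mulrA mulrAC (mulrC (lam i ^+ l)) mulrAC.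
- move=> l t tk m g M.
  rewrite -(minor_unitri_r tk g _ U0 U1).
  rewrite (@minor_scale _ _ _ _ g (lead tk) (fun=> 1) (fun j => lam (f j) ^+ l)
    (M *m (\matrix_(i, j) (lam i ^+ l * (X *m U) i j / lam (f j) ^+ l)))).
    by rewrite big1_eq mul1r mulrC.
  move=> i j; rewrite mul1r.
  have -> : M *m diag_pow l *m X *m U = M *m (diag_pow l *m (X *m U)) by rewrite !mulmxA.
  rewrite [LHS]mxE [in RHS]mxE mulr_suml; apply: eq_bigr => s _.
  rewrite /diag_pow mul_diag_mx; move: (X *m U) => B; rewrite !mxE -!mulrA; congr (_ * (_ * _)).
  by rewrite mulVf ?mulr1 ?expf_neq0//.
Unshelve. all: end_near. Qed.

Lemma power_minor2 (X Y : 'M[R]_k) : X \in unitmx -> Y \in unitmx ->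
  exists (f f' : 'I_k -> 'I_k) (Xh Yh : nat -> 'M[R]_k) (nu nu' : 'I_k -> R),
  [/\ injective f /\ injective f', forall j, nu j != 0 /\ nu' j != 0,
    entrywise_cvg (F := \oo) Xh (\matrix_(i, j) (nu j *+ (i == f j))),
    entrywise_cvg (F := \oo) Yh (\matrix_(i, j) (nu' i *+ (j == f' i))) &
    forall l t (tk : (t <= k)%N) (E : 'M[R]_k),
      minor (lead tk) (lead tk) (Y *m diag_pow l *m E *m diag_pow l *m X) =
      (\prod_a lam (f (lead tk a)) ^+ l) * (\prod_a lam (f' (lead tk a)) ^+ l)
      * minor (lead tk) (lead tk) (Yh l *m E *m Xh l)].
Proof.
move=> Xu Yu; have [f [Xh [nu [fi nu0 cX mX]]]] := power_minor Xu.
have YTu : Y^T \in unitmx by rewrite unitmx_tr.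
have [f' [Yh [nu' [fi' nu0' cY mY]]]] := power_minor YTu.
exists f, f', Xh, (fun l => (Yh l)^T), nu, nu'; split => //.
  move=> i j; rewrite mxE; under eq_cvg do rewrite mxE.
  by have := cY j i; rewrite mxE.
move=> l t tk E.
rewrite mX -mulrA; congr (_ * _).
rewrite -[LHS]minor_tr !trmx_mul !mulmxA.
have -> : (diag_pow l)^T = diag_pow l by rewrite tr_diag_mx.
by rewrite mY -[in RHS]minor_tr !trmx_mul trmxK mulmxA.
Qed.

(** In the limit the normalised minor is a nonzero multiple of the minor of [psi] on the rows [f']
    and columns [f] of the leading indices. The tolerance [e] does not depend on [l]; the bound [c]
    does, as it contains the powers [lam i ^+ l]. *)
Lemma power_minor_limit (psi X Y : 'M[R]_k) : X \in unitmx -> Y \in unitmx ->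
  (forall t (s u : 'I_#|incr t k|), (t < k)%N -> minor (incr_of s) (incr_of u) psi != 0) ->
  exists (e : R) (l0 : nat), 0 < e /\ forall l, (l0 <= l)%N ->
   exists2 c : R, 0 < c & forall E, opnorm (E - psi) < e ->
   forall t (tk : (t <= k)%N), (t < k)%N ->
     c <= `|minor (lead tk) (lead tk) (Y *m diag_pow l *m E *m diag_pow l *m X)|.
Proof.
move=> Xu Yu psi0.
have [f [f' [Xh [Yh [nu [nu' [[fi fi'] nu0 cX cY mE]]]]]]] := power_minor2 Xu Yu.
pose NX : 'M[R]_k := \matrix_(i, j) (nu j *+ (i == f j)).
pose NY : 'M[R]_k := \matrix_(i, j) (nu' i *+ (j == f' i)).
pose c0 (t : 'I_k) := `|minor (lead (ltnW (ltn_ord t))) (lead (ltnW (ltn_ord t))) (NY *m psi *m NX)|.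
have c0_gt0 t : 0 < c0 t.
  rewrite /c0 normr_gt0; set tk := ltnW _.
  rewrite (@minor_scale _ _ _ _ (lead tk) (lead tk) nu' nu (\matrix_(i, j) psi (f' i) (f j))); last first.
    move=> i j; rewrite [LHS]mxE (bigD1 (f j))//= big1 ?addr0; last first.
      by move=> s /negbTE sf; rewrite [X in _ * X]mxE sf mulr0n mulr0.
    rewrite [X in X * _]mxE (bigD1 (f' i))//= big1 ?addr0; last first.
      by move=> s /negbTE sf; rewrite [X in X * _]mxE sf mulr0n mul0r.
    by rewrite !mxE !eqxx !mulr1n.
  rewrite !mulf_neq0//.
  - by apply/prodf_neq0 => a _; case: (nu0 (lead tk a)).
  - have -> : minor (lead tk) (lead tk) (\matrix_(i, j) psi (f' i) (f j)) =
       minor (fun a => f' (lead tk a)) (fun a => f (lead tk a)) psi.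
      by congr (\det _); apply/matrixP => a b; rewrite !mxE.
    rewrite -normr_eq0.
    have [||s [u ->]] := @minor_inj_eq _ t _ _ (fun a => f' (lead tk a)) (fun a => f (lead tk a)) psi.
    + by move=> a b /fi'; apply: (incr_inj (lead_incr tk)).
    + by move=> a b /fi; apply: (incr_inj (lead_incr tk)).
    by rewrite normr_eq0 psi0.
  - by apply/prodf_neq0 => a _; case: (nu0 (lead tk a)).
(* Otherwise there are times tending to infinity and centres tending to [psi] with small minors,
   although these minors converge to a value of modulus [c0 t]. *)
have key (t : 'I_k) : exists (e : R) (l0 : nat), 0 < e /\ forall l E, (l0 <= l)%N ->
    opnorm (E - psi) < e ->
    c0 t / 2 <= `|minor (lead (ltnW (ltn_ord t))) (lead (ltnW (ltn_ord t))) (Yh l *m E *m Xh l)|.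
  apply: contrapT => /forallNP H.
  have {}H n : exists lE : nat * 'M[R]_k, [/\ (n <= lE.1)%N, opnorm (lE.2 - psi) < n.+1%:R^-1 &
     `|minor (lead (ltnW (ltn_ord t))) (lead (ltnW (ltn_ord t))) (Yh lE.1 *m lE.2 *m Xh lE.1)| < c0 t / 2].
    apply: contrapT => /forallNP H'; apply: (H n.+1%:R^-1); exists n; split; first by rewrite invr_gt0.
    move=> l E nl hE; rewrite leNgt; apply/negP => hlt; by apply: (H' (l, E)).
  have {H}[g gP] := choice H.
  have gl : (g n).1 @[n --> \oo] --> \oo.
    move=> A [N _ NA]; exists N => // n /= Nn; apply: NA => /=.
    by apply: leq_trans Nn _; have [] := gP n.
  have gE : entrywise_cvg (F := \oo) (fun n => (g n).2) psi.
    move=> i j; apply/cvgrPdist_lt => e e0; near=> n.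
    have [_ h _] := gP n.
    rewrite distrC; apply: le_lt_trans (_ : opnorm ((g n).2 - psi) < e).
      by have := entry_le_opnorm ((g n).2 - psi) i j; rewrite !mxE.
    apply: (lt_trans h); near: n.
    exact: near_infty_natSinv_lt (PosNum e0).
  have : `|minor (lead (ltnW (ltn_ord t))) (lead (ltnW (ltn_ord t))) (Yh (g n).1 *m (g n).2 *m Xh (g n).1)| @[n --> \oo] --> c0 t.
    apply: cvg_norm; apply: entrywise_minor; apply: entrywise_mul.
      apply: entrywise_mul => // i j.
      exact: (cvg_comp (fun n => (g n).1) (fun l => Yh l i j) gl (cY i j)).
    move=> i j.
    exact: (cvg_comp (fun n => (g n).1) (fun l => Xh l i j) gl (cX i j)).
  move=> /cvgr_gt/(_ (c0 t / 2)).
  rewrite ltr_pdivrMr// ltr_pMr// ltr1n => /(_ isT)[N _ /(_ N (leqnn N))] /=.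
  by have [_ _ h] := gP N; rewrite ltNge (ltW h).
have {key}[e keye] := choice key; have {keye}[l0 key] := choice keye.
have fmin (a : 'I_k -> R) : (forall i, 0 < a i) -> exists2 b, 0 < b & forall i, b <= a i.
  move=> a0; exists (\big[Order.min/1]_i a i); first by apply: lt_bigmin.
  by move=> i; exact: bigmin_le_cond.
have [e0 e0p e0le] := fmin e (fun t => proj1 (key t)).
have [c1 c1p c1le] := fmin c0 c0_gt0.
have lamp i : 0 < `|lam i| by rewrite normr_gt0.
have [mu mup mule] := fmin _ lamp.
(* Capping at 1 allows a product of [t] factors to be bounded below by a [k]-th power, whatever [t]
   is. *)
pose mu1 := Order.min mu 1.
have mu1p : 0 < mu1 by rewrite lt_min mup ltr01.
exists e0, (\max_t l0 t)%N; split => // l hl.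
exists ((mu1 ^+ l) ^+ k * (mu1 ^+ l) ^+ k * (c1 / 2)).
  by rewrite !mulr_gt0 ?exprn_gt0// divr_gt0.
move=> E hE t tk tk'.
have prodle (h : 'I_k -> 'I_k) : (mu1 ^+ l) ^+ k <= `|\prod_(a < t) lam (h (lead tk a)) ^+ l|.
  rewrite normr_prod.
  have -> : (mu1 ^+ l) ^+ k = (mu1 ^+ l) ^+ (k - t) * \prod_(a < t) mu1 ^+ l.
    by rewrite prodr_const card_ord -exprD subnK.
  rewrite -[X in _ <= X]mul1r; apply: ler_pM.
  - by rewrite !exprn_ge0// ltW.
  - by rewrite prodr_ge0// => a _; rewrite exprn_ge0// ltW.
  - by rewrite exprn_ile1 ?exprn_ge0 ?exprn_ile1 ?(ltW mu1p)// ge_min lexx orbT.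
  apply: ler_prod => a _; rewrite exprn_ge0 ?(ltW mu1p)//= normrX.
  by rewrite lerXn2r ?nnegrE ?(ltW mu1p)// (le_trans _ (mule _))// ge_min lexx.
rewrite mE !normrM; apply: ler_pM.
- by rewrite mulr_ge0// !exprn_ge0// ltW.
- by rewrite ltW// divr_gt0.
- by apply: ler_pM; rewrite ?prodle ?exprn_ge0 ?(ltW mu1p).
have [_ /(_ l E)] := key (Ordinal tk').
rewrite (_ : ltnW _ = tk); last exact: bool_irrelevance.
move=> h; apply: le_trans (h _ _).
- by rewrite ler_pM2r ?invr_gt0.
- by apply: leq_trans hl; exact: (leq_bigmax (Ordinal tk')).
- exact: lt_le_trans hE (e0le _).
Unshelve. all: end_near. Qed.

End PowerMinors.

(** * Uniformity over controlled outer factors *)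

Section UniformPowerMinors.
Context {R : realType} {k : nat}.
Variable lam : 'I_k -> R.
Hypothesis lam_inj : injective (fun i => `|lam i|).
Hypothesis lam_neq0 : forall i, lam i != 0.

(** A kernel vector [v] of [X] satisfies [enorm v <= c * opnorm (X' - X) * enorm v] whenever [X'] is
    controlled. In the compactness argument, singular points therefore have neighbourhoods where
    nothing is to be proved. *)
Lemma controlled_near (c : R) (X : 'M[R]_k) : X \notin unitmx ->
  exists2 d : R, 0 < d & forall X', opnorm (X' - X) < d -> ~ controlled c X'.
Proof.
move=> Xu; have [c0|c0] := leP c 0.
  exists 1 => // X' _ [X'u X'1 X'2].
  have [k0|k0] := posnP k.
    by move: Xu; rewrite -unitmx_tr unitmxE; subst k; rewrite det_mx00 unitr1.
  have := @opnorm_unit_gt0 _ _ X' k0 X'u; rewrite ltNge => /negP; apply.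
  exact: le_trans c0.
exists c^-1; first by rewrite invr_gt0.
move=> X' hX [X'u _ X'2].
have [v v0 Xv] : exists2 v : 'cV[R]_k, v != 0 & X *m v = 0.
  move: Xu; rewrite -unitmx_tr -row_free_unit -kermx_eq0 => /rowV0Pn[w].
  move=> /sub_kermxP wX w0; exists w^T; first by rewrite trmx_eq0.
  by rewrite -[LHS]trmxK trmx_mul trmxK wX trmx0.
have vp : 0 < enorm v.
  rewrite lt_def enorm_ge0 andbT; apply: contraNN v0 => /eqP/enorm_eq0->; by rewrite eqxx.
have : enorm v <= c * (opnorm (X' - X) * enorm v).
  have -> : v = invmx X' *m ((X' - X) *m v) by rewrite mulmxBl Xv subr0 mulKmx.
  rewrite [in X in _ <= _ * (_ * X)]mulmxBl Xv subr0 mulKmx//.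
  apply: (le_trans (opnormP _ _)); apply: ler_pM; rewrite ?opnorm_ge0 ?enorm_ge0//.
  exact: opnormP.
rewrite mulrA ler_pMl// => h.
have : c * opnorm (X' - X) < 1 by rewrite mulrC -ltr_pdivlMr// mul1r.
by rewrite ltNge h.
Qed.

Lemma opnorm_perturb (A B E : 'M[R]_k) (d M : R) : d <= 1 ->
  opnorm (A - 1%:M) <= d -> opnorm (B - 1%:M) <= d -> opnorm E <= M ->
  opnorm (A *m E *m B - E) <= 3 * d * M.
Proof.
move=> d1 hA hB hE.
have d0 : 0 <= d by apply: le_trans hA; exact: opnorm_ge0.
have -> : A *m E *m B - E = (A - 1%:M) *m E *m B + E *m (B - 1%:M).
  by rewrite !mulmxBl mulmxBr mul1mx mulmx1 addrA subrK.
have B2 : opnorm B <= 2.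
  rewrite (le_trans (opnorm_triBD B 1%:M))// -[2]/(1 + 1) lerD ?opnorm1//.
  exact: le_trans d1.
apply: (le_trans (opnormD _ _)).
have -> : 3 * d * M = d * M * 2 + M * d by ring.
apply: lerD; apply: (le_trans (opnormM _ _)).
  apply: ler_pM; rewrite ?opnorm_ge0//.
  by apply: (le_trans (opnormM _ _)); apply: ler_pM; rewrite ?opnorm_ge0.
by apply: ler_pM; rewrite ?opnorm_ge0.
Qed.

Lemma diag_pow_unit l : diag_pow lam l \in unitmx.
Proof.
rewrite unitmxE det_diag unitfE; apply/prodf_neq0 => i _.
by rewrite mxE expf_neq0.
Qed.

(* For fixed [l], moving [X] and [Y] amounts to a small two-sided perturbation of the middle factor, so openness in that factor alone suffices. *)
Lemma power_minor_open (psi X Y : 'M[R]_k) : X \in unitmx -> Y \in unitmx ->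
  (forall t (s u : 'I_#|incr t k|), (t < k)%N -> minor (incr_of s) (incr_of u) psi != 0) ->
  exists (e : R) (l0 : nat), 0 < e /\ forall l, (l0 <= l)%N ->
   exists c d : R, [/\ 0 < c, 0 < d & forall E X' Y', opnorm (E - psi) < e ->
   opnorm (X' - X) < d -> opnorm (Y' - Y) < d ->
   forall t (tk : (t <= k)%N), (t < k)%N ->
     c <= `|minor (lead tk) (lead tk) (Y' *m diag_pow lam l *m E *m diag_pow lam l *m X')|].
Proof.
move=> Xu Yu psi0.
have [e [l0 [e0 he]]] := power_minor_limit lam_inj lam_neq0 Xu Yu psi0.
exists (e / 2), l0; split; first by rewrite divr_gt0.
move=> l /he[c c0 hc].
pose L := diag_pow lam l; have Lu : L \in unitmx := diag_pow_unit l.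
pose M := opnorm psi + e.
have Mp : 0 < M by rewrite ltr_wpDl ?opnorm_ge0.
pose C := opnorm (invmx L) * (opnorm (invmx Y) + opnorm (invmx X)) * opnorm L + 1.
have Cp : 0 < C by rewrite ltr_wpDl// !mulr_ge0 ?addr_ge0 ?opnorm_ge0.
pose eta := Order.min 1 (e / (8 * M)).
have etap : 0 < eta by rewrite lt_min ltr01 divr_gt0// mulr_gt0.
exists c, (eta / C); split=> //; first by rewrite divr_gt0.
move=> E X' Y' hE hX hY t tk tk'.
pose A := invmx L *m invmx Y *m Y' *m L; pose B := L *m X' *m invmx X *m invmx L.
have -> : Y' *m L *m E *m L *m X' = Y *m L *m (A *m E *m B) *m L *m X.
  rewrite /A /B -!mulmxA; rewrite (mulKVmx Lu) (mulKVmx Yu).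
  by rewrite (mulKmx Lu) mulVmx// mulmx1.
apply: hc => //.
apply: (le_lt_trans (opnorm_triB _ E _)); rewrite [X in _ < X](splitr e) ltr_leD//; last exact: ltW.
have hA : opnorm (A - 1%:M) <= eta.
  have -> : A - 1%:M = invmx L *m (invmx Y *m (Y' - Y)) *m L.
    by rewrite /A !mulmxBr !mulmxBl mulVmx// mulmx1 mulVmx// !mulmxA.
  apply: (@le_trans _ _ (C * (eta / C))); last by rewrite mulrC divfK ?gt_eqF.
  have p0 : 0 <= opnorm (Y' - Y) by exact: opnorm_ge0.
  apply: (@le_trans _ _ (C * opnorm (Y' - Y))); last by rewrite ler_pM2l// ltW.
  apply: (le_trans (opnormM _ _)).
  have -> : C * opnorm (Y' - Y) = (opnorm (invmx L) * (opnorm (invmx Y) * opnorm (Y' - Y)) * opnorm L) +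
    (opnorm (invmx L) * opnorm (invmx X) * opnorm L + 1) * opnorm (Y' - Y) by rewrite /C; ring.
  apply: ler_wpDr; first by rewrite mulr_ge0// addr_ge0// !mulr_ge0 ?opnorm_ge0.
  apply: ler_wpM2r; first exact: opnorm_ge0.
  by apply: (le_trans (opnormM _ _)); apply: ler_wpM2l; rewrite ?opnorm_ge0// opnormM.
have hB : opnorm (B - 1%:M) <= eta.
  have -> : B - 1%:M = L *m ((X' - X) *m invmx X) *m invmx L.
    by rewrite /B !mulmxBl !mulmxBr !mulmxBl mulmxV// mulmx1 mulmxV// !mulmxA.
  apply: (@le_trans _ _ (C * (eta / C))); last by rewrite mulrC divfK ?gt_eqF.
  have p0 : 0 <= opnorm (X' - X) by exact: opnorm_ge0.
  apply: (@le_trans _ _ (C * opnorm (X' - X))); last by rewrite ler_pM2l// ltW.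
  apply: (le_trans (opnormM _ _)).
  have -> : C * opnorm (X' - X) = (opnorm L * (opnorm (X' - X) * opnorm (invmx X)) * opnorm (invmx L)) +
    (opnorm (invmx L) * opnorm (invmx Y) * opnorm L + 1) * opnorm (X' - X) by rewrite /C; ring.
  apply: ler_wpDr; first by rewrite mulr_ge0// addr_ge0// !mulr_ge0 ?opnorm_ge0.
  apply: ler_wpM2r; first exact: opnorm_ge0.
  by apply: (le_trans (opnormM _ _)); apply: ler_wpM2l; rewrite ?opnorm_ge0// opnormM.
apply: (@le_lt_trans _ _ (3 * eta * M)).
  apply: opnorm_perturb => //; first by rewrite ge_min lexx.
  apply: (le_trans (opnorm_triBD E psi)); rewrite lerD2l (le_trans (ltW hE))//.
  by rewrite ler_pdivrMr// ler_peMr// ?ler1n// ltW.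
apply: (@le_lt_trans _ _ (3 * (e / (8 * M)) * M)).
  by rewrite ler_pM2r// ler_pM2l// ge_min lexx orbT.
have -> : 3 * (e / (8 * M)) * M = 3 / 8 * e.
  by rewrite invfM mulrA mulrA divfK ?gt_eqF// mulrAC.
by rewrite mulrC ltr_pM2l//; lra.
Qed.

(** Compactness for the pair of outer factors, coded as a row vector in a box. [Ec l] describes the
    centres available at time [l]: they depend on [l] themselves and approach [psi] only as it
    grows. A single index [j] bounds [l] from above and, through [j.+1%:R^-1], the minors from
    below, which suits the near-covering form of compactness. *)
Lemma uniform_power_minor (psi : 'M[R]_k) (kap : R) (Ec : nat -> set 'M[R]_k) (lmin : nat) :
  (forall t (s u : 'I_#|incr t k|), (t < k)%N -> minor (incr_of s) (incr_of u) psi != 0) ->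
  (forall e : R, 0 < e -> exists l0 : nat, forall l E, (l0 <= l)%N -> Ec l E -> opnorm (E - psi) < e) ->
  exists (Lmax : nat) (c : R), 0 < c /\ forall X Y, controlled kap X -> controlled kap Y ->
  exists2 l, (lmin <= l <= Lmax)%N & forall E, Ec l E ->
   forall t (tk : (t <= k)%N), (t < k)%N ->
     c <= `|minor (lead tk) (lead tk) (Y *m diag_pow lam l *m E *m diag_pow lam l *m X)|.
Proof.
move=> psi0 Ecpsi.
pose D := (k * k)%N.
pose XX (v : 'rV[R]_(D + D)) : 'M[R]_k := vec_mx (lsubmx v).
pose YY (v : 'rV[R]_(D + D)) : 'M[R]_k := vec_mx (rsubmx v).
pose box := [set v : 'rV[R]_(D + D) | forall i, (fun=> `[- kap, kap]%classic) i (v ord0 i)].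
have cbox : compact box by apply: rV_compact => _; exact: segment_compact.
pose P (j : nat) (v : 'rV[R]_(D + D)) := controlled kap (XX v) -> controlled kap (YY v) ->
  exists2 l, (lmin <= l <= j)%N & forall E, Ec l E ->
   forall t (tk : (t <= k)%N), (t < k)%N ->
     j.+1%:R^-1 <= `|minor (lead tk) (lead tk) (YY v *m diag_pow lam l *m E *m diag_pow lam l *m XX v)|.
have nearv v (d : R) : 0 < d -> \forall v' \near v, opnorm (XX v' - XX v) < d /\ opnorm (YY v' - YY v) < d.
  move=> d0; pose d' := d / ((D.+1)%:R).
  have d'0 : 0 < d' by rewrite divr_gt0.
  have : nbhs v (ball v d') by exact: nbhsx_ballx.
  apply: filterS => v' [_ hv'].
  have lt0 : d' * D%:R < d.
    by rewrite /d' mulrAC ltr_pdivrMr// ltr_pM2l// ltr_nat.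
  split; apply: le_lt_trans lt0; apply: opnorm_le_entries => i j.
    rewrite !mxE distrC; apply: ltW; exact: hv'.
  rewrite !mxE distrC; apply: ltW; exact: hv'.
have [J _ HJ] : \forall j \near \oo, box `<=` P j.
  have /compact_near_coveringP := cbox; apply => v _.
  have [[Xu Yu]|nu] := pselect (XX v \in unitmx /\ YY v \in unitmx).
    have [e [l0 [e0 he]]] := power_minor_open Xu Yu psi0.
    have [l1 hl1] := Ecpsi _ e0.
    pose l := maxn l0 (maxn l1 lmin).
    have /he[c [d [c0 d0 hcd]]] : (l0 <= l)%N by rewrite leq_maxl.
    have lnear : \forall j \near \oo, (l <= j)%N by exists l.
    near=> v' j => _ _.
    have lj : (l <= j)%N by near: j.
    have jc : j.+1%:R^-1 < c by near: j; exact: near_infty_natSinv_lt (PosNum c0).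
    have [h1 h2] : opnorm (XX v' - XX v) < d /\ opnorm (YY v' - YY v) < d by near: v'; exact: nearv.
    exists l.
      apply/andP; split; first by rewrite /l !leq_max leqnn !orbT.
      exact: lj.
    move=> E EE t tk tk'; apply: (@le_trans _ _ c).
      exact: ltW.
    apply: hcd => //; apply: hl1 EE; by rewrite /l !leq_max leqnn !orbT.
  have [d d0 hd] : exists2 d : R, 0 < d & forall v', opnorm (XX v' - XX v) < d ->
      opnorm (YY v' - YY v) < d -> ~ (controlled kap (XX v') /\ controlled kap (YY v')).
    have [Xu|/controlled_near-/(_ kap)[d d0 hd]] := boolP (XX v \in unitmx); last first.
      by exists d => // v' /hd h _ [].
    have [Yu|/controlled_near-/(_ kap)[d d0 hd]] := boolP (YY v \in unitmx); last first.
      by exists d => // v' _ /hd h [].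
    by exfalso; apply: nu.
  near=> v' j => cX cY; exfalso.
  have [h1 h2] : opnorm (XX v' - XX v) < d /\ opnorm (YY v' - YY v) < d by near: v'; exact: nearv.
  exact: (hd v' h1 h2).
exists J, J.+1%:R^-1; split; first by rewrite invr_gt0.
move=> X Y cX cY.
pose v : 'rV[R]_(D + D) := row_mx (mxvec X) (mxvec Y).
have XE : XX v = X by rewrite /XX row_mxKl mxvecK.
have YE : YY v = Y by rewrite /YY row_mxKr mxvecK.
have bv : box v.
  move=> i /=; rewrite in_itv /= -ler_norml.
  have bX i' : `|mxvec X 0 i'| <= kap.
    case/mxvec_indexP: i' => a b; rewrite mxvecE.
    by case: cX => _ h _; apply: le_trans h; exact: entry_le_opnorm.
  have bY i' : `|mxvec Y 0 i'| <= kap.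
    case/mxvec_indexP: i' => a b; rewrite mxvecE.
    by case: cY => _ h _; apply: le_trans h; exact: entry_le_opnorm.
  by rewrite /v; case: (split_ordP i) => i' ->; rewrite ?row_mxEl ?row_mxEr.
have := HJ J (leqnn J) v bv; rewrite /P XE YE; apply => //.
Unshelve. all: end_near. Qed.

End UniformPowerMinors.

(** * Norms of exterior powers *)

Section ExteriorBounds.
Context {R : realType}.

Definition ext_bound (t k : nat) (c : R) : R :=
  (t`!)%:R * c ^+ t * (#|incr t k| * #|incr t k|)%:R.

Lemma det_bound n (B : 'M[R]_n) c : (forall i j, `|B i j| <= c) ->
  `|\det B| <= (n`!)%:R * c ^+ n.
Proof.
move=> h; apply: (le_trans (ler_norm_sum _ _ _)).
apply: (@le_trans _ _ (\sum_(s : 'S_n) c ^+ n)).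
  apply: ler_sum => s _; rewrite normrM normrX normrN1 expr1n mul1r normr_prod.
  have -> : c ^+ n = \prod_(i < n) c by rewrite prodr_const card_ord.
  by apply: ler_prod => i _; rewrite normr_ge0 h.
rewrite sumr_const mulr_natl -card_Sn le_eqVlt; apply/orP; left; apply/eqP.
by congr (_ *+ _); apply: eq_card => s; rewrite !inE.
Qed.

Lemma opnorm_ext_le t k (B : 'M[R]_k) c : opnorm B <= c ->
  opnorm (extpow t B) <= ext_bound t k c.
Proof.
move=> h; apply: opnorm_le_entries => s u; rewrite extpowE.
apply: det_bound => i j; rewrite mxE.
by apply: le_trans h; exact: entry_le_opnorm.
Qed.

Lemma minor_le_ext t k (tk : (t <= k)%N) (B : 'M[R]_k) :
  `|minor (lead tk) (lead tk) B| <= opnorm (extpow t B).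
Proof.
have h := lead_incr tk.
have := entry_le_opnorm (extpow t B) (enum_rank_in h (lead tk)) (enum_rank_in h (lead tk)).
by rewrite extpowE /incr_of enum_rankK_in.
Qed.

Lemma incr_top k (s : 'I_#|incr k k|) : incr_of s = lead (leqnn k).
Proof.
apply/eqP; apply/negPn/negP => /(incr_neq_lead (enum_valP s))[a].
by rewrite leqNgt ltn_ord.
Qed.

Lemma minor_top k (B : 'M[R]_k) : minor (lead (leqnn k)) (lead (leqnn k)) B = \det B.
Proof.
congr (\det _); apply/matrixP => i j; rewrite mxE !ffunE.
by congr (B _ _); exact: val_inj.
Qed.

Lemma det_le_ext k (B : 'M[R]_k) : `|\det B| <= opnorm (extpow k B).
Proof. by rewrite -minor_top minor_le_ext. Qed.

(** The top exterior power is one-dimensional, and its only entry is the determinant. *)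
Lemma ext_le_det k (B : 'M[R]_k) :
  opnorm (extpow k B) <= `|\det B| * (#|incr k k| * #|incr k k|)%:R.
Proof.
by apply: opnorm_le_entries => s u; rewrite extpowE !incr_top minor_top.
Qed.

(** By functoriality it suffices that the identity goes to the identity: two distinct increasing
    selections have distinct images, so the corresponding minor of the identity has a zero row. *)
Lemma extpow_unit t k (B : 'M[R]_k) : B \in unitmx -> extpow t B \in unitmx.
Proof.
move=> Bu.
have e1 : extpow t (1%:M : 'M[R]_k) = 1%:M.
  apply/matrixP => s u; rewrite extpowE mxE.
  have [<-|su] := eqVneq s u.
    rewrite /minor (_ : \matrix_(_, _) _ = 1%:M) ?det1//.
    apply/matrixP => a b; rewrite !mxE; congr (_ %:R).
    by rewrite (inj_eq (incr_inj (enum_valP s))).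
  rewrite mulr0n; suff [a ha] : exists a, forall b, incr_of s a <> incr_of u b.
    by apply: (minor_row0 (a := a)) => b; rewrite mxE; case: eqP (ha b).
  apply: contrapT => /forallNP H; move/eqP: su; apply.
  have {}H a : exists b, incr_of u b = incr_of s a.
    by apply: contrapT => /forallNP H'; apply: (H a) => b hb; apply: (H' b).
  have [g gP] := choice H.
  have gi : injective g.
    by move=> a b e; apply: (incr_inj (enum_valP s)); rewrite -/(incr_of s) -!gP e.
  have e : fperm (incr_of s) 1%g = fperm (incr_of u) (perm gi).
    by apply/ffunP => a; rewrite !ffunE perm1 permE gP.
  apply: enum_val_inj.
  by have /(congr1 fst) := fperm_inj (x := (_, _)) (y := (_, _)) (enum_valP s) (enum_valP u) e.
have E : extpow t B *m extpow t (invmx B) = 1%:M by rewrite -extpowM mulmxV.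
by have [] := mulmx1_unit E.
Qed.

Lemma ext_gt0 t k (B : 'M[R]_k) : (t <= k)%N -> B \in unitmx -> 0 < opnorm (extpow t B).
Proof.
move=> tk Bu; apply: opnorm_unit_gt0; last exact: extpow_unit.
by apply/card_gt0P; exists (lead tk); exact: lead_incr.
Qed.

(* Complete pivoting plays the role of the singular value decomposition: up to controlled factors, all the exterior powers of [B1] and [B2] are largest on the leading coordinates. *)
Lemma ext_product_lower k : exists (kap : R) (C : nat -> R),
  [/\ 1 <= kap, forall t, 0 < C t & forall B1 B2 : 'M[R]_k, exists K L,
   [/\ controlled kap K, controlled kap L & forall M t (tk : (t <= k)%N) c,
      c <= `|minor (lead tk) (lead tk) (L *m M *m K)| ->
      c * (opnorm (extpow t B2) * opnorm (extpow t B1)) <=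
      C t * opnorm (extpow t (B2 *m M *m B1))]].
Proof.
have [kap [kap1 hkap]] := @pivot_decomposition R k.
have kap0 : 0 <= kap by exact: le_trans kap1.
pose e t := ext_bound t k kap.
have e0 t : 0 <= e t by rewrite !mulr_ge0// exprn_ge0.
pose q t := kap ^+ t * opnorm (extpow t (1%:M : 'M[R]_k)) * (#|incr t k| * #|incr t k|)%:R.
have q0 t : 0 <= q t by rewrite !mulr_ge0 ?exprn_ge0 ?opnorm_ge0.
pose s t := e t * q t * e t.
have s0 t : 0 <= s t by rewrite /s mulr_ge0 ?e0// mulr_ge0 ?e0 ?q0.
have C0 t : 0 <= s t * s t * (e t * e t) by apply: mulr_ge0; apply: mulr_ge0.
exists kap, (fun t => s t * s t * (e t * e t) + 1); split => //.
  by move=> t; rewrite ltr_wpDl.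
move=> B1 B2.
have [K1 [L1 [d1 [cK1 cL1 B1E d1le]]]] := hkap B1.
have [K2 [L2 [d2 [cK2 cL2 B2E d2le]]]] := hkap B2.
exists K1, L2; split => // M t tk c hc.
have diagle (d : 'rV[R]_k) (K L B : 'M[R]_k) : controlled kap K -> controlled kap L ->
   (forall i j : 'I_k, (i <= j)%N -> `|d 0 j| <= kap * `|d 0 i|) ->
   B = K *m diag_mx d *m L ->
   opnorm (extpow t B) <= s t * `|\prod_a d 0 (lead tk a)|.
  move=> [_ hK _] [_ hL _] dle ->.
  have hd : opnorm (extpow t (diag_mx d)) <= q t * `|\prod_a d 0 (lead tk a)|.
    have -> : q t * `|\prod_a d 0 (lead tk a)| =
      `|\prod_a d 0 (lead tk a)| * kap ^+ t * opnorm (extpow t (1%:M : 'M[R]_k)) * (#|incr t k| * #|incr t k|)%:R.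
      by rewrite /q; ring.
    apply: opnorm_le_entries => a b; rewrite extpowE.
    rewrite (@minor_scale _ _ _ _ (incr_of a) (incr_of b) (fun i => d 0 i) (fun=> 1) 1%:M); last first.
      by move=> i j; rewrite !mxE mulr1; case: eqP => _; rewrite ?mulr1n ?mulr1 ?mulr0n ?mulr0.
    rewrite [X in _ * X]big1_eq mulr1 normrM; apply: ler_pM => //; last first.
      by rewrite -extpowE; exact: entry_le_opnorm.
    rewrite !normr_prod mulrC.
    have -> : kap ^+ t = \prod_(a < t) kap by rewrite prodr_const card_ord.
    rewrite -big_split /=; apply: ler_prod => i _; rewrite normr_ge0 /=.
    by apply: dle; rewrite ffunE; exact: incr_ge (enum_valP a) i.
  rewrite !extpowM; apply: (le_trans (opnormM _ _)).
  have -> : s t * `|\prod_a d 0 (lead tk a)| = e t * (q t * `|\prod_a d 0 (lead tk a)|) * e t.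
    by rewrite /s; ring.
  apply: ler_pM; rewrite ?opnorm_ge0//; last exact: opnorm_ext_le.
  apply: (le_trans (opnormM _ _)).
  by apply: ler_pM; rewrite ?opnorm_ge0//; exact: opnorm_ext_le.
have h1 := diagle _ _ _ _ cK1 cL1 d1le B1E.
have h2 := diagle _ _ _ _ cK2 cL2 d2le B2E.
have [/ltW c0|c0] := ltP c 0.
  apply: (@le_trans _ _ 0); first by rewrite mulr_le0_ge0// mulr_ge0 ?opnorm_ge0.
  by rewrite mulr_ge0 ?opnorm_ge0// addr_ge0.
set Z := B2 *m M *m B1.
have hZ : `|\prod_a d2 0 (lead tk a)| * c * `|\prod_a d1 0 (lead tk a)| <= e t * opnorm (extpow t Z) * e t.
  have [K1u _ _] := cK1; have [K2u _ hK2] := cK2; have [L1u _ hL1] := cL1.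
  pose N := diag_mx d2 *m (L2 *m M *m K1) *m diag_mx d1.
  have NE : N = invmx K2 *m Z *m invmx L1.
    rewrite /N /Z B1E B2E -!mulmxA (mulKmx K2u) mulmxV// mulmx1.
    by rewrite !mulmxA.
  apply: (@le_trans _ _ `|minor (lead tk) (lead tk) N|).
    rewrite (@minor_scale _ _ _ _ (lead tk) (lead tk) (fun i => d2 0 i) (fun j => d1 0 j) (L2 *m M *m K1)); last first.
      by move=> i j; rewrite /N mul_mx_diag mul_diag_mx; move: (L2 *m M *m K1) => B; rewrite !mxE.
    by rewrite !normrM ler_wpM2r// ler_wpM2l.
  apply: (le_trans (minor_le_ext _ _)); rewrite NE !extpowM.
  apply: (le_trans (opnormM _ _)); apply: ler_pM; rewrite ?opnorm_ge0//; last exact: opnorm_ext_le.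
  apply: (le_trans (opnormM _ _)); apply: ler_pM; rewrite ?opnorm_ge0//; exact: opnorm_ext_le.
apply: (@le_trans _ _ (c * ((s t * `|\prod_a d2 0 (lead tk a)|) * (s t * `|\prod_a d1 0 (lead tk a)|)))).
  by apply: ler_wpM2l => //; apply: ler_pM; rewrite ?opnorm_ge0.
have -> : c * ((s t * `|\prod_a d2 0 (lead tk a)|) * (s t * `|\prod_a d1 0 (lead tk a)|)) =
  s t * s t * (`|\prod_a d2 0 (lead tk a)| * c * `|\prod_a d1 0 (lead tk a)|) by ring.
apply: (@le_trans _ _ (s t * s t * (e t * opnorm (extpow t Z) * e t))).
  by apply: ler_wpM2l => //; rewrite mulr_ge0.
by rewrite mulrDl mul1r ler_wpDr ?opnorm_ge0// le_eqVlt; apply/orP; left; apply/eqP; ring.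
Qed.

End ExteriorBounds.

(** * Typicality as nonvanishing of minors in the eigenbasis *)

Section GeneralPosition.
Context {R : realType} {k : nat}.

Definition eigenbasis (v : 'I_k -> 'cV[R]_k) : 'M[R]_k := \matrix_(i, j) v j i 0.

Lemma col_eigenbasis v j : col j (eigenbasis v) = v j.
Proof. by apply/matrixP => i l; rewrite !mxE ord1. Qed.

(** With a zero coefficient along [v w], the vector [psi *m v u] would lie in the span of the
    others. *)
Lemma general_position_coef n m (psi : 'M[R]_n) (v : 'I_m -> 'cV[R]_n) (c : 'I_m -> 'I_m -> R) :
  in_general_position psi v -> (forall u, psi *m v u = \sum_w c w u *: v w) ->
  forall w u, c w u != 0.
Proof.
move=> gp h w u; apply/eqP => c0; have /negP := gp u w; apply.
rewrite h (bigD1 w)//= c0 scale0r add0r; apply: memv_suml => l lw.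
apply: memvZ; apply: memv_span; apply/mapP; exists l => //.
by rewrite mem_filter lw mem_enum.
Qed.

Lemma mulmx_col_sum n m (B : 'M[R]_(n, m)) (C : 'M[R]_m) u :
  col u (B *m C) = \sum_w C w u *: col w B.
Proof.
apply/matrixP => i j; rewrite mxE mxE summxE; apply: eq_bigr => l _.
by rewrite !mxE mulrC.
Qed.

(** The wedges of eigenvectors are the columns of [extpow t V], so the coefficients of their images
    are the entries of the exterior power of [invmx V *m psi *m V], that is, its minors. *)
Lemma general_position_minor t (psi : 'M[R]_k) (v : 'I_k -> 'cV[R]_k) :
  eigenbasis v \in unitmx ->
  in_general_position (extpow t psi) (@wedge_eigenvector R k t v) ->
  forall s u : 'I_#|incr t k|,
    minor (incr_of s) (incr_of u) (invmx (eigenbasis v) *m psi *m eigenbasis v) != 0.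
Proof.
set V := eigenbasis v => Vu gp s u.
set psi' := invmx V *m psi *m V.
have wE w : wedge_eigenvector v w = col w (extpow t V).
  apply/matrixP => i j; rewrite ord1 [RHS]mxE extpowE !mxE.
  by congr (\det _); apply/matrixP => a b; rewrite !mxE.
rewrite -extpowE; apply: (general_position_coef (c := fun s u => extpow t psi' s u) gp) => {s}u.
under eq_bigr do rewrite wE.
rewrite -mulmx_col_sum wE -extpowM.
have -> : V *m psi' = psi *m V by rewrite /psi' !mulmxA mulmxV// mul1mx.
by rewrite extpowM !colE mulmxA.
Qed.

(** Order 1 is separate because 1-typicality is stated for [psi] itself and not for
    [extpow 1 psi]. *)
Lemma general_position_minor1 (psi : 'M[R]_k) (v : 'I_k -> 'cV[R]_k) :
  eigenbasis v \in unitmx -> in_general_position psi v ->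
  forall s u : 'I_#|incr 1 k|,
    minor (incr_of s) (incr_of u) (invmx (eigenbasis v) *m psi *m eigenbasis v) != 0.
Proof.
set V := eigenbasis v => Vu gp s u.
set psi' := invmx V *m psi *m V.
rewrite /minor det_mx11 mxE; apply: (general_position_coef (c := fun i j => psi' i j) gp) => j.
rewrite (eq_bigr (fun w => psi' w j *: col w V)); last by move=> w _; rewrite col_eigenbasis.
rewrite -mulmx_col_sum /psi' !mulmxA mulmxV// mul1mx -[v j]col_eigenbasis.
by rewrite !colE mulmxA.
Qed.

Lemma general_position_minors (psi : 'M[R]_k) (v : 'I_k -> 'cV[R]_k) :
  eigenbasis v \in unitmx -> in_general_position psi v ->
  (forall t, (2 <= t < k)%N -> in_general_position (extpow t psi) (@wedge_eigenvector R k t v)) ->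
  forall t (s u : 'I_#|incr t k|), (t < k)%N ->
    minor (incr_of s) (incr_of u) (invmx (eigenbasis v) *m psi *m eigenbasis v) != 0.
Proof.
move=> Vu gp1 gp [|[|t]] s u tk.
- by rewrite /minor det_mx00 oner_neq0.
- exact: general_position_minor1.
- by apply: general_position_minor => //; exact: gp.
Qed.

(** Applying the product of the [P - lam l] over [l != i] to a linear relation isolates its [i]-th
    term, multiplied by a nonzero scalar. *)
Lemma eigenbasis_unit (P : 'M[R]_k) (lam : 'I_k -> R) (v : 'I_k -> 'cV[R]_k) :
  injective lam -> (forall i, v i != 0 /\ P *m v i = lam i *: v i) ->
  eigenbasis v \in unitmx.
Proof.
move=> li hv; rewrite -unitmx_tr -row_free_unit -kermx_eq0.
apply: contraT => /rowV0Pn[w /sub_kermxP wV w0].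
have Vw : \sum_i w 0 i *: v i = 0.
  apply/matrixP => a b; rewrite ord1 mxE summxE.
  move/matrixP/(_ 0 a): wV; rewrite !mxE => e; rewrite -[RHS]e.
  by apply: eq_bigr => l _; rewrite !mxE.
have prodV (s : seq 'I_k) : \sum_i (w 0 i * \prod_(l <- s) (lam i - lam l)) *: v i = 0.
  elim: s => [|l s IH].
    by rewrite -[RHS]Vw; apply: eq_bigr => i _; rewrite big_nil mulr1.
  move/(congr1 (fun x => P *m x - lam l *: x)): IH.
  rewrite mulmx0 scaler0 subr0 mulmx_sumr scaler_sumr -sumrB => IH.
  rewrite -[RHS]IH; apply: eq_bigr => i _.
  rewrite -scalemxAr (proj2 (hv i)) !scalerA -scalerBl big_cons; congr (_ *: _); ring.
have [i wi] : exists i, w 0 i != 0.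
  apply: contrapT => /forallNP H; move/eqP: w0; apply; apply/matrixP => a b.
  by rewrite ord1 mxE; apply/eqP/negPn/negP; exact: H.
have := prodV [seq l <- enum 'I_k | l != i].
rewrite (bigD1 i)//= [X in _ + X]big1 ?addr0 => [/eqP|j ji].
  rewrite scaler_eq0 mulf_eq0 (negbTE wi) (negbTE (proj1 (hv i))) orbF /=.
  rewrite prodf_seq_eq0 => /hasP[l]; rewrite mem_filter => /andP[li' _] /=.
  by rewrite subr_eq0 => /eqP/li il; rewrite il eqxx in li'.
rewrite [X in (_ * X)](_ : _ = 0) ?mulr0 ?scale0r//.
apply/eqP; rewrite prodf_seq_eq0; apply/hasP; exists j; last by rewrite /= subrr.
by rewrite mem_filter ji mem_enum.
Qed.

Lemma eigenbasis_diag (P : 'M[R]_k) (lam : 'I_k -> R) (v : 'I_k -> 'cV[R]_k) :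
  (forall i, v i != 0 /\ P *m v i = lam i *: v i) ->
  P *m eigenbasis v = eigenbasis v *m diag_mx (\row_i lam i).
Proof.
move=> hv; apply/matrixP => i j; rewrite mul_mx_diag [RHS]mxE.
have /matrixP/(_ i 0) := proj2 (hv j); rewrite !mxE => e.
rewrite mulrC -[RHS]e; by apply: eq_bigr => l _; rewrite mxE.
Qed.

End GeneralPosition.

(** * Subshifts: agreement windows, compactness and gluing *)

Section ShiftSpace.
Context {q : nat} {Q : 'M[bool]_q}.
Implicit Types x y z w : subshift Q.

Lemma subshift_ext x y : (forall i, sval x i = sval y i) -> x = y.
Proof.
case: x y => [f hf] [g hg] /= fg; have e : f = g by exact/funext.
by subst g; congr (exist _ _ _); exact: Prop_irrelevance.
Qed.

Lemma Tpow0 x : Tpow 0 x = x.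
Proof. by apply: subshift_ext => i /=; rewrite addr0. Qed.

Lemma TpowD m n x : Tpow m (Tpow n x) = Tpow (m + n) x.
Proof. by apply: subshift_ext => i /=; rewrite addrA. Qed.

Lemma agree0 x y : agree x y 0.
Proof. by move=> i; rewrite normr_lt0. Qed.

Lemma agree_le x y m n : (m <= n)%N -> agree x y n -> agree x y m.
Proof. by move=> mn h i im; apply: h; apply: (lt_le_trans im); rewrite lez_nat. Qed.

Lemma agree_trans x y z m : agree x y m -> agree y z m -> agree x z m.
Proof. by move=> h h' i im; rewrite h// h'. Qed.

Lemma agree_shift x y m n (s : int) : (m + `|s| <= n)%N -> agree x y n ->
  agree (Tpow s x) (Tpow s y) m.
Proof. by move=> mn h i im /=; apply: h; lia. Qed.

(** Distinct sequences differ at some coordinate, which bounds their agreement windows; so a largest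
    window exists and [xget] does not return its default. *)
Lemma separationP x y : x <> y -> agree x y (separation x y) /\
  forall m, agree x y m -> (m <= separation x y)%N.
Proof.
move=> xy.
have [i xyi] : exists i, sval x i <> sval y i.
  by apply: contrapT => /forallNP h; apply: xy; apply: subshift_ext => i; exact: contrapT (h i).
have bnd m : agree x y m -> (m <= `|i|)%N.
  by move=> h; rewrite leqNgt; apply/negP => im; apply: xyi; apply: h; lia.
rewrite /separation; case: xgetP => [m _ []//|] H; exfalso.
have ex : exists m, `[<agree x y m>] by exists 0%N; apply/asboolP; exact: agree0.
have bd m : `[<agree x y m>] -> (m <= `|i|)%N by move/asboolP/bnd.
case: (ex_maxnP ex bd) => m /asboolP am mm.
by apply: (H m); split => // m' /asboolP/mm.
Qed.

Lemma sub_pigeonhole (T : finType) (c : nat -> T) :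
  exists v, forall J, exists2 j, (J <= j)%N & c j = v.
Proof.
apply: contrapT => /forallNP H.
have {}H v : exists J, forall j, (J <= j)%N -> c j <> v.
  apply: contrapT => /forallNP H'; apply: (H v) => J; apply: contrapT => H2.
  by apply: (H' J) => j Jj cj; apply: H2; exists j.
have [g gP] := choice H.
by apply: (gP (c (\max_v g v)) (\max_v g v)%N _ erefl); exact: leq_bigmax.
Qed.

(* Compactness of the subshift, in the form of Koenig's lemma. *)
Lemma local_to_uniform (P : nat -> subshift Q -> Prop) :
  (forall i j x, (i <= j)%N -> P i x -> P j x) ->
  (forall x, exists n j, forall y, agree x y n -> P j y) ->
  exists j, forall x, P j x.
Proof.
move=> Pmono Ploc; apply: contrapT => /forallNP H.
have {}H j : exists x, ~ P j x by apply/existsNP; exact: H.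
pose bad n w := forall j, exists2 x, agree w x n & ~ P j x.
have [w0 _] := H 0%N.
have bad0 : bad 0%N w0 by move=> j; have [x Px] := H j; exists x => //; exact: agree0.
have step n w : exists w', bad n w -> agree w w' n /\ bad n.+1 w'.
  have [b|nb] := pselect (bad n w); last by exists w.
  have {}b j : exists x, agree w x n /\ ~ P j x by have [x ? ?] := b j; exists x.
  have [g gP] := choice b.
  have [v hv] := sub_pigeonhole (fun j => (sval (g j) (- n%:Z), sval (g j) n%:Z)).
  have [j0 _ v0] := hv 0%N.
  exists (g j0) => _; split; first by case: (gP j0).
  move=> j; have [j1 jj1 v1] := hv j; exists (g j1); last first.
    by move=> /(Pmono _ _ _ jj1); case: (gP j1).
  have [a0 _] := gP j0; have [a1 _] := gP j1.
  move: v0; rewrite -v1 => -[vN vP] i im.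
  have [im'|[->|->]] // : `|i| < n%:Z \/ i = n%:Z \/ i = - n%:Z by lia.
  by rewrite -a0// a1.
have [g gP] : exists g : nat -> subshift Q -> subshift Q,
    forall n w, bad n w -> agree w (g n w) n /\ bad n.+1 (g n w).
  have [g gP] := choice (fun nw : nat * subshift Q => step nw.1 nw.2).
  by exists (fun n w => g (n, w)) => n w; exact: (gP (n, w)).
pose u := fix u n := if n is m.+1 then g m (u m) else w0.
have bu n : bad n (u n) by elim: n => // n /gP[].
have au n : agree (u n) (u n.+1) n by case: (gP _ _ (bu n)).
have aum m n : (m <= n)%N -> agree (u m) (u n) m.
  elim: n => [|n IH]; first by rewrite leqn0 => /eqP->.
  rewrite leq_eqVlt => /orP[/eqP-> //|]; rewrite ltnS => mn.
  by apply: (agree_trans (IH mn)); apply: agree_le mn (au n).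
have uE (i : int) n : (absz i < n)%N -> sval (u (absz i).+1) i = sval (u n) i.
  by move=> h; apply: (aum _ _ h); lia.
have hx (i : int) : Q (sval (u (absz i).+1) i) (sval (u (absz (i + 1)).+1) (i + 1)).
  pose n := (absz i + absz (i + 1)).+1.
  rewrite (uE i n) ?(uE (i + 1) n); [exact: (svalP (u n))|rewrite /n; lia|rewrite /n; lia].
pose x : subshift Q := exist _ (fun i => sval (u (absz i).+1) i) hx.
have ax n : agree x (u n) n by move=> i im /=; rewrite (uE i n)//; lia.
have [n [j xP]] := Ploc x.
have [y yu] := bu n j; apply; apply: xP; exact: agree_trans (ax n) yu.
Qed.

Lemma glue_subproof (c : int) x y : sval x c = sval y c ->
  forall i : int, Q (if i < c then sval x i else sval y i)
                    (if i + 1 < c then sval x (i + 1) else sval y (i + 1)).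
Proof.
move=> e i; case: (ltP i c) => ic.
  case: ltP => ic'; first exact: (svalP x).
  have -> : i + 1 = c by lia.
  by have := svalP x i; rewrite -e; have -> : i + 1 = c by lia.
have -> : (i + 1 < c) = false by lia.
exact: (svalP y).
Qed.

(** The local product structure: one past and one future joined at a common symbol. *)
Definition glue (c : int) x y (e : sval x c = sval y c) : subshift Q :=
  exist _ (fun i : int => if i < c then sval x i else sval y i) (glue_subproof e).

Lemma glue_ex (c : int) x y : sval x c = sval y c -> exists w,
  (forall i, i <= c -> sval w i = sval x i) /\ (forall i, c <= i -> sval w i = sval y i).
Proof.
move=> e; exists (glue e); split => i ic /=; last by rewrite ltNge ic.
by case: ltP => // ci; have -> : i = c by lia.
Qed.

End ShiftSpace.

(** * The metric and topological mixing *)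

Section Metric.
Context {R : realType} {q : nat} {Q : 'M[bool]_q}.
Variable omega : R.
Hypothesis omega01 : 0 < omega < 1.
Implicit Types x y z w : subshift Q.

Lemma dist_agree x y m : agree x y m -> dist omega x y <= omega ^+ m.
Proof.
case/andP: omega01 => o0 o1 h; rewrite /dist; case: eqP => [_|xy].
  by rewrite exprn_ge0// ltW.
have [_ /(_ _ h) hm] := separationP xy.
by rewrite ler_wiXn2l// ltW.
Qed.

Lemma dist_ge0 x y : 0 <= dist omega x y.
Proof.
case/andP: omega01 => o0 _; rewrite /dist; case: eqP => // _.
by rewrite exprn_ge0// ltW.
Qed.

(** The strict inequality gains a coordinate: a distance below [omega ^+ m] means that [separation]
    exceeds [m]. *)
Lemma agree_dist x y m : dist omega x y < omega ^+ m -> agree x y m.+1.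
Proof.
case/andP: omega01 => o0 o1; rewrite /dist; case: eqP => [->//|xy].
rewrite ltr_iXn2l// => h; have [a _] := separationP xy; exact: agree_le a.
Qed.

Lemma holder_agree k (A : subshift Q -> 'M[R]_k) (r : R) : 0 < r -> holder omega r A ->
  exists2 C : R, 0 <= C & forall x y m, agree x y m ->
    opnorm (A x - A y) <= C * (omega `^ r) ^+ m.
Proof.
case/andP: omega01 => o0 o1 r0 [C hC].
exists `|C| => // x y m h; apply: (le_trans (hC x y)).
apply: (@le_trans _ _ (`|C| * dist omega x y `^ r)).
  by rewrite ler_wpM2r ?powR_ge0// ler_norm.
rewrite ler_wpM2l// -powR_mulrn ?powR_ge0// -powRrM mulrC powRrM powR_mulrn ?(ltW o0)//.
apply: (ge0_ler_powR (ltW r0)); rewrite ?nnegrE ?dist_ge0 ?exprn_ge0 ?(ltW o0)//.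
exact: dist_agree.
Qed.

Lemma dopen_cyl (i : int) (a : 'I_q) : dopen omega [set x : subshift Q | sval x i = a].
Proof.
case/andP: omega01 => o0 o1.
move=> x /= xa; exists (omega ^+ `|i|%N); first exact: exprn_gt0.
by move=> y /agree_dist/(_ i) <-//; lia.
Qed.

(** Mixing is applied to pairs of one-symbol cylinders. There are finitely many, so one transition
    time [N0] works for all of them, and the transition is then glued between any past and any
    future. *)
Lemma mixing_connect : @topologically_mixing R q Q omega ->
  exists N0 : nat, (0 < N0)%N /\ forall x y (i j : int), exists w,
    (forall l : int, l <= i -> sval w l = sval x l) /\
    (forall l : int, 0 <= l -> sval w (i + N0%:Z + l) = sval y (j + l)).
Proof.
move=> mix.
have H (ab : 'I_q * 'I_q) : exists N, forall n, (N <= n)%N -> forall x y (i j : int),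
    sval x i = ab.1 -> sval y j = ab.2 ->
    exists w, sval w 0 = ab.1 /\ sval w n%:Z = ab.2.
  have [[[x0 [i0 x0a]] [y0 [j0 y0b]]]|no] := pselect ((exists x i, sval x i = ab.1) /\
      (exists y j, sval y j = ab.2)); last first.
    exists 0%N => n _ x y i j xa yb; exfalso; apply: no; split; [by exists x, i|by exists y, j].
  have [||N hN] := mix _ _ (@dopen_cyl 0 ab.1) (@dopen_cyl 0 ab.2).
  - by exists (Tpow i0 x0); rewrite /= add0r.
  - by exists (Tpow j0 y0); rewrite /= add0r.
  exists N => n /hN[_ [[w wa <-]]] /=; rewrite add0r => wb x y i j _ _.
  by exists w.
have {H}[g gP] := choice H.
exists (\max_ab g ab).+1; split => // x y i j.
have hN : (g (sval x i, sval y j) <= (\max_ab g ab).+1)%N by apply: leqW; exact: (leq_bigmax (F := g) (sval x i, sval y j)).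
have [w [w0 wn]] := gP _ _ hN x y i j erefl erefl.
set N := (\max_ab g ab).+1 in wn *.
have [u [u1 u2]] : exists u : subshift Q, (forall l, l <= i -> sval u l = sval x l) /\
    (forall l, i <= l -> sval u l = sval (Tpow (- i) w) l).
  by apply: (@glue_ex _ _ i x (Tpow (- i) w)); rewrite /= subrr w0.
have [v [v1 v2]] : exists v : subshift Q, (forall l, l <= i + N%:Z -> sval v l = sval u l) /\
    (forall l, i + N%:Z <= l -> sval v l = sval (Tpow (j - i - N%:Z) y) l).
  apply: (@glue_ex _ _ (i + N%:Z) u (Tpow (j - i - N%:Z) y)); rewrite u2 /=; last by lia.
  have -> : i + N%:Z - i = N%:Z by lia.
  by rewrite wn /=; congr (sval y _); lia.
exists v; split => l hl; first by rewrite v1 ?u1//; lia.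
by rewrite v2 /=; [congr (sval y _); lia|lia].
Qed.

End Metric.

(** * Ratios of nearby matrix products *)

Section MatrixProducts.
Context {R : realType} {k : nat}.

Fixpoint pseq (a : nat -> 'M[R]_k) (n : nat) : 'M[R]_k :=
  if n is m.+1 then a m *m pseq a m else 1%:M.

Lemma pseq_unit a n : (forall i, a i \in unitmx) -> pseq a n \in unitmx.
Proof.
by move=> au; elim: n => [|n IH] /=; rewrite ?unitmx1// unitmx_mul au.
Qed.

Lemma pseq_cat a m n : pseq a (m + n) = pseq (fun i => a (m + i)%N) n *m pseq a m.
Proof.
elim: n => [|n IH]; first by rewrite addn0 mul1mx.
by rewrite addnS /= IH mulmxA.
Qed.

Lemma pseq_eq a b n : (forall i, a i = b i) -> pseq a n = pseq b n.
Proof. by move=> ab; elim: n => //= n ->; rewrite ab. Qed.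

Lemma mul_near (B C : 'M[R]_k) e : 0 < e -> exists2 d, 0 < d & forall B' C',
  opnorm (B' - B) < d -> opnorm (C' - C) < d -> opnorm (B' *m C' - B *m C) < e.
Proof.
move=> e0; pose M := opnorm B + opnorm C + 1.
have M0 : 0 < M by rewrite ltr_wpDl// addr_ge0 ?opnorm_ge0.
have MB : opnorm B <= M by rewrite /M -addrA lerDl addr_ge0 ?opnorm_ge0.
exists (Order.min 1 (e / (4 * M))); first by rewrite lt_min ltr01 divr_gt0// mulr_gt0.
move=> B' C'; rewrite !lt_min => /andP[b1 b2] /andP[c1 c2].
have -> : B' *m C' - B *m C = (B' - B) *m C' + B *m (C' - C).
  by rewrite mulmxBl mulmxBr addrA subrK.
have C'M : opnorm C' <= M.
  apply: (le_trans (opnorm_triBD _ C)).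
  by rewrite /M -addrA ler_wpDl ?opnorm_ge0// lerD2l ltW.
apply: (@le_lt_trans _ _ (e / (4 * M) * M + M * (e / (4 * M)))).
  apply: (le_trans (opnormD _ _)); apply: lerD; apply: (le_trans (opnormM _ _)).
    by apply: ler_pM; rewrite ?opnorm_ge0// ltW.
  by apply: ler_pM; rewrite ?opnorm_ge0// ltW.
have -> : e / (4 * M) * M + M * (e / (4 * M)) = e / 2 by field; rewrite gt_eqF.
by rewrite ltr_pdivrMr// ltr_pMr// ltr1n.
Qed.

(* The increments of the ratio decay like [tau ^ n] since the distortion of the factors contributes only a bounded factor [expR]. *)
Lemma pseq_ratio_step (theta tau c0 : R) : 0 < theta < 1 -> 0 < tau < 1 -> 0 <= c0 ->
  forall Kmax, 0 <= Kmax -> exists2 G, 0 <= G &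
  forall K a b, 0 <= K <= Kmax -> (forall i, b i \in unitmx) ->
   (forall i, opnorm (b i) * opnorm (invmx (b i)) * theta <= tau) ->
   (forall i, opnorm (invmx (b i)) <= c0) ->
   (forall i, opnorm (a i - b i) <= K * theta ^+ i) ->
   forall n, opnorm (invmx (pseq b n.+1) *m pseq a n.+1 - invmx (pseq b n) *m pseq a n)
      <= G * K * tau ^+ n.
Proof.
move=> /andP[th0 th1] /andP[t0 t1] c00 Kmax Kmax0.
pose H := expR (c0 * Kmax / tau * (1 - theta)^-1).
exists (c0 * H); first by rewrite mulr_ge0// expR_ge0.
move=> K a b /andP[K0 KK] bu btau bc0 hab n.
have th1' : 0 < 1 - theta by rewrite subr_gt0.
pose D n := opnorm (invmx (pseq b n)) * opnorm (pseq a n) * theta ^+ n.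
have Dle m : D m <= tau ^+ m * expR (c0 * Kmax / tau * \sum_(i < m) theta ^+ i).
  elim: m => [|m IH].
    rewrite /D /= !expr0 mulr1 mul1r big_ord0 mulr0 expR0 invmx1.
    by rewrite mulr_ile1 ?opnorm_ge0 ?opnorm1.
  apply: (@le_trans _ _ (D m * (tau * (1 + c0 * Kmax / tau * theta ^+ m)))).
    rewrite /D /= invmx_mul ?pseq_unit//.
    apply: (@le_trans _ _ ((opnorm (invmx (pseq b m)) * opnorm (invmx (b m))) *
       (opnorm (a m) * opnorm (pseq a m)) * theta ^+ m.+1)).
      apply: ler_wpM2r; first by rewrite exprn_ge0// ltW.
      by apply: ler_pM; rewrite ?opnorm_ge0 ?opnormM.
    have -> : (opnorm (invmx (pseq b m)) * opnorm (invmx (b m))) *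
       (opnorm (a m) * opnorm (pseq a m)) * theta ^+ m.+1 =
       (opnorm (invmx (pseq b m)) * opnorm (pseq a m) * theta ^+ m) *
       (opnorm (a m) * opnorm (invmx (b m)) * theta) by rewrite exprS; ring.
    apply: ler_wpM2l; first by rewrite !mulr_ge0 ?opnorm_ge0// exprn_ge0// ltW.
    apply: (@le_trans _ _ ((opnorm (b m) + K * theta ^+ m) * opnorm (invmx (b m)) * theta)).
      rewrite ler_pM2r//; apply: ler_wpM2r; first exact: opnorm_ge0.
      by apply: (le_trans (opnorm_triBD (a m) (b m))); rewrite lerD2l.
    rewrite mulrDl mulrDl mulrDr mulr1; apply: lerD; first exact: btau.
    have -> : tau * (c0 * Kmax / tau * theta ^+ m) = Kmax * theta ^+ m * c0 * 1.
      by rewrite mulr1; field; rewrite gt_eqF.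
    apply: ler_pM; rewrite ?mulr_ge0 ?opnorm_ge0 ?exprn_ge0 ?(ltW th0) ?(ltW th1)//.
    apply: ler_pM; rewrite ?mulr_ge0 ?opnorm_ge0 ?exprn_ge0 ?(ltW th0)//.
    by apply: ler_wpM2r => //; rewrite exprn_ge0// ltW.
  have e0 : 0 <= c0 * Kmax / tau * theta ^+ m.
    by rewrite !mulr_ge0 ?invr_ge0 ?exprn_ge0// ltW.
  rewrite big_ord_recr /= [c0 * Kmax / tau * (_ + _)]mulrDr expRD exprSr.
  apply: (@le_trans _ _ (tau ^+ m * expR (c0 * Kmax / tau * \sum_(i < m) theta ^+ i) *
     (tau * (1 + c0 * Kmax / tau * theta ^+ m)))).
    by apply: ler_wpM2r => //; rewrite mulr_ge0 ?(ltW t0)// addr_ge0.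
  rewrite -!mulrA ler_pM2l ?exprn_gt0// [X in _ <= X]mulrCA ler_pM2l ?expR_gt0//.
  by rewrite ler_pM2l// expR_ge1Dx.
have DH m : D m <= H * tau ^+ m.
  apply: (le_trans (Dle m)); rewrite mulrC ler_pM2r ?exprn_gt0// ler_expR.
  apply: ler_wpM2l; first by rewrite !mulr_ge0 ?invr_ge0// ltW.
  rewrite -[X in _ <= X]mul1r ler_pdivlMr//.
  have -> : (\sum_(i < m) theta ^+ i) * (1 - theta) = 1 - theta ^+ m.
    by rewrite mulrC -[LHS]opprK -mulNr opprB -subrX1 opprB.
  by rewrite gerBl exprn_ge0// ltW.
have -> : invmx (pseq b n.+1) *m pseq a n.+1 - invmx (pseq b n) *m pseq a n =
   invmx (pseq b n) *m (invmx (b n) *m (a n - b n)) *m pseq a n.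
  rewrite /= invmx_mul ?pseq_unit// !mulmxBr mulVmx// mulmxBl mulmx1.
  by rewrite !mulmxA.
apply: (le_trans (opnormM _ _)).
apply: (@le_trans _ _ (opnorm (invmx (pseq b n)) * (c0 * (K * theta ^+ n)) * opnorm (pseq a n))).
  apply: ler_wpM2r; first exact: opnorm_ge0.
  apply: (le_trans (opnormM _ _)); apply: ler_wpM2l; first exact: opnorm_ge0.
  by apply: (le_trans (opnormM _ _)); apply: ler_pM; rewrite ?opnorm_ge0.
have -> : opnorm (invmx (pseq b n)) * (c0 * (K * theta ^+ n)) * opnorm (pseq a n) =
  c0 * K * D n by rewrite /D; ring.
have -> : c0 * H * K * tau ^+ n = c0 * K * (H * tau ^+ n) by ring.
by apply: ler_wpM2l; rewrite ?mulr_ge0.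
Qed.

(** Sums the geometric series of increments. The bound is linear in [K], with [G] depending only on
    the ceiling [Kmax], so sequences that are close from the start have ratios close to the identity
    at all times. *)
Lemma pseq_ratio_cauchy (theta tau c0 : R) : 0 < theta < 1 -> 0 < tau < 1 -> 0 <= c0 ->
  forall Kmax, 0 <= Kmax -> exists2 G, 0 <= G &
  forall K a b, 0 <= K <= Kmax -> (forall i, b i \in unitmx) ->
   (forall i, opnorm (b i) * opnorm (invmx (b i)) * theta <= tau) ->
   (forall i, opnorm (invmx (b i)) <= c0) ->
   (forall i, opnorm (a i - b i) <= K * theta ^+ i) ->
   forall N n, (N <= n)%N ->
    opnorm (invmx (pseq b n) *m pseq a n - invmx (pseq b N) *m pseq a N) <= G * K * tau ^+ N.
Proof.
move=> th /andP[t0 t1] c00 Kmax Kmax0.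
have t01 : 0 < tau < 1 by rewrite t0.
have [G G0 hG] := pseq_ratio_step th t01 c00 Kmax0.
have t1' : 0 < 1 - tau by rewrite subr_gt0.
exists (G / (1 - tau)); first by rewrite divr_ge0// ltW.
move=> K a b hK bu b1 b2 b3 N n.
have [K0 _] := andP hK.
pose S n := invmx (pseq b n) *m pseq a n; rewrite -/(S n) -/(S N).
have key d : opnorm (S (N + d)%N - S N) <= G * K * tau ^+ N * ((1 - tau ^+ d) / (1 - tau)).
  elim: d => [|d IH]; first by rewrite addn0 subrr opnorm0 expr0 subrr mul0r mulr0.
  apply: (le_trans (opnorm_triB _ (S (N + d)%N) _)); rewrite addrC.
  have -> : G * K * tau ^+ N * ((1 - tau ^+ d.+1) / (1 - tau)) =
    G * K * tau ^+ N * ((1 - tau ^+ d) / (1 - tau)) + G * K * tau ^+ (N + d).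
    by rewrite exprD exprS; field; rewrite gt_eqF.
  by apply: lerD => //; rewrite addnS; apply: hG.
move=> /subnKC <-; apply: (le_trans (key _)).
have -> : G / (1 - tau) * K * tau ^+ N = G * K * tau ^+ N * (1 - tau)^-1 by ring.
apply: ler_wpM2l; first by rewrite !mulr_ge0// exprn_ge0// ltW.
by rewrite ler_piMl ?invr_ge0 ?(ltW t1')// gerBl exprn_ge0// ltW.
Qed.

End MatrixProducts.

(** * Products along orbits and finite-time holonomies *)

Section OrbitProducts.
Context {R : realType} {q : nat} {Q : 'M[bool]_q} {k : nat}.
Implicit Types (x y z w p : subshift Q) (F A : subshift Q -> 'M[R]_k).

(* [true] is forward and [false] backward time. *)
Definition shift_by (b : bool) (n : nat) : int := if b then n%:Z else - n%:Z.
(** Backward time starts at -1, since the first factor of [A^{-n}(x)] is the inverse of [A] at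
    [T^{-1} x]. *)
Definition shift_idx (b : bool) (i : nat) : int := if b then i%:Z else - i.+1%:Z.

Definition orbit_seq F b x (i : nat) := F (Tpow (shift_idx b i) x).
Definition orbit_prod F b n x := pseq (orbit_seq F b x) n.
(** The finite-time holonomy from [x] to [y]: stable for forward products of [A], unstable for
    backward products of its inverse. *)
Definition ratio F b n y x := invmx (orbit_prod F b n y) *m orbit_prod F b n x.

Definition time_map A (b : bool) x := if b then A x else invmx (A x).

Lemma orbit_prodD F b m n x :
  orbit_prod F b (m + n) x = orbit_prod F b n (Tpow (shift_by b m) x) *m orbit_prod F b m x.
Proof.
rewrite /orbit_prod pseq_cat; congr (_ *m _); apply: pseq_eq => i.
rewrite /orbit_seq TpowD; congr (F (Tpow _ x)); rewrite /shift_idx /shift_by.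
by case: b; lia.
Qed.

Lemma cocycle_fwdE A n x : cocycle_fwd A n x = orbit_prod A true n x.
Proof. by elim: n => //= n ->. Qed.

Lemma cocycle_posE A n x : cocycle A n%:Z x = orbit_prod (time_map A true) true n x.
Proof. exact: cocycle_fwdE. Qed.

Lemma cocycle_negE A n x : cocycle A (- n%:Z) x = orbit_prod (time_map A false) false n x.
Proof.
by case: n => [|n] //; elim: n => [|n IH] //; rewrite -[LHS]/(_ *m _) [X in _ *m X]IH.
Qed.

(** What remains of Hölder continuity and fibre bunching, in a form shared by [A] forward and its
    inverse backward, so that stable and unstable holonomies are treated together. [theta] is the
    rate of approach of the factors and [tau] the bunching rate. *)
Definition dominated (theta tau c0 C : R) F :=
  [/\ 0 < theta < 1, 0 < tau < 1, 0 <= c0, 0 <= C &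
   [/\ forall x, F x \in unitmx,
      forall x, opnorm (F x) * opnorm (invmx (F x)) * theta <= tau,
      forall x, opnorm (F x) <= c0, forall x, opnorm (invmx (F x)) <= c0 &
      forall x y m, agree x y m -> opnorm (F x - F y) <= C * theta ^+ m]].

Lemma orbit_prod_unit theta tau c0 C F b n x : dominated theta tau c0 C F ->
  orbit_prod F b n x \in unitmx.
Proof. by move=> [_ _ _ _ [h _ _ _ _]]; apply: pseq_unit => i; exact: h. Qed.

Lemma ratio_inv theta tau c0 C F b n x y : dominated theta tau c0 C F ->
  ratio F b n x y \in unitmx /\ invmx (ratio F b n x y) = ratio F b n y x.
Proof.
move=> dF; apply: invmx_uniq; rewrite /ratio mulmxA mulmxK ?(orbit_prod_unit _ _ _ dF)//.
by rewrite mulVmx// (orbit_prod_unit _ _ _ dF).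
Qed.

Lemma ratio_mul theta tau c0 C F b n x y : dominated theta tau c0 C F ->
  orbit_prod F b n x *m ratio F b n x y = orbit_prod F b n y.
Proof. by move=> dF; rewrite /ratio mulKVmx// (orbit_prod_unit _ _ _ dF). Qed.

(** The constant [K] stays explicit because [ratio_near1] turns a small [K] into a ratio close to
    the identity. *)
Definition asymptotic theta (K : R) F b x y :=
  forall i, opnorm (orbit_seq F b x i - orbit_seq F b y i) <= K * theta ^+ i.

Lemma ratio_cauchy theta tau c0 C F : dominated theta tau c0 C F ->
  forall Kmax, 0 <= Kmax -> exists2 G, 0 <= G & forall K b x y, 0 <= K <= Kmax ->
   asymptotic theta K F b x y -> forall N n, (N <= n)%N ->
   opnorm (ratio F b n x y - ratio F b N x y) <= G * K * tau ^+ N.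
Proof.
move=> [th t01 c00 C0 [Fu Ft F1 F2 FH]] Kmax Kmax0.
have [G G0 hG] := pseq_ratio_cauchy (k := k) th t01 c00 Kmax0.
exists G => // K b x y hK hxy N n Nn.
apply: (hG _ _ _ hK _ _ _ _ N n Nn) => i; [exact: Fu|exact: Ft|exact: F2|].
by rewrite opnormB; exact: hxy.
Qed.

Lemma ratio_near1 theta tau c0 C F : dominated theta tau c0 C F ->
  forall Kmax, 0 <= Kmax -> exists2 G, 0 <= G & forall K b x y, 0 <= K <= Kmax ->
   asymptotic theta K F b x y -> forall n, opnorm (ratio F b n x y - 1%:M) <= G * K.
Proof.
move=> dF Kmax Kmax0; have [G G0 hG] := ratio_cauchy dF Kmax0; exists G => // K b x y hK h n.
have := hG K b x y hK h 0%N n (leq0n n); rewrite expr0 mulr1.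
by rewrite {2}/ratio /= invmx1 mul1mx.
Qed.

Lemma asymptotic_sym theta K F b x y : asymptotic theta K F b x y -> asymptotic theta K F b y x.
Proof. by move=> h i; rewrite opnormB. Qed.

Lemma ratio_controlled theta tau c0 C F : dominated theta tau c0 C F ->
  forall Kmax, 0 <= Kmax -> exists2 G, 1 <= G & forall b x y,
   asymptotic theta Kmax F b x y -> forall n, controlled G (ratio F b n x y).
Proof.
move=> dF Kmax Kmax0; have [G G0 hG] := ratio_near1 dF Kmax0.
exists (1 + G * Kmax); first by rewrite lerDl mulr_ge0.
have KK : 0 <= Kmax <= Kmax by rewrite Kmax0 lexx.
move=> b x y h n; have [u i] := ratio_inv b n x y dF; split => //.
  apply: (le_trans (opnorm_triBD _ 1%:M)); apply: lerD; first exact: opnorm1.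
  exact: hG.
rewrite i; apply: (le_trans (opnorm_triBD _ 1%:M)); apply: lerD; first exact: opnorm1.
by apply: hG => //; exact: asymptotic_sym.
Qed.

Lemma asymptotic_fwd theta tau c0 C F x y (d : nat) : dominated theta tau c0 C F ->
  (forall i : int, - d%:Z <= i -> sval x i = sval y i) ->
  asymptotic theta (C * theta ^+ d) F true x y.
Proof.
move=> [_ _ _ _ [_ _ _ _ FH]] h i; rewrite -mulrA -exprD; apply: FH.
by move=> j hj /=; apply: h; rewrite /shift_idx; lia.
Qed.

Lemma asymptotic_bwd theta tau c0 C F x y (d : nat) : dominated theta tau c0 C F ->
  (forall i : int, i < d%:Z -> sval x i = sval y i) ->
  asymptotic theta (C * theta ^+ d) F false x y.
Proof.
move=> [_ _ _ _ [_ _ _ _ FH]] h i; rewrite -mulrA -exprD; apply: FH.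
by move=> j hj /=; apply: h; rewrite /shift_idx; lia.
Qed.

Lemma asymptotic_fwd0 theta tau c0 C F x y : dominated theta tau c0 C F ->
  (forall i : int, 0 <= i -> sval x i = sval y i) -> asymptotic theta C F true x y.
Proof.
move=> dF h; have := @asymptotic_fwd theta tau c0 C F x y 0 dF.
by rewrite expr0 mulr1 oppr0; apply.
Qed.

Lemma asymptotic_bwd0 theta tau c0 C F x y : dominated theta tau c0 C F ->
  (forall i : int, i < 0 -> sval x i = sval y i) -> asymptotic theta C F false x y.
Proof.
move=> dF h; have := @asymptotic_bwd theta tau c0 C F x y 0 dF.
by rewrite expr0 mulr1; apply.
Qed.

(** Agreement that begins only at time [d] costs a factor [theta ^+ d] in the denominator: before
    that time the trivial bound [C] is already below the claimed one. *)
Lemma asymptotic_late theta tau c0 C F b x y (d : nat) : dominated theta tau c0 C F ->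
  (forall i : int, (if b then d%:Z <= i else i < - d%:Z) -> sval x i = sval y i) ->
  asymptotic theta (C / theta ^+ d) F b x y.
Proof.
move=> [/andP[th0 th1] _ _ C0 [_ _ _ _ FH]] h i; rewrite -mulrA.
have td0 : 0 < theta ^+ d by exact: exprn_gt0.
have [id_|di] := ltnP i d.
  apply: (@le_trans _ _ (C * theta ^+ 0)); first by apply: FH; exact: agree0.
  rewrite expr0; apply: ler_wpM2l => //.
  rewrite ler_pdivlMl// mulr1.
  by apply: ler_wiXn2l; rewrite ?(ltW th0) ?(ltW th1) ?(ltnW id_).
have -> : (theta ^+ d)^-1 * theta ^+ i = theta ^+ (i - d).
  by rewrite -[in LHS](subnKC di) exprD mulKf// gt_eqF.
by apply: FH => j hj /=; move: h; rewrite /shift_idx; case: b => h; apply: h; lia.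
Qed.

Definition loc_cont (f : subshift Q -> 'M[R]_k) x :=
  forall e, 0 < e -> exists M : nat, forall y, agree x y M -> opnorm (f y - f x) < e.

Lemma loc_cont_cst B x : loc_cont (fun=> B) x.
Proof. by move=> e e0; exists 0%N => y _; rewrite subrr opnorm0. Qed.

Lemma loc_cont_mul f g x : loc_cont f x -> loc_cont g x -> loc_cont (fun y => f y *m g y) x.
Proof.
move=> hf hg e e0; have [d d0 hd] := mul_near (f x) (g x) e0.
have [Nf hNf] := hf _ d0; have [Ng hNg] := hg _ d0.
exists (maxn Nf Ng) => y xy; apply: hd.
  by apply: hNf; apply: agree_le xy; exact: leq_maxl.
by apply: hNg; apply: agree_le xy; exact: leq_maxr.
Qed.

Lemma inv_perturb (B B' : 'M[R]_k) e : B \in unitmx -> B' \in unitmx ->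
  opnorm (B' - B) <= e -> 2 * opnorm (invmx B) * e <= 1 ->
  opnorm (invmx B') <= 2 * opnorm (invmx B) /\
  opnorm (invmx B' - invmx B) <= 2 * opnorm (invmx B) ^+ 2 * e.
Proof.
move=> Bu B'u he h.
have E : invmx B' - invmx B = - (invmx B' *m (B' - B) *m invmx B).
  by rewrite mulmxBr mulVmx// mulmxBl mul1mx -mulmxA mulmxV// mulmx1 opprB.
have h1 : opnorm (invmx B' - invmx B) <= opnorm (invmx B') * e * opnorm (invmx B).
  rewrite E opnormN; apply: (le_trans (opnormM _ _)).
  apply: ler_wpM2r; first exact: opnorm_ge0.
  by apply: (le_trans (opnormM _ _)); apply: ler_wpM2l => //; exact: opnorm_ge0.
have e0 : 0 <= e by apply: le_trans he; exact: opnorm_ge0.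
have h2 : opnorm (invmx B') <= 2 * opnorm (invmx B).
  have := opnorm_triBD (invmx B') (invmx B).
  have := opnorm_ge0 (invmx B'); have := opnorm_ge0 (invmx B).
  move: h h1; set a := opnorm (invmx B); set b := opnorm (invmx B'); set c := opnorm _.
  move=> h h1 a0 b0 h3.
  have : b * e * a <= b / 2.
    have -> : b * e * a = b * (2 * a * e) / 2 by field.
    by rewrite ler_pM2r// ler_piMr.
  lra.
split => //; apply: (le_trans h1).
have -> : 2 * opnorm (invmx B) ^+ 2 * e = 2 * opnorm (invmx B) * e * opnorm (invmx B) by ring.
by apply: ler_wpM2r; rewrite ?opnorm_ge0//; apply: ler_wpM2r.
Qed.

Lemma loc_cont_inv f x : (forall y, f y \in unitmx) -> loc_cont f x ->
  loc_cont (fun y => invmx (f y)) x.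
Proof.
move=> fu hf e e0.
pose a := opnorm (invmx (f x)) + 1.
have a0 : 0 < a by rewrite ltr_wpDl ?opnorm_ge0.
have ia : opnorm (invmx (f x)) <= a by rewrite lerDl.
pose d := Order.min ((2 * a)^-1) (e / (4 * a ^+ 2)).
have d0 : 0 < d by rewrite lt_min invr_gt0 !divr_gt0 ?mulr_gt0 ?exprn_gt0.
have [M hM] := hf _ d0; exists M => y /hM/ltW h.
have [|_] := inv_perturb (fu x) (fu y) h.
  apply: (@le_trans _ _ (2 * a * (2 * a)^-1)); last by rewrite divff// gt_eqF// mulr_gt0.
  apply: ler_pM; rewrite ?mulr_ge0 ?opnorm_ge0 ?(ltW d0)//; first by rewrite ler_pM2l.
  by rewrite ge_min lexx.
move=> h'; apply: (le_lt_trans h').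
apply: (@le_lt_trans _ _ (2 * a ^+ 2 * (e / (4 * a ^+ 2)))).
  apply: ler_pM; rewrite ?mulr_ge0 ?exprn_ge0 ?opnorm_ge0 ?(ltW d0)//.
    by rewrite ler_pM2l// lerXn2r ?nnegrE ?opnorm_ge0 ?(ltW a0).
  by rewrite ge_min lexx orbT.
have -> : 2 * a ^+ 2 * (e / (4 * a ^+ 2)) = e / 2 by field; rewrite gt_eqF.
by rewrite ltr_pdivrMr// ltr_pMr// ltr1n.
Qed.

Lemma loc_cont_shift f x s : loc_cont f (Tpow s x) -> loc_cont (fun y => f (Tpow s y)) x.
Proof.
move=> hf e /hf[M hM]; exists (M + absz s)%N => y xy; apply: hM.
by apply: agree_shift xy.
Qed.

Lemma loc_cont_orbit_prod F b n x : (forall y, loc_cont F y) -> loc_cont (orbit_prod F b n) x.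
Proof.
move=> hF; elim: n => [|n IH]; first exact: loc_cont_cst.
apply: loc_cont_mul => //.
by apply: loc_cont_shift; exact: hF.
Qed.

Lemma small_pow (theta C e : R) : 0 < theta < 1 -> 0 < e -> exists M, forall n, (M <= n)%N -> C * theta ^+ n < e.
Proof.
move=> /andP[t0 t1] e0.
have : C * theta ^+ n @[n --> \oo] --> C * 0.
  by apply: cvgMr; apply: cvg_expr; rewrite ger0_norm// ltW.
rewrite mulr0 => /cvgr_lt/(_ _ e0)[M _ hM]; exists M => n /hM.
by [].
Qed.

Lemma dominated_loc_cont theta tau c0 C F x : dominated theta tau c0 C F -> loc_cont F x.
Proof.
move=> [th _ _ C0 [_ _ _ _ FH]] e e0.
have [M hM] := small_pow C th e0; exists M => y xy; rewrite opnormB.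
by apply: le_lt_trans (hM M (leqnn M)); exact: FH.
Qed.

(** Joint continuity of the holonomy, uniformly in large times. The uniform Cauchy bound reduces to
    a fixed time [N], the finite product is continuous at [(p, z)], and the ratio at [(p, z)] is
    then close to its limit. *)
Lemma ratio_limit theta tau c0 C F b p z psi (Kmax : R) : dominated theta tau c0 C F ->
  0 <= Kmax -> asymptotic theta Kmax F b p z ->
  entrywise_cvg (F := \oo) (fun n => ratio F b n p z) psi ->
  forall e, 0 < e -> exists M : nat, forall y w n, agree p y M -> agree z w M ->
    asymptotic theta Kmax F b y w -> (M <= n)%N -> opnorm (ratio F b n y w - psi) < e.
Proof.
move=> dF Kmax0 apz hpsi e e0.
have [G G0 hG] := ratio_cauchy dF Kmax0.
have [th t01 _ _ _] := dF.
have KK : 0 <= Kmax <= Kmax by rewrite Kmax0 lexx.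
have e3 : 0 < e / 3 by rewrite divr_gt0.
have [N1 hN1] := small_pow (G * Kmax) t01 e3.
have [N2 hN2] : exists N2, forall n, (N2 <= n)%N -> opnorm (ratio F b n p z - psi) <= e / 3.
  have hij ij : \forall n \near \oo, `|(ratio F b n p z - psi) ij.1 ij.2| < e / 3 / (k * k).+1%:R.
    have := hpsi ij.1 ij.2 => /cvgrPdist_lt/(_ (e / 3 / (k * k).+1%:R)).
    rewrite divr_gt0// => /(_ isT); apply: filterS => n; rewrite distrC.
    by rewrite !mxE.
  have [N _ hN] : \forall n \near \oo, forall ij : 'I_k * 'I_k, `|(ratio F b n p z - psi) ij.1 ij.2| < e / 3 / (k * k).+1%:R.
    by apply: filter_forall => ij; exact: hij.
  exists N => n Nn; have h := hN n Nn.
  apply: (@le_trans _ _ (e / 3 / (k * k).+1%:R * (k * k)%:R)).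
    by apply: opnorm_le_entries => i j; apply: ltW; exact: (h (i, j)).
  by rewrite mulrAC ler_pdivrMr// ler_pM2l// ler_nat.
pose N := maxn N1 N2.
have [M1 hM1] : exists M1, forall y w, agree p y M1 -> agree z w M1 ->
    opnorm (ratio F b N y w - ratio F b N p z) < e / 3.
  have Fl x : loc_cont F x by exact: dominated_loc_cont dF.
  have c1 : loc_cont (fun y => invmx (orbit_prod F b N y)) p.
    apply: loc_cont_inv; last exact: loc_cont_orbit_prod.
    by move=> y; exact: orbit_prod_unit dF.
  have c2 : loc_cont (orbit_prod F b N) z by exact: loc_cont_orbit_prod.
  have [d d0 hd] := mul_near (invmx (orbit_prod F b N p)) (orbit_prod F b N z) e3.
  have [Nf hNf] := c1 _ d0; have [Ng hNg] := c2 _ d0.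
  exists (maxn Nf Ng) => y w py zw; apply: hd.
    by apply: hNf; apply: agree_le py; exact: leq_maxl.
  by apply: hNg; apply: agree_le zw; exact: leq_maxr.
exists (maxn N M1) => y w n py zw yw Mn.
have Nn : (N <= n)%N by apply: leq_trans Mn; exact: leq_maxl.
apply: (le_lt_trans (opnorm_triB _ (ratio F b N y w) _)).
have -> : e = e / 3 + (e / 3 + e / 3) by field.
apply: ler_ltD.
  apply: (le_trans (hG _ _ _ _ KK yw _ _ Nn)); apply: ltW; apply: hN1; exact: leq_maxl.
apply: (le_lt_trans (opnorm_triB _ (ratio F b N p z) _)).
apply: ltr_leD; last by apply: hN2; exact: leq_maxr.
by apply: hM1; [apply: agree_le py|apply: agree_le zw]; exact: leq_maxr.
Qed.

Lemma entrywise_cvg_mx m n (f : nat -> 'M[R]_(m, n)) (B : 'M[R]_(m, n)) :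
  entrywise_cvg (F := \oo) f B -> f x @[x --> \oo] --> B.
Proof.
move=> h; apply/cvg_ballP => e e0.
have H ij : \forall x \near \oo, ball (B ij.1 ij.2) e (f x ij.1 ij.2).
  by have /cvg_ballP/(_ e e0) := h ij.1 ij.2.
have : \forall x \near \oo, forall ij : 'I_m * 'I_n, ball (B ij.1 ij.2) e (f x ij.1 ij.2).
  by apply: filter_forall => ij; exact: H.
by apply: filterS => x hx; split => // i j; exact: (hx (i, j)).
Qed.

Lemma ratio_cvg theta tau c0 C F b p z (K : R) : dominated theta tau c0 C F ->
  0 <= K -> asymptotic theta K F b p z ->
  exists psi, entrywise_cvg (F := \oo) (fun n => ratio F b n p z) psi.
Proof.
move=> dF K0 apz.
have [G G0 hG] := ratio_cauchy dF K0.
have [th t01 _ _ _] := dF.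
have KK : 0 <= K <= K by rewrite K0 lexx.
have H (ij : 'I_k * 'I_k) : exists l : R, ratio F b n p z ij.1 ij.2 @[n --> \oo] --> l.
  suff : cvg (ratio F b n p z ij.1 ij.2 @[n --> \oo]) by move=> h; eexists; exact: h.
  apply/cauchy_cvgP; apply: cauchy_exP => e e0.
  have [N hN] := small_pow (G * K) t01 e0.
  exists (ratio F b N p z ij.1 ij.2); exists N => // n /= Nn.
  rewrite /ball /= distrC; apply: le_lt_trans (hN N (leqnn N)).
  apply: le_trans (hG _ _ _ _ KK apz _ _ Nn).
  by have := entry_le_opnorm (ratio F b n p z - ratio F b N p z) ij.1 ij.2; rewrite !mxE.
have [g gP] := choice H.
exists (\matrix_(i, j) g (i, j)) => i j; rewrite mxE; exact: (gP (i, j)).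
Qed.

End OrbitProducts.

Lemma nat_above (R : realType) (x : R) : exists n : nat, x <= n%:R.
Proof. by exists (Num.truncn x).+1; apply: ltW; exact: Num.Theory.truncnS_gt. Qed.

(** * Uniform constants for fibre-bunched cocycles *)

Section FiberBunching.
Context {R : realType} {q : nat} {Q : 'M[bool]_q} {k : nat}.
Implicit Types (x y z w p : subshift Q) (A F : subshift Q -> 'M[R]_k).

(** Fibre bunching is a pointwise strict inequality; continuity and compactness make it uniform. One
    integer [j] encodes all three bounds, in a way that only weakens as [j] grows. *)
Lemma Hrb_bounds (theta C : R) A : 0 < theta < 1 -> 0 <= C ->
  (forall x, A x \in unitmx) ->
  (forall x y m, agree x y m -> opnorm (A x - A y) <= C * theta ^+ m) ->
  (forall x, opnorm (A x) * opnorm (invmx (A x)) * theta < 1) ->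
  exists tau c0 : R, [/\ 0 < tau < 1, 0 <= c0 & forall x,
    [/\ opnorm (A x) <= c0, opnorm (invmx (A x)) <= c0 &
        opnorm (A x) * opnorm (invmx (A x)) * theta <= tau]].
Proof.
move=> th C0 Au AH Ab.
have Al x : loc_cont A x.
  move=> e e0; have [M hM] := small_pow C th e0; exists M => y xy; rewrite opnormB.
  by apply: le_lt_trans (hM M (leqnn M)); exact: AH.
have Ail x : loc_cont (fun y => invmx (A y)) x by exact: loc_cont_inv.
case/andP: th => th0 th1.
pose P j x := [/\ opnorm (A x) <= j%:R, opnorm (invmx (A x)) <= j%:R &
   opnorm (A x) * opnorm (invmx (A x)) * theta <= 1 - j.+1%:R^-1].
have [|x|j hj] := @local_to_uniform _ Q P.
- move=> i j x ij [h1 h2 h3]; split.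
  + by apply: (le_trans h1); rewrite ler_nat.
  + by apply: (le_trans h2); rewrite ler_nat.
  + by apply: (le_trans h3); rewrite lerD2l lerN2 lef_pV2 ?posrE// ler_nat.
- pose a := opnorm (A x); pose m := opnorm (invmx (A x)); pose rho := a * m * theta.
  have a0 : 0 <= a by exact: opnorm_ge0.
  have m0 : 0 <= m by exact: opnorm_ge0.
  have rho1 : rho < 1 by exact: Ab.
  have s0 : 0 < a + m + 1 by rewrite ltr_wpDl// addr_ge0.
  pose d := Order.min 1 ((1 - rho) / (2 * (a + m + 1))).
  have d0 : 0 < d by rewrite lt_min ltr01 divr_gt0 ?subr_gt0// mulr_gt0.
  have d1 : d <= 1 by rewrite ge_min lexx.
  have d2 : d * (a + m + 1) <= (1 - rho) / 2.
    rewrite -ler_pdivlMr//; apply: (@le_trans _ _ ((1 - rho) / (2 * (a + m + 1)))).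
      by rewrite ge_min lexx orbT.
    by rewrite invfM mulrA.
  have [M1 h1] := Al x _ d0; have [M2 h2] := Ail x _ d0.
  have [J hJ] : exists J : nat, [/\ a + 1 <= J%:R, m + 1 <= J%:R & 2 / (1 - rho) <= J%:R].
    pose S := a + 1 + (m + 1) + 2 / (1 - rho).
    have r0 : 0 <= 2 / (1 - rho) by rewrite divr_ge0// subr_ge0 ltW.
    have [J] := nat_above S; rewrite /S => h; exists J.
    split; apply: le_trans h; lra.
  case: hJ => J1 J2 J3.
  exists (maxn M1 M2), J => y xy.
  have {}h1 := h1 y (agree_le (leq_maxl _ _) xy); have {}h2 := h2 y (agree_le (leq_maxr _ _) xy).
  have a' : opnorm (A y) <= a + d.
    by apply: (le_trans (opnorm_triBD _ (A x))); rewrite lerD2l ltW.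
  have m' : opnorm (invmx (A y)) <= m + d.
    by apply: (le_trans (opnorm_triBD _ (invmx (A x)))); rewrite lerD2l ltW.
  split.
  + by apply: (le_trans a'); apply: le_trans J1; rewrite lerD2l.
  + by apply: (le_trans m'); apply: le_trans J2; rewrite lerD2l.
  apply: (@le_trans _ _ ((a + d) * (m + d) * theta)).
    by rewrite ler_pM2r//; apply: ler_pM; rewrite ?opnorm_ge0.
  have -> : (a + d) * (m + d) * theta = rho + d * (a + m + d) * theta by rewrite /rho; ring.
  apply: (@le_trans _ _ (rho + (1 - rho) / 2)).
    rewrite lerD2l; apply: le_trans d2.
    rewrite -[X in _ <= X]mulr1; apply: ler_pM; rewrite ?(ltW th0) ?(ltW th1)//.
      by rewrite mulr_ge0 ?addr_ge0// ltW.
    by rewrite ler_pM2l// lerD2l.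
  have -> : rho + (1 - rho) / 2 = 1 - (1 - rho) / 2 by field.
  rewrite lerD2l lerN2 -[X in _ <= X]invrK lef_pV2 ?posrE ?invr_gt0 ?divr_gt0 ?subr_gt0//.
  by rewrite invfM invrK mulrC; apply: (le_trans J3); rewrite ler_nat.
(* The maximum with [1 / 2] keeps the rate positive when [j] is 0. *)
exists (Order.max (1 / 2) (1 - j.+1%:R^-1)), j%:R; split=> //.
  by rewrite lt_max gt_max divr_gt0//= ltr_pdivrMr// mul1r ltr1n/= gtrBl invr_gt0.
move=> x; have [h1 h2 h3] := hj x; split => //.
by apply: (le_trans h3); rewrite le_max lexx orbT.
Qed.

(** Inversion preserves the bunching quantity and multiplies the Hölder constant by at most
    [c0 ^+ 2]; the constant [C * (1 + c0 ^+ 2)] covers both time directions. *)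
Lemma dominated_time_map (omega r : R) A : 0 < omega < 1 -> 0 < r -> Hrb omega r A ->
  exists tau c0 C : R, forall b, dominated (omega `^ r) tau c0 C (time_map A b).
Proof.
move=> o01 r0 [Au Ah Ab].
have [C C0 AH] := holder_agree o01 r0 Ah.
have th : 0 < omega `^ r < 1.
  case/andP: o01 => o0 o1; rewrite powR_gt0//=.
  by have := gt0_ltr_powR r0 (x := omega) (y := 1); rewrite powR1 !nnegrE; apply => //; exact: ltW.
have [tau [c0 [t01 c00 h]]] := Hrb_bounds th C0 Au AH Ab.
exists tau, c0, (C * (1 + c0 ^+ 2)) => b; split => //.
  by rewrite mulr_ge0// addr_ge0// exprn_ge0.
have th0 m : 0 <= (omega `^ r) ^+ m by rewrite exprn_ge0// ltW; case/andP: th.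
case: b; rewrite /time_map; split => //.
- by move=> x; case: (h x).
- by move=> x; case: (h x).
- by move=> x; case: (h x).
- move=> x y m xy; apply: (le_trans (AH _ _ _ xy)); rewrite ler_wpM2r// ler_peMr// lerDl.
  exact: exprn_ge0.
- by move=> x; rewrite unitmx_inv.
- by move=> x; rewrite invmxK [opnorm (invmx _) * _]mulrC; case: (h x).
- by move=> x; case: (h x).
- by move=> x; rewrite invmxK; case: (h x).
- move=> x y m xy.
  have -> : invmx (A x) - invmx (A y) = invmx (A x) *m (A y - A x) *m invmx (A y).
    by rewrite mulmxBr mulVmx// mulmxBl mul1mx -mulmxA mulmxV// mulmx1.
  apply: (@le_trans _ _ (c0 * (C * (omega `^ r) ^+ m) * c0)).
    apply: (le_trans (opnormM _ _)); apply: ler_pM; rewrite ?opnorm_ge0//; last by case: (h y).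
    apply: (le_trans (opnormM _ _)); apply: ler_pM; rewrite ?opnorm_ge0//; first by case: (h x).
    by rewrite opnormB; exact: AH.
  have -> : c0 * (C * (omega `^ r) ^+ m) * c0 = C * c0 ^+ 2 * (omega `^ r) ^+ m by ring.
  by rewrite ler_wpM2r// ler_wpM2l// lerDr.
Qed.

End FiberBunching.

(** * Canonical holonomies and bounded distortion *)

Section Holonomy.
Context {R : realType} {q : nat} {Q : 'M[bool]_q} {k : nat}.
Implicit Types (x y z w p : subshift Q).
Variables (theta tau c0 C : R) (A : subshift Q -> 'M[R]_k).
Hypothesis domA : forall b, dominated theta tau c0 C (time_map A b).

Let dF : dominated theta tau c0 C A := domA true.

Notation fwd := (orbit_prod A true).
Notation bwd := (orbit_prod (time_map A false) false).

Lemma fwd_unit n x : fwd n x \in unitmx.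
Proof. exact: (orbit_prod_unit _ _ _ dF). Qed.

Lemma bwd_unit n x : bwd n x \in unitmx.
Proof. exact: (orbit_prod_unit _ _ _ (domA false)). Qed.

Lemma fwd_bwd n x : fwd n (Tpow (- n%:Z) x) = invmx (bwd n x).
Proof.
elim: n => [|n IH]; first by rewrite /orbit_prod /= invmx1.
have Au y : A y \in unitmx by case: dF => _ _ _ _ [].
have -> : bwd n.+1 x = invmx (A (Tpow (- n.+1%:Z) x)) *m bwd n x by [].
rewrite invmx_mul ?unitmx_inv// ?bwd_unit// invmxK -IH -addn1 addnC orbit_prodD TpowD; congr (_ *m _).
  by congr (orbit_prod A true n (Tpow _ x)); rewrite /shift_by; lia.
rewrite /orbit_prod /= /orbit_seq mulmx1 TpowD.
by congr (A (Tpow _ x)); rewrite /shift_idx; lia.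
Qed.

Lemma fwd_ratio_bwd n x y :
  fwd n (Tpow (- n%:Z) x) = ratio (time_map A false) false n x y *m fwd n (Tpow (- n%:Z) y).
Proof.
by rewrite !fwd_bwd /ratio mulmxK// bwd_unit.
Qed.

Lemma ratio_shift (F : subshift Q -> 'M[R]_k) b n p z psi : (forall x, F x \in unitmx) ->
  entrywise_cvg (F := \oo) (fun m => ratio F b m (Tpow (shift_by b n) p) (Tpow (shift_by b n) z)) psi ->
  entrywise_cvg (F := \oo) (fun m => ratio F b m p z)
    (invmx (orbit_prod F b n p) *m psi *m orbit_prod F b n z).
Proof.
move=> Fu h i j.
have : entrywise_cvg (F := \oo) (fun m => invmx (orbit_prod F b n p) *m
    ratio F b m (Tpow (shift_by b n) p) (Tpow (shift_by b n) z) *m orbit_prod F b n z)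
    (invmx (orbit_prod F b n p) *m psi *m orbit_prod F b n z).
  apply: entrywise_mul; last exact: entrywise_cst.
  by apply: entrywise_mul => //; exact: entrywise_cst.
move/(_ i j).
have pu m y : orbit_prod F b m y \in unitmx by apply: pseq_unit => l; exact: Fu.
rewrite -[X in _ -> X](cvg_shiftn n).
suff -> : (fun m => (invmx (orbit_prod F b n p) *m ratio F b m (Tpow (shift_by b n) p) (Tpow (shift_by b n) z) *m
    orbit_prod F b n z) i j) = (fun m => ratio F b (m + n) p z i j) by [].
apply/funext => m; congr (fun_of_matrix _ i j).
by rewrite /ratio addnC !orbit_prodD invmx_mul// !mulmxA.
Qed.

Lemma lim_ratio (u : nat -> 'M[R]_k) psi : entrywise_cvg (F := \oo) u psi ->
  lim (u n @[n --> \oo]) = psi.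
Proof. by move=> h; apply: cvg_lim; [exact: norm_hausdorff|exact: entrywise_cvg_mx]. Qed.

(** [Hs] first moves both points forward by a chosen time. Multiplying the local limit by the
    products up to that time restores the ratios started at time 0, so the choice disappears. *)
Lemma Hs_limit p z : Ws p z ->
  entrywise_cvg (F := \oo) (fun n => ratio A true n p z) (Hs A p z).
Proof.
move=> [n0 hn0]; rewrite /Hs; case: xgetP => [n _ hn|]; last first.
  by move=> /(_ n0); case=> i i0; rewrite hn0.
have [_ _ _ C0 _] := dF.
have asy : asymptotic theta C A true (Tpow n%:Z p) (Tpow n%:Z z).
  by apply: (asymptotic_fwd0 dF) => i i0; exact: (hn i i0).
have [psi hpsi] := ratio_cvg dF C0 asy.
have -> : Hsloc A (Tpow n%:Z p) (Tpow n%:Z z) = psi.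
  rewrite /Hsloc -(lim_ratio hpsi).
  have -> : (fun m : nat => invmx (cocycle A m%:Z (Tpow n%:Z p)) *m cocycle A m%:Z (Tpow n%:Z z)) =
    (fun m => ratio A true m (Tpow n%:Z p) (Tpow n%:Z z)).
    by apply/funext => m; rewrite !cocycle_posE.
  by [].
rewrite !cocycle_posE; apply: (@ratio_shift A true n) => //.
by case: dF => _ _ _ _ [].
Qed.

Lemma Hu_limit p z : Wu p z ->
  entrywise_cvg (F := \oo) (fun n => ratio (time_map A false) false n z p) (Hu A z p).
Proof.
have dB := domA false.
move=> [n0 hn0]; rewrite /Hu; case: xgetP => [n _ hn|]; last first.
  by move=> /(_ n0); case=> i i0; rewrite hn0.
have [_ _ _ C0 _] := dB.
have asy : asymptotic theta C (time_map A false) false (Tpow (- n%:Z) z) (Tpow (- n%:Z) p).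
  by apply: (asymptotic_bwd0 dB) => i i0; exact: (hn i i0).
have [psi hpsi] := ratio_cvg dB C0 asy.
have -> : Huloc A (Tpow (- n%:Z) z) (Tpow (- n%:Z) p) = psi.
  rewrite /Huloc -(lim_ratio hpsi).
  have -> : (fun m : nat => invmx (cocycle A (- m%:Z) (Tpow (- n%:Z) z)) *m cocycle A (- m%:Z) (Tpow (- n%:Z) p)) =
    (fun m => ratio (time_map A false) false m (Tpow (- n%:Z) z) (Tpow (- n%:Z) p)).
    by apply/funext => m; rewrite !cocycle_negE.
  by [].
rewrite !cocycle_negE; apply: (@ratio_shift (time_map A false) false n) => //.
by case: dB => _ _ _ _ [].
Qed.

(** Compare both points with the [w] that has the past of [x] and the future of [y]: it is on the
    local stable set of [y] when the word begins and on the local unstable set of [x] when it ends,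
    and both ratios are controlled. *)
Lemma distortion : exists2 D : R, 1 <= D & forall n x y,
  (forall i : int, 0 <= i < n%:Z -> sval x i = sval y i) ->
  exists U S, [/\ controlled D U, controlled D S & fwd n y = U *m fwd n x *m S].
Proof.
have [_ _ _ C0 _] := dF.
have [G G1 hG] := ratio_controlled dF C0.
have [G' G'1 hG'] := ratio_controlled (domA false) C0.
exists (Order.max G G'); first by rewrite le_max G1.
move=> [|n] x y xy.
  (* The empty word offers no common symbol to glue at. *)
  exists 1%:M, 1%:M; rewrite /orbit_prod /= !mulmx1.
  by split => //; apply: controlled_le (controlled1 _); rewrite le_max G1.
have [|w [w1 w2]] := @glue_ex _ _ 0 x y; first by apply: xy; lia.
have w1' (i : int) : i < n.+1%:Z -> sval w i = sval x i.
  move=> i0; case: (lerP i 0) => [/w1//|i1]; rewrite w2 ?ltW// xy//; lia.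
have a1 : asymptotic theta C A true w y.
  by apply: (asymptotic_fwd0 dF) => i i0; apply: w2.
have a2 : asymptotic theta C (time_map A false) false (Tpow n.+1%:Z w) (Tpow n.+1%:Z x).
  apply: (asymptotic_bwd0 (domA false)) => i i0 /=.
  by apply: w1'; lia.
exists (ratio (time_map A false) false n.+1 (Tpow n.+1%:Z w) (Tpow n.+1%:Z x)), (ratio A true n.+1 w y).
split.
- by apply: controlled_le (hG' _ _ _ a2 _); rewrite le_max lexx orbT.
- by apply: controlled_le (hG _ _ _ a1 _); rewrite le_max lexx.
have := fwd_ratio_bwd n.+1 (Tpow n.+1%:Z w) (Tpow n.+1%:Z x).
rewrite !TpowD addNr !Tpow0 => <-.
by rewrite (ratio_mul _ _ _ _ dF).
Qed.

Lemma ext_distortion : exists D : nat -> R, (forall t, 0 < D t) /\ forall t n x y,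
  (forall i : int, 0 <= i < n%:Z -> sval x i = sval y i) ->
  opnorm (extpow t (fwd n y)) <= D t * opnorm (extpow t (fwd n x)).
Proof.
have [D D1 hD] := distortion.
have D0 : 0 <= D by exact: le_trans D1.
have e0 t : 0 <= ext_bound t k D by rewrite !mulr_ge0// exprn_ge0.
exists (fun t => ext_bound t k D * ext_bound t k D + 1); split.
  by move=> t; rewrite ltr_wpDl// mulr_ge0.
move=> t n x y /hD[U [S [[_ cU _] [_ cS _] ->]]].
rewrite !extpowM; apply: (@le_trans _ _ (ext_bound t k D * opnorm (extpow t (fwd n x)) * ext_bound t k D)).
  apply: (le_trans (opnormM _ _)); apply: ler_pM; rewrite ?opnorm_ge0 ?opnorm_ext_le//.
  by apply: (le_trans (opnormM _ _)); apply: ler_wpM2r; rewrite ?opnorm_ge0 ?opnorm_ext_le.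
by rewrite mulrAC mulrDl mul1r lerDl opnorm_ge0.
Qed.

Lemma controlled_fwd : exists2 c : R, 1 <= c & forall n x, controlled (c ^+ n) (fwd n x).
Proof.
have [_ _ c00 _ [Au _ A1 A2 _]] := dF.
exists (Order.max c0 1); first by rewrite le_max lexx orbT.
have cA y : controlled (Order.max c0 1) (A y).
  by split => //; [apply: (le_trans (A1 y))|apply: (le_trans (A2 y))]; rewrite le_max lexx.
elim=> [|n IH] x; first by rewrite expr0; exact: controlled1.
rewrite exprS /orbit_prod /=; apply: controlled_mul; [exact: cA (Tpow _ x)|exact: IH].
Qed.

End Holonomy.

(** * Quasi-multiplicativity through the homoclinic loop *)

Section QuasiMultiplicativity.
Context {R : realType} {q : nat} {Q : 'M[bool]_q} {k : nat}.
Implicit Types (x y z w p : subshift Q).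

Lemma periodic_per p : Defs.periodic p -> is_period p (per p).
Proof.
move=> [n0 hn0]; rewrite /per; case: xgetP => [n _ []//|H]; exfalso.
have ex : exists n, `[<is_period p n>] by exists n0; apply/asboolP.
case: (ex_minnP ex) => n /asboolP hn hmin.
by apply: (H n); split => // m hm; apply: hmin; apply/asboolP.
Qed.

Lemma period_mul p n l : Tpow n%:Z p = p -> Tpow (l * n)%N%:Z p = p.
Proof.
move=> h; elim: l => [|l IH]; first by rewrite mul0n Tpow0.
by rewrite mulSn PoszD -TpowD IH h.
Qed.

Lemma period_mulN p n l : Tpow n%:Z p = p -> Tpow (- (l * n)%N%:Z) p = p.
Proof. by move=> h; rewrite -[in LHS](period_mul l h) TpowD addNr Tpow0. Qed.

Lemma homoclinic_bound p z : Ws p z -> Wu p z -> exists n0 : nat,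
  (forall i : int, n0%:Z <= i -> sval z i = sval p i) /\
  (forall i : int, i < - n0%:Z -> sval z i = sval p i).
Proof.
move=> [n hn] [m hm]; exists (maxn n m); split => i hi.
  by have := hn (i - n%:Z); rewrite /= subrK; apply; lia.
by have := hm (i + m%:Z); rewrite /= addrK; apply; lia.
Qed.

Variables (theta tau c0 C : R) (A : subshift Q -> 'M[R]_k).
Hypothesis domA : forall b, dominated theta tau c0 C (time_map A b).

Let dF : dominated theta tau c0 C A := domA true.
Let dB : dominated theta tau c0 C (time_map A false) := domA false.

Notation fwd := (orbit_prod A true).
Notation bwd := (orbit_prod (time_map A false) false).
Notation sratio := (ratio A true).
Notation uratio := (ratio (time_map A false) false).

Lemma fwdD m n x : fwd (m + n) x = fwd n (Tpow m%:Z x) *m fwd m x.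
Proof. exact: orbit_prodD. Qed.

(** Determinants multiply exactly, so every connecting word of bounded length works, in particular
    the one chosen for the lower exterior powers. *)
Lemma top_multiplicative (L : nat) : exists2 K : R, 0 < K & forall x n y m w g, (g <= L)%N ->
  (forall i : int, 0 <= i < n%:Z -> sval w i = sval x i) ->
  (forall i : int, 0 <= i < m%:Z -> sval w ((n + g)%N%:Z + i) = sval y i) ->
  opnorm (extpow k (fwd n x)) * opnorm (extpow k (fwd m y)) <=
    K * opnorm (extpow k (fwd (n + g + m) w)).
Proof.
have [D [D0 hD]] := ext_distortion domA.
have [c c1 hc] := controlled_fwd domA.
pose N : R := (#|incr k k| * #|incr k k|)%:R.
pose E : R := (k`!)%:R * (c ^+ L) ^+ k.
have E0 : 0 <= E by rewrite mulr_ge0// !exprn_ge0// (le_trans _ c1).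
have N0 : 0 <= N by exact: ler0n.
have Dk0 : 0 <= D k by exact: ltW.
have F0 : 0 <= D k * N * (D k * N) * E by do ![assumption | apply: mulr_ge0].
exists (D k * N * (D k * N) * E + 1); first by rewrite ltr_wpDl.
move=> x n y m w g gL wx wy.
have h1 : opnorm (extpow k (fwd n x)) <= D k * N * `|\det (fwd n w)|.
  apply: (le_trans (hD k n w x wx)); rewrite -mulrA ler_pM2l//.
  by rewrite mulrC; exact: ext_le_det.
have h2 : opnorm (extpow k (fwd m y)) <= D k * N * `|\det (fwd m (Tpow (n + g)%N%:Z w))|.
  apply: (le_trans (hD k m (Tpow (n + g)%N%:Z w) y _)).
    by move=> i hi /=; rewrite addrC wy.
  rewrite -mulrA ler_pM2l//.
  by rewrite mulrC; exact: ext_le_det.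
have h3 : 1 <= E * `|\det (fwd g (Tpow n%:Z w))|.
  have [u _ hi] := hc g (Tpow n%:Z w).
  have : 1 <= `|\det (invmx (fwd g (Tpow n%:Z w)))| * `|\det (fwd g (Tpow n%:Z w))|.
    by rewrite -normrM -det_mulmx mulVmx// det1 normr1.
  move=> h; apply: (le_trans h); apply: ler_wpM2r => //.
  apply: det_bound => i j; apply: (le_trans (entry_le_opnorm _ i j)).
  by apply: (le_trans hi); apply: ler_weXn2l.
have -> : fwd (n + g + m) w = fwd m (Tpow (n + g)%N%:Z w) *m fwd g (Tpow n%:Z w) *m fwd n w.
  by rewrite fwdD fwdD mulmxA.
apply: (@le_trans _ _ ((D k * N * `|\det (fwd n w)|) * (D k * N * `|\det (fwd m (Tpow (n + g)%N%:Z w))|))).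
  by apply: ler_pM; rewrite ?opnorm_ge0.
apply: (@le_trans _ _ ((D k * N * (D k * N) * E + 1) *
  `|\det (fwd m (Tpow (n + g)%N%:Z w) *m fwd g (Tpow n%:Z w) *m fwd n w)|)); last first.
  apply: ler_wpM2l; last exact: det_le_ext.
  by rewrite addr_ge0.
rewrite !det_mulmx !normrM.
set a := `|\det (fwd n w)|; set b := `|\det (fwd m _)|; set d := `|_| in h3 *.
have -> : D k * N * a * (D k * N * b) = D k * N * (D k * N) * (b * a) * 1 by ring.
apply: (@le_trans _ _ (D k * N * (D k * N) * (b * a) * (E * d))).
  by apply: ler_wpM2l => //; do ![assumption | exact: normr_ge0 | apply: mulr_ge0].
have -> : D k * N * (D k * N) * (b * a) * (E * d) = D k * N * (D k * N) * E * (b * d * a) by ring.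
apply: ler_wpM2r; last by rewrite lerDl.
by do ![exact: normr_ge0 | apply: mulr_ge0].
Qed.

(** A telescoping identity that isolates [fwd l p]. Its last ratio is taken at time [Lam] rather
    than [l], so it depends only on the starting point [Tpow (- l%:Z) x0], which in the application
    does not vary with [l]. *)
Lemma fwd_through_stable p x0 l Lam : (l <= Lam)%N -> Tpow l%:Z p = p ->
  fwd l (Tpow (- l%:Z) x0) =
  sratio (Lam - l) x0 p *m fwd l p *m sratio Lam p (Tpow (- l%:Z) x0).
Proof.
move=> lL pl.
have e (y : subshift Q) : fwd Lam y = fwd (Lam - l) (Tpow l%:Z y) *m fwd l y.
  by rewrite -[in LHS](subnKC lL) fwdD.
rewrite /ratio (e p) (e (Tpow (- l%:Z) x0)) pl TpowD addrN Tpow0.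
by rewrite invmx_mul ?(fwd_unit domA)// !mulmxA !mulmxK ?(fwd_unit domA)// mulVmx ?(fwd_unit domA)// mul1mx.
Qed.

Lemma fwd_through_unstable p y l Lam : (l <= Lam)%N -> Tpow (- l%:Z) p = p ->
  fwd l (Tpow (- l%:Z) y) =
  uratio Lam y p *m fwd l p *m uratio (Lam - l) p (Tpow (- l%:Z) y).
Proof.
move=> lL pl.
have e (u : subshift Q) : bwd Lam u = bwd (Lam - l) (Tpow (- l%:Z) u) *m bwd l u.
  by rewrite -[in LHS](subnKC lL) orbit_prodD.
rewrite -[in fwd l p]pl !(fwd_bwd domA) /ratio (e p) (e y) pl.
by rewrite invmx_mul ?(bwd_unit domA)// !mulmxA !mulmxK ?(bwd_unit domA)// mulmxKV ?(bwd_unit domA).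
Qed.

(** At the centre the orbit of [w0] is compared with that of [x0] in the past and with that of [y1]
    in the future; the two ratios approximate the two halves of the homoclinic loop. *)
Lemma fwd_center c n w0 x0 y1 :
  fwd (c + n) (Tpow (- c%:Z) w0) =
  fwd n y1 *m (sratio n y1 w0 *m uratio c w0 x0) *m fwd c (Tpow (- c%:Z) x0).
Proof.
rewrite fwdD TpowD addrN Tpow0 (fwd_ratio_bwd domA c w0 x0) -(ratio_mul _ n y1 w0 dF).
by rewrite !mulmxA.
Qed.

Lemma fwd_period p n (V : 'M[R]_k) (lam : 'I_k -> R) l : Tpow n%:Z p = p -> V \in unitmx ->
  fwd n p *m V = V *m diag_mx (\row_i lam i) ->
  fwd (l * n) p = V *m diag_pow lam l *m invmx V.
Proof.
move=> pn Vu PV; elim: l => [|l IH].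
  rewrite mul0n (_ : diag_pow lam 0 = 1%:M) ?mulmx1 ?mulmxV//.
  by apply/matrixP => i j; rewrite !mxE expr0.
have PE : fwd n p = V *m diag_mx (\row_i lam i) *m invmx V by rewrite -PV mulmxK.
rewrite mulSn fwdD pn IH PE !mulmxA mulmxKV// -(mulmxA V); congr (_ *m _ *m _).
by apply/matrixP => i j; rewrite /diag_pow mul_diag_mx !mxE exprSr mulrnAr.
Qed.

Section Typical.
Variables (p z : subshift Q) (n0 per0 N0 : nat) (lam : 'I_k -> R) (V : 'M[R]_k).
Hypothesis per0_gt0 : (0 < per0)%N.
Hypothesis pperiod : Tpow per0%:Z p = p.
Hypothesis zfut : forall i : int, n0%:Z <= i -> sval z i = sval p i.
Hypothesis zpast : forall i : int, i < - n0%:Z -> sval z i = sval p i.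
Hypothesis zs : Ws p z.
Hypothesis zu : Wu p z.
Hypothesis Vu : V \in unitmx.
Hypothesis PV : fwd per0 p *m V = V *m diag_mx (\row_i lam i).
Hypothesis connect : forall x y (i j : int), exists w,
    (forall l : int, l <= i -> sval w l = sval x l) /\
    (forall l : int, 0 <= l -> sval w (i + N0%:Z + l) = sval y (j + l)).

(** The constant of [asymptotic_late] at time [n0], from which [z] and [p] agree. *)
Let K := C / theta ^+ n0.

Let psi := invmx V *m (Hs A p z *m Hu A z p) *m V.

Lemma theta_bounds : [/\ 0 < theta, theta < 1, 0 <= C, 0 <= K & C <= K].
Proof.
have [/andP[t0 t1] _ _ C0 _] := dF.
have tn : 0 < theta ^+ n0 by exact: exprn_gt0.
split => //; first by rewrite divr_ge0// ltW.
by rewrite ler_pdivlMr// ler_piMr// exprn_ile1// ltW.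
Qed.

Lemma p_shift (l : nat) (i : int) : sval p (i + (l * per0)%N%:Z) = sval p i.
Proof. by rewrite -[in RHS](period_mul l pperiod). Qed.

Lemma p_shiftN (l : nat) (i : int) : sval p (i - (l * per0)%N%:Z) = sval p i.
Proof. by rewrite -[in RHS](period_mulN l pperiod). Qed.

(** The possible centres at time [l], described only by what their limit requires: [a2] and [a3] are
    ratios of points near [p] and [z], tending to the stable and the unstable holonomy, while [a1]
    and [a4] are corrections close to the identity. *)
Definition centre_factors (G : R) (l : nat) : set 'M[R]_k :=
  [set E | exists a1 a2 a3 a4 : 'M[R]_k,
   [/\ E = invmx V *m ((a1 *m a2) *m (a3 *m a4)) *m V,
     opnorm (a1 - 1%:M) <= G * theta ^+ l, opnorm (a4 - 1%:M) <= G * theta ^+ l,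
     exists y w n, [/\ agree p y (l * per0), agree z w (l * per0), asymptotic theta K A true y w,
        (l * per0 <= n)%N & a2 = sratio n y w] &
     exists y w n, [/\ agree p y (l * per0), agree z w (l * per0), asymptotic theta K (time_map A false) false w y,
        (l * per0 <= n)%N & a3 = uratio n w y]]].

Lemma centre_factors_cvg G e : 0 < e -> exists l0 : nat, forall l E, (l0 <= l)%N ->
  centre_factors G l E -> opnorm (E - psi) < e.
Proof.
move=> e0; have [t0 t1 C0 K0 CK] := theta_bounds.
have th : 0 < theta < 1 by rewrite t0.
have [d1 d10 h1] := mul_near (invmx V *m (Hs A p z *m Hu A z p)) V e0.
have [d2 d20 h2] := mul_near (invmx V) (Hs A p z *m Hu A z p) d10.
have [d3 d30 h3] := mul_near (Hs A p z) (Hu A z p) d20.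
have [d4 d40 h4] := mul_near (1%:M) (Hs A p z) d30.
have [d5 d50 h5] := mul_near (Hu A z p) (1%:M) d30.
rewrite mul1mx in h4; rewrite mulmx1 in h5.
have asyS : asymptotic theta K A true p z.
  by apply: (asymptotic_late dF) => i hi; rewrite zfut.
have asyU : asymptotic theta K (time_map A false) false z p.
  by apply: (asymptotic_late dB) => i hi; rewrite zpast.
have [M1 hM1] := ratio_limit dF K0 asyS (Hs_limit domA zs) d40.
have [M2 hM2] := ratio_limit dB K0 asyU (Hu_limit domA zu) d50.
have d6 : 0 < Order.min d4 d5 by rewrite lt_min d40.
have [M3 hM3] := small_pow G th d6.
exists (maxn M1 (maxn M2 M3)) => l E; rewrite !geq_max => /and3P[l1 l2 l3].
have lp : (l <= l * per0)%N by rewrite leq_pmulr.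
move=> [a1 [a2 [a3 [a4 [-> ha1 ha4 [y [w [n [py zw as2 ln ->]]]] [y' [w' [n' [py' zw' as3 ln' ->]]]]]]]]].
have := hM3 l l3; rewrite lt_min => /andP[g1 g2].
have v0 : opnorm (V - V) < d1 by rewrite subrr opnorm0.
have v1 : opnorm (invmx V - invmx V) < d2 by rewrite subrr opnorm0.
apply: (h1 _ _ _ v0); apply: (h2 _ _ v1); apply: h3.
  apply: h4; first exact: le_lt_trans g1.
  have M1d := leq_trans l1 lp.
  by apply: hM1 as2 _; [exact: agree_le py|exact: agree_le zw|exact: leq_trans ln].
apply: h5; last exact: le_lt_trans g2.
have M2d := leq_trans l2 lp.
by apply: hM2 as3 _; [exact: agree_le zw'|exact: agree_le py'|exact: leq_trans ln'].
Qed.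

(** Glue the past of [x0], the homoclinic point [z] on [[- d, d]] and the future of [y1]. At both
    joints the neighbouring sequences read [p], because [d] is a multiple of the period that exceeds
    [n0]. *)
Lemma shadowing_point (qq y2 x : subshift Q) n (y : subshift Q) l : (n0 < l)%N ->
  (forall i : int, i <= n%:Z -> sval qq i = sval x i) ->
  (forall i : int, 0 <= i -> sval qq (n%:Z + N0%:Z + i) = sval p i) ->
  (forall i : int, i <= 0 -> sval y2 i = sval p i) ->
  (forall i : int, 0 <= i -> sval y2 (N0%:Z + i) = sval y i) ->
  let d := (l * per0)%N in let c := (n + N0 + d)%N in
  let x0 := Tpow c%:Z qq in let y1 := Tpow (- d%:Z) y2 in exists w0 : subshift Q,
  [/\ (forall i : int, i <= n%:Z -> sval (Tpow (- c%:Z) w0) i = sval x i) /\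
      (forall i : int, 0 <= i -> sval w0 ((d + N0)%N%:Z + i) = sval y i),
     forall i : int, - d%:Z <= i -> sval x0 i = sval p i,
     forall i : int, i <= d%:Z -> sval y1 i = sval p i,
     agree z w0 d &
     (forall i : int, n0%:Z <= i -> sval y1 i = sval w0 i) /\
     (forall i : int, i < - n0%:Z -> sval w0 i = sval x0 i)].
Proof.
move=> n0l q1 q2 y21 y22 d c x0 y1.
have lp : (n0 < d)%N by apply: (leq_trans n0l); rewrite leq_pmulr.
have x0p (i : int) : - d%:Z <= i -> sval x0 i = sval p i.
  move=> hi; rewrite /x0 /= -(p_shift l i) -/d -q2; last by lia.
  by congr (sval qq _); rewrite /c; lia.
have y1p (i : int) : i <= d%:Z -> sval y1 i = sval p i.
  by move=> hi; rewrite /y1 /= y21 ?p_shiftN//; lia.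
have [|u [u1 u2]] := @glue_ex _ _ (- d%:Z) x0 z.
  by rewrite x0p// zpast//; lia.
have [|w0 [w1 w2]] := @glue_ex _ _ d%:Z u y1.
  by rewrite y1p// u2 ?zfut//; lia.
exists w0; split => //.
- split => i hi.
  + rewrite /= w1; last by rewrite /c; lia.
    rewrite u1; last by rewrite /c; lia.
    by rewrite /x0 /= addrNK q1.
  + rewrite w2; last by lia.
    by rewrite /y1 /= -y22//; congr (sval y2 _); lia.
- by move=> i hi; rewrite w1 ?u2//; lia.
- split=> i hi.
  + have [hd|hd] := lerP d%:Z i; first by rewrite w2.
    by rewrite y1p ?(ltW hd)// w1 ?(ltW hd)// u2 ?zfut//; lia.
  + have [hd|hd] := lerP i (- d%:Z); first by rewrite w1 ?u1//; lia.
    by rewrite w1 ?u2 ?zpast ?x0p//; lia.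
Qed.

(* Reading the orbit of a point that shadows [p] up to its centre, then [z]: the powers [P ^ l] of the return map appear between factors [X], [Y] that do not depend on [l] and a factor close to the holonomy loop. *)
Lemma fwd_shadowing (qq y2 w0 : subshift Q) n m l Lam : (l <= Lam)%N ->
  let d := (l * per0)%N in let c := (n + N0 + d)%N in
  let x0 := Tpow c%:Z qq in let y1 := Tpow (- d%:Z) y2 in
  fwd (c + (d + (N0 + m))) (Tpow (- c%:Z) w0) =
  fwd m (Tpow N0%:Z y2) *m
   (fwd N0 y2 *m uratio (Lam * per0) y2 p *m fwd d p *m
    ((uratio (Lam * per0 - d) p y1 *m sratio (d + (N0 + m)) y1 w0) *m
     (uratio c w0 x0 *m sratio (Lam * per0 - d) x0 p)) *m
    fwd d p *m sratio (Lam * per0) p (Tpow (n + N0)%N%:Z qq) *m fwd N0 (Tpow n%:Z qq))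
  *m fwd n qq.
Proof.
move=> lL d c x0 y1.
have dL : (d <= Lam * per0)%N by rewrite leq_mul2r lL orbT.
rewrite (fwd_center c (d + (N0 + m)) w0 x0 y1).
have -> : Tpow (- c%:Z) x0 = qq by rewrite /x0 TpowD addNr Tpow0.
have x0q : Tpow (- d%:Z) x0 = Tpow (n + N0)%N%:Z qq.
  by rewrite /x0 TpowD; congr (Tpow _ qq); rewrite /c; lia.
have -> : fwd c qq = sratio (Lam * per0 - d) x0 p *m fwd d p *m
    sratio (Lam * per0) p (Tpow (n + N0)%N%:Z qq) *m fwd N0 (Tpow n%:Z qq) *m fwd n qq.
  rewrite /c fwdD -x0q (@fwd_through_stable p x0 d (Lam * per0)) ?(period_mul _ pperiod)//.
  by rewrite x0q fwdD !mulmxA.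
have -> : fwd (d + (N0 + m)) y1 = fwd m (Tpow N0%:Z y2) *m fwd N0 y2 *m
    uratio (Lam * per0) y2 p *m fwd d p *m uratio (Lam * per0 - d) p y1.
  rewrite fwdD /y1 (@fwd_through_unstable p y2 d (Lam * per0)) ?(period_mulN _ pperiod)//.
  by rewrite TpowD addrN Tpow0 fwdD !mulmxA.
by rewrite !mulmxA.
Qed.

Hypothesis lam_inj : injective (fun i => `|lam i|).
Hypothesis lam_neq0 : forall i, lam i != 0.
Hypothesis psi_minors :
  forall t (s u : 'I_#|incr t k|), (t < k)%N -> minor (incr_of s) (incr_of u) psi != 0.

(** Order of choices: the two words give [qq] and [y2], hence [X] and [Y]; pivoting gives [K1] and
    [L2], which are absorbed into these outer factors; only then does compactness select [l], and
    [w0] is glued last. *)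
Lemma quasi_multiplicative_low : exists (L : nat) (B : nat -> R), (forall t, 0 < B t) /\ forall x n y m, exists w g, [/\ (g <= L)%N,
    forall i : int, i < n%:Z -> sval w i = sval x i,
    forall i : int, 0 <= i -> sval w ((n + g)%N%:Z + i) = sval y i &
    forall t, (t < k)%N -> opnorm (extpow t (fwd n x)) * opnorm (extpow t (fwd m y)) <=
      B t * opnorm (extpow t (fwd (n + g + m) w))].
Proof.
have [t0 t1 C0 K0 CK] := theta_bounds.
have [kap1 [Cf [k1 Cf0 hlow]]] := @ext_product_lower R k.
have [D [D0 hD]] := ext_distortion domA.
have [c c1 hc] := controlled_fwd domA.
have [G1 G11 hG1] := ratio_controlled dF C0.
have [G2 G21 hG2] := ratio_controlled dB C0.
have [G3 G30 hG3] := ratio_near1 dF C0.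
have [G4 G40 hG4] := ratio_near1 dB C0.
pose G := (G3 + G4) * C.
pose v := Order.max (opnorm V) (opnorm (invmx V)).
have cV : controlled v V by split; rewrite ?Vu// /v le_max lexx ?orbT.
have cVi : controlled v (invmx V) by exact: controlled_inv.
pose kapX := v * G1 * c ^+ N0 * kap1.
pose kapY := kap1 * c ^+ N0 * G2 * v.
(* The minimum [n0.+1] for [l] is what [shadowing_point] asks for. *)
have [Lmax [cm [cm0 hcm]]] := @uniform_power_minor R k lam lam_inj lam_neq0 psi
   (Order.max kapX kapY) (centre_factors G) n0.+1 psi_minors (@centre_factors_cvg G).
exists (N0 + N0 + (Lmax * per0 + Lmax * per0))%N, (fun t => D t * D t * Cf t / cm).
split; first by move=> t; rewrite divr_gt0// !mulr_gt0.
move=> x n y m.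
have [qq [q1 q2]] := connect x p n%:Z 0.
have [y2 [y21 y22]] := connect p y 0 0.
have {}q2 (i : int) : 0 <= i -> sval qq (n%:Z + N0%:Z + i) = sval p i.
  by move=> hi; rewrite q2// add0r.
have {}y22 (i : int) : 0 <= i -> sval y2 (N0%:Z + i) = sval y i.
  by move=> hi; have := y22 i hi; rewrite !add0r.
pose q' := Tpow (n + N0)%N%:Z qq.
pose X := sratio (Lmax * per0) p q'; pose Y := uratio (Lmax * per0) y2 p.
have cX : controlled G1 X.
  apply: hG1; apply: (asymptotic_fwd0 dF) => i hi; rewrite /q' /= -q2//.
  by rewrite PoszD addrC.
have cY : controlled G2 Y.
  by apply: hG2; apply: (asymptotic_bwd0 dB) => i hi; rewrite y21// ltW.
have [K1 [L2 [cK1 cL2 hKL]]] := hlow (fwd n qq) (fwd m (Tpow N0%:Z y2)).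
have [||l /andP[ll lL] hl] := hcm (invmx V *m X *m fwd N0 (Tpow n%:Z qq) *m K1) (L2 *m fwd N0 y2 *m Y *m V).
- apply: (@controlled_le _ _ kapX); first by rewrite le_max lexx.
  by do 3 ?[apply: controlled_mul => //].
- apply: (@controlled_le _ _ kapY); first by rewrite le_max lexx orbT.
  by do 3 ?[apply: controlled_mul => //].
have [w0 [[wx wy] x0p y1p zw [yw wx0]]] := shadowing_point ll q1 q2 y21 y22.
set d := (l * per0)%N in wx wy x0p y1p zw yw wx0.
set cc := (n + N0 + d)%N in wx wy x0p y1p zw yw wx0.
set x0 := Tpow cc%:Z qq in x0p wx0; set y1 := Tpow (- d%:Z) y2 in y1p yw.
exists (Tpow (- cc%:Z) w0), (N0 + d + (d + N0))%N.
have dL : (d <= Lmax * per0)%N by rewrite leq_mul2r lL orbT.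
split.
- by move: dL; clear; lia.
- by move=> i hi; apply: wx; exact: ltW.
- move=> i hi /=; rewrite -wy//; congr (sval w0 _); rewrite /cc; clear; lia.
move=> t tk.
pose a1 := uratio (Lmax * per0 - d) p y1; pose a2 := sratio (d + (N0 + m)) y1 w0.
pose a3 := uratio cc w0 x0; pose a4 := sratio (Lmax * per0 - d) x0 p.
pose E := invmx V *m ((a1 *m a2) *m (a3 *m a4)) *m V.
have thd : theta ^+ d <= theta ^+ l by apply: ler_wiXn2l; rewrite ?ltW// leq_pmulr.
have Cth : 0 <= C * theta ^+ d <= C.
  by rewrite mulr_ge0 ?exprn_ge0 ?(ltW t0)//= ler_piMr// exprn_ile1 ?ltW.
have EE : centre_factors G l E.
  exists a1, a2, a3, a4; split => //.
  - apply: (le_trans (hG4 _ _ _ _ Cth _ _)).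
      by apply: (asymptotic_bwd dB) => i hi; rewrite y1p// ltW.
    rewrite /G mulrA; apply: ler_pM; rewrite ?exprn_ge0 ?mulr_ge0 ?(ltW t0)//.
    by apply: ler_wpM2r => //; rewrite lerDr.
  - apply: (le_trans (hG3 _ _ _ _ Cth _ _)).
      by apply: (asymptotic_fwd dF) => i hi; rewrite x0p.
    rewrite /G mulrA; apply: ler_pM; rewrite ?exprn_ge0 ?mulr_ge0 ?(ltW t0)//.
    by apply: ler_wpM2r => //; rewrite lerDl.
  - exists y1, w0, (d + (N0 + m))%N; split => //; last by rewrite leq_addr.
      by move=> i hi; rewrite y1p//; move: hi; clear; lia.
    by apply: (asymptotic_late dF) => i hi; exact: yw.
  - exists x0, w0, cc; split => //; last by rewrite /cc leq_addl.
      by move=> i hi; rewrite x0p//; move: hi; clear; lia.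
    by apply: (asymptotic_late dB) => i hi; exact: wx0.
pose M := fwd N0 y2 *m Y *m fwd d p *m ((a1 *m a2) *m (a3 *m a4)) *m fwd d p *m X *m fwd N0 (Tpow n%:Z qq).
(* In the eigenbasis [fwd d p] becomes [diag_pow lam l], which gives the shape treated by
   [uniform_power_minor]. *)
have ML : L2 *m M *m K1 = L2 *m fwd N0 y2 *m Y *m V *m diag_pow lam l *m E *m diag_pow lam l *m
    (invmx V *m X *m fwd N0 (Tpow n%:Z qq) *m K1).
  by rewrite /M /E (fwd_period l pperiod Vu PV) !mulmxA.
have := hl E EE t (ltnW tk) tk; rewrite -ML => /hKL.
have nE : (n + (N0 + d + (d + N0)) + m = cc + (d + (N0 + m)))%N by rewrite /cc; clear; lia.
rewrite nE (fwd_shadowing qq y2 w0 n m lL) => hM.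
have h1 : opnorm (extpow t (fwd n x)) <= D t * opnorm (extpow t (fwd n qq)).
  by apply: hD => i /andP[_ hi]; rewrite q1// ltW.
have h2 : opnorm (extpow t (fwd m y)) <= D t * opnorm (extpow t (fwd m (Tpow N0%:Z y2))).
  by apply: hD => i /andP[hi _] /=; rewrite addrC y22.
apply: (@le_trans _ _ (D t * opnorm (extpow t (fwd n qq)) * (D t * opnorm (extpow t (fwd m (Tpow N0%:Z y2)))))).
  exact: (ler_pM (opnorm_ge0 _) (opnorm_ge0 _) h1 h2).
rewrite -(ler_pdivlMl _ _ cm0) in hM.
have -> : D t * opnorm (extpow t (fwd n qq)) * (D t * opnorm (extpow t (fwd m (Tpow N0%:Z y2)))) =
  D t * D t * (opnorm (extpow t (fwd m (Tpow N0%:Z y2))) * opnorm (extpow t (fwd n qq))) by ring.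
apply: (@le_trans _ _ (D t * D t * (cm^-1 * (Cf t * opnorm (extpow t (fwd m (Tpow N0%:Z y2) *m M *m fwd n qq)))))).
  by apply: ler_wpM2l => //; rewrite mulr_ge0// ltW.
by rewrite le_eqVlt; apply/orP; left; apply/eqP; rewrite /M; ring.
Qed.

End Typical.

End QuasiMultiplicativity.

(** * From typicality to quasi-multiplicativity *)

Section TypicalQuasiMultiplicativity.
Context {R : realType} {q : nat} {Q : 'M[bool]_q} {k : nat}.
Implicit Types (x y z w p : subshift Q).

Lemma quasi_multiplicative (omega r : R) (A : subshift Q -> 'M[R]_k) :
  (0 < k)%N -> 0 < omega < 1 -> 0 < r -> @topologically_mixing R q Q omega ->
  typical_cocycles omega r A ->
  exists (L : nat) (B : nat -> R), (forall t, 0 < B t) /\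
  forall x n y m, exists w g, [/\ (g <= L)%N,
    forall i : int, i < n%:Z -> sval w i = sval x i,
    forall i : int, 0 <= i -> sval w ((n + g)%N%:Z + i) = sval y i &
    forall t, (1 <= t <= k)%N ->
      opnorm (extpow t (orbit_prod A true n x)) * opnorm (extpow t (orbit_prod A true m y)) <=
      B t * opnorm (extpow t (orbit_prod A true (n + g + m) w))].
Proof.
move=> k0 o01 r0 mix [HA typ].
have [tau [c0 [C domA]]] := dominated_time_map o01 r0 HA.
have [N0 [_ connect]] := mixing_connect o01 mix.
(* For [k = 1] the range of [t] in [typical] is empty and provides no homoclinic loop; the
   determinant estimate handles the only power. *)
have [k1|k2] := leqP k 1.
  have kE : k = 1%N by apply/eqP; rewrite eqn_leq k1 k0.
  have [K K0 hK] := top_multiplicative domA N0.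
  exists N0, (fun=> K); split => // x n y m.
  have [w [w1 w2]] := connect x y n%:Z 0.
  exists w, N0; split; first exact: leqnn.
  - by move=> i hi; apply: w1; exact: ltW.
  - by move=> i hi; rewrite PoszD w2// add0r.
  - move=> t tk; have -> : t = k by apply/eqP; rewrite eqn_leq; case/andP: tk => t1 ->; rewrite kE.
    apply: hK => // i /andP[i0 i1]; first by apply: w1; exact: ltW.
    by rewrite PoszD w2// add0r.
have [p [z [lam [v typ']]]] := typ.
have [|[pper [zs zu] _ [_ lam_inj eig] gp] _] := typ' 1%N.
  by rewrite /= -ltnS prednK.
have [per0 pp] := periodic_per pper.
have [n0 [zf zp]] := homoclinic_bound zs zu.
have Vu : eigenbasis v \in unitmx.
  apply: eigenbasis_unit eig => i j e; apply: lam_inj; by rewrite e.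
have PE : return_map A p = orbit_prod A true (per p) p by exact: cocycle_posE.
have PV : orbit_prod A true (per p) p *m eigenbasis v = eigenbasis v *m diag_mx (\row_i lam i).
  by rewrite -PE; exact: eigenbasis_diag.
have lam0 i : lam i != 0.
  apply/eqP => l0; have [vi0 Pv] := eig i.
  have Pu : return_map A p \in unitmx by rewrite PE; exact: fwd_unit domA _ _.
  move: vi0; rewrite -(mulKmx Pu (v i)) Pv l0 scale0r mulmx0 => /eqP; apply.
  by [].
have minors : forall t (s u : 'I_#|incr t k|), (t < k)%N -> minor (incr_of s) (incr_of u)
   (invmx (eigenbasis v) *m (Hs A p z *m Hu A z p) *m eigenbasis v) != 0.
  apply: general_position_minors => // t /andP[t2 tk].
  have [|_ /(_ t2)[_ +]] := typ' t; last exact.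
  by rewrite (ltnW t2)/= -ltnS prednK.
have [L [B [B0 hB]]] := quasi_multiplicative_low domA per0 pp zf zp zs zu Vu PV connect lam_inj lam0 minors.
have [K K0 hK] := top_multiplicative domA L.
exists L, (fun t => if t == k then K else B t); split; first by move=> t; case: eqP.
move=> x n y m; have [w [g [gL w1 w2 h]]] := hB x n y m.
exists w, g; split; [exact: gL|exact: w1|exact: w2|].
move=> t /andP[_]; rewrite leq_eqVlt; case: eqP => [-> _|_ /= tk]; last exact: h.
apply: hK => // i /andP[i0 i1]; first by apply: w1.
by rewrite w2.
Qed.

End TypicalQuasiMultiplicativity.

(** * Words of a given length *)

Section Words.
Context {q : nat} {Q : 'M[bool]_q}.
Implicit Types (x y z : subshift Q).

Definition same_word (m : nat) x y := forall i : int, 0 <= i < m%:Z -> sval x i = sval y i.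

Lemma same_word_sym m x y : same_word m x y -> same_word m y x.
Proof. by move=> h i hi; rewrite h. Qed.

Lemma words_enum (m : nat) : exists (K : nat) (u : 'I_K -> subshift Q),
  (forall a b, same_word m (u a) (u b) -> a = b) /\ (forall x, exists a, same_word m x (u a)).
Proof.
pose P (f : {ffun 'I_m -> 'I_q}) := `[<exists x, forall i : 'I_m, sval x i%:Z = f i>].
have hu (a : 'I_#|P|) : exists x, forall i : 'I_m, sval x i%:Z = (enum_val a) i.
  have := enum_valP a; rewrite unfold_in => /asboolP h; exact: h.
have [u uP] := choice hu.
exists #|P|, u; split => [a b ab|x].
  apply: enum_val_inj; apply/ffunP => i; rewrite -!uP; apply: ab.
  by rewrite /= ltz_nat.
pose f : {ffun 'I_m -> 'I_q} := [ffun i : 'I_m => sval x i%:Z].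
have Pf : f \in P by rewrite unfold_in; apply/asboolP; exists x => i; rewrite ffunE.
exists (enum_rank_in Pf f) => i /andP[i0 im].
have lt : (absz i < m)%N by lia.
have := uP (enum_rank_in Pf f) (Ordinal lt); rewrite enum_rankK_in// ffunE /= gez0_abs//.
Qed.

End Words.

(** * Bowen entropy and the number of words *)

Section BowenEntropy.
Context {R : realType} {q : nat} {Q : 'M[bool]_q}.
Implicit Types (x y z w : subshift Q) (Y : set (subshift Q)).
Variable omega : R.
Hypothesis omega01 : 0 < omega < 1.

Lemma bowen_SN_ge0 Y (s : R) N eps : (0 <= bowen_SN omega Y s N eps)%E.
Proof.
apply: le_ereal_inf_tmp => _ [D _ <-]; apply: esum_ge0 => c _.
by rewrite lee_fin expR_ge0.
Qed.

Lemma bowen_SN_homo Y (s : R) eps : nondecreasing_seq (fun N => bowen_SN omega Y s N eps).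
Proof.
move=> M N MN; apply: ereal_inf_le_tmp => _ [D [cD DN DY] <-]; exists D => //.
by split => // c /DN; exact: leq_trans.
Qed.

(** Raising [N] leaves fewer admissible covers, so the limit in [bowen_S] is monotone and [lim] is
    never a default value. *)
Lemma bowen_S_sup Y (s eps : R) :
  bowen_S omega Y s eps = ereal_sup (range (fun N => bowen_SN omega Y s N eps)).
Proof.
apply: cvg_lim => //; apply: ereal_nondecreasing_cvgn; exact: bowen_SN_homo.
Qed.

Lemma bowen_SN_le_S Y (s : R) N eps : (bowen_SN omega Y s N eps <= bowen_S omega Y s eps)%E.
Proof. by rewrite bowen_S_sup; apply: ereal_sup_ubound; exists N. Qed.

Lemma bowen_S_ge0 Y (s eps : R) : (0 <= bowen_S omega Y s eps)%E.
Proof. exact: le_trans (bowen_SN_ge0 _ _ 0%N _) (bowen_SN_le_S _ _ _ _). Qed.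

Lemma bowen_S_anti Y (s e1 e2 : R) : e1 <= e2 ->
  (bowen_S omega Y s e2 <= bowen_S omega Y s e1)%E.
Proof.
move=> e12; rewrite [X in (X <= _)%E]bowen_S_sup; apply: ge_ereal_sup => _ [N _ <-].
apply: le_trans (bowen_SN_le_S Y s N e1).
apply: ereal_inf_le_tmp => _ [D [cD DN DY] <-]; exists D => //.
split => // x /DY[c Dc h]; exists c => //.
exact: lt_le_trans e12.
Qed.

Lemma htop_eps_anti Y (e1 e2 : R) : e1 <= e2 -> (htop_eps omega Y e2 <= htop_eps omega Y e1)%E.
Proof.
move=> e12; apply: ereal_inf_le_tmp => _ [s /= hs <-]; exists s => //=.
by apply/eqP; rewrite eq_le bowen_S_ge0 andbT -hs bowen_S_anti.
Qed.

Lemma htop_cvg Y : cvg (htop_eps omega Y eps @[eps --> 0^'+]).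
Proof.
apply/cvg_ex; exists (ereal_sup (htop_eps omega Y @` [set` Interval (BRight (0 : R)) (BInfty _ false)])).
by apply: nonincreasing_at_right_cvge => // a b _ _; exact: htop_eps_anti.
Qed.

Lemma htop_ge Y (s0 : R) :
  (forall s eps, s <= s0 -> 0 < eps <= 1 -> bowen_S omega Y s eps <> 0%E) ->
  (s0%:E <= htop omega Y)%E.
Proof.
move=> h; apply: lime_ge; first exact: htop_cvg.
near=> eps; apply: le_ereal_inf_tmp => _ [s /= hs <-]; rewrite lee_fin leNgt.
apply/negP => ss0; apply: (h s eps) => //; first exact: ltW.
by apply/andP; split; near: eps; [exact: nbhs_right_gt|exact: nbhs_right_le].
Unshelve. all: end_near. Qed.

Lemma htop_gt0 Y : (0 < htop omega Y)%E -> exists2 eps : R, 0 < eps & (0 < htop_eps omega Y eps)%E.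
Proof.
move=> h; apply: contrapT => H; move: h; rewrite ltNge => /negP; apply.
apply: lime_le; first exact: htop_cvg.
near=> eps; rewrite leNgt; apply/negP => he; apply: H; exists eps => //.
Unshelve. all: end_near. Qed.

(** For the empty set, the empty cover makes [bowen_S] vanish at [s = 0]. *)
Lemma htop_gt0_nonempty Y : (0 < htop omega Y)%E -> Y !=set0.
Proof.
move=> /htop_gt0[eps _ he]; apply: contrapT => /set0P/negP; rewrite negbK => /eqP Y0.
move: he; rewrite ltNge => /negP; apply.
apply: ereal_inf_lbound; exists 0 => //=.
apply/eqP; rewrite eq_le bowen_S_ge0 andbT bowen_S_sup.
apply: ge_ereal_sup => _ [N _ <-]; apply: ereal_inf_lbound; exists set0.
  by split => //; rewrite Y0.
by rewrite esum_set0.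
Qed.

(** A distance below [omega ^+ 0] already fixes coordinate 0, at each time of the orbit segment. *)
Lemma bowen_ball_word n x y (eps : R) : eps <= 1 -> bowen_ball omega n x eps y -> same_word n x y.
Proof.
move=> e1 h i /andP[i0 in_].
have lt : (absz i < n)%N by lia.
have : dist omega (Tpow (absz i)%:Z x) (Tpow (absz i)%:Z y) < omega ^+ 0.
  rewrite expr0; apply: lt_le_trans e1; apply: le_lt_trans h.
  exact: (le_bigmax _ (fun j : 'I_n => dist omega (Tpow j%:Z x) (Tpow j%:Z y)) (Ordinal lt)).
move/(agree_dist omega01)/(_ 0); rewrite /= !add0r gez0_abs//; exact.
Qed.

Lemma esum_le_card (T : choiceType) (C : set T) (K : nat) (u : 'I_K -> T) (a : R) : 0 <= a ->
  C `<=` range u -> (\esum_(c in C) a%:E <= (K%:R * a)%:E)%E.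
Proof.
move=> a0 Cu; apply: ge_ereal_sup => _ [X [finX XC] <-].
rewrite fsbig_finite//= sumEFin lee_fin big_const_seq iter_addr_0 -[a *+ _]mulr_natl.
apply: ler_wpM2r => //; rewrite ler_nat count_predT.
apply: (@leq_trans (size [seq u i | i <- enum 'I_K])); last by rewrite size_map size_enum_ord.
apply: uniq_leq_size; first exact: finmap.fset_uniq.
move=> t; rewrite in_fset_set// inE => /XC/Cu[i _ <-].
by apply: map_f; rewrite mem_enum.
Qed.

(** Words of length [m] yield a cover by balls of order [m - 2 kk], the margin [kk] on each side
    being dictated by [eps]. Positivity of [bowen_SN] at rate [s] then bounds their number from
    below, and passing to [s / 2] absorbs the margin and the constant. *)
Lemma words_growth : (0 < htop omega [set: subshift Q])%E ->
  exists h : R, 0 < h /\ exists M, forall m, (M <= m)%N -> forall K (u : 'I_K -> subshift Q),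
    (forall x, exists a, same_word m x (u a)) -> expR (h * m%:R) <= K%:R.
Proof.
move=> htop0; have [eps eps0 he] := htop_gt0 htop0.
have [s s0 hs] : exists2 s : R, 0 < s & (s%:E < htop_eps omega [set: subshift Q] eps)%E.
  move: he; case: (htop_eps omega [set: subshift Q] eps) => [h| |] //= h0.
    by exists (h / 2); rewrite ?divr_gt0//= lte_fin ltr_pdivrMr// ltr_pMr// ltr1n.
  by exists 1 => //; rewrite ltry.
have Spos : (0 < bowen_S omega [set: subshift Q] s eps)%E.
  rewrite lt_def bowen_S_ge0 andbT; apply/eqP => S0.
  move: hs; rewrite ltNge => /negP; apply; apply: ereal_inf_lbound.
  by exists s.
have [N0 [c c0 hc]] : exists N0, exists2 c : R, 0 < c & forall N, (N0 <= N)%N ->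
    (c%:E <= bowen_SN omega [set: subshift Q] s N eps)%E.
  move: Spos; rewrite bowen_S_sup => /ereal_sup_gt[_ [N0 _ <-] hN0].
  have [c c0 hcN] : exists2 c : R, 0 < c & (c%:E <= bowen_SN omega [set: subshift Q] s N0 eps)%E.
    move: hN0; case: (bowen_SN omega [set: subshift Q] s N0 eps) => [h| |] //= h0; first by exists h.
    by exists 1 => //; rewrite leey.
  exists N0, c => // N NN; apply: (le_trans hcN); exact: bowen_SN_homo.
have [kk hkk] := small_pow 1 omega01 eps0.
have {}hkk : omega ^+ kk < eps by have := hkk kk (leqnn kk); rewrite mul1r.
have [M1 hM1] := nat_above ((s * (kk + kk)%:R - ln c) * (2 / s)).
exists (s / 2); split; first by rewrite divr_gt0.
exists (N0 + (kk + kk) + M1)%N => m hm K u hu.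
pose N := (m - (kk + kk))%N.
have NN0 : (N0 <= N)%N by move: hm; rewrite /N; clear; lia.
have mE : m = (N + (kk + kk))%N by move: hm; rewrite /N; clear; lia.
have main : c <= K%:R * expR (- (s * N%:R)).
  rewrite -lee_fin; apply: (le_trans (hc N NN0)).
  (* Words start at coordinate 0 while the balls also see [kk] coordinates on the left, hence the
     shift. *)
  pose D := range (fun a => (Tpow kk%:Z (u a), N)).
  apply: (@le_trans _ _ (\esum_(d in D) (expR (- (s * d.2%:R)))%:E)%E).
    apply: ereal_inf_lbound; exists D => //; split.
    - by apply: finite_set_countable; apply: finite_image; exact: finite_finset.
    - by move=> _ [a _ <-].
    - move=> x _; have [a ha] := hu (Tpow (- kk%:Z) x).
      exists (Tpow kk%:Z (u a), N) => //; first by exists a.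
      rewrite /bowen_ball /=; apply: le_lt_trans hkk.
      apply: bigmax_le; first by rewrite exprn_ge0// ltW; case/andP: omega01.
      move=> j _; apply: (dist_agree omega01) => i hi /=.
      have := ha (i + j%:Z + kk%:Z); rewrite /= addrK => -> //.
      by move: hi (ltn_ord j); rewrite mE; move: (N) (nat_of_ord j); clear; lia.
  rewrite (@eq_esum _ _ _ _ (fun=> (expR (- (s * N%:R)))%:E)); last by move=> _ [a _ <-].
  by apply: (@esum_le_card _ _ _ (fun a => (Tpow kk%:Z (u a), N))) => //; exact: expR_ge0.
have : c * expR (s * N%:R) <= K%:R.
  by rewrite -ler_pdivlMr ?expR_gt0// -expRN.
apply: le_trans.
rewrite -[c in X in _ <= X](lnK c0) -expRD ler_expR.
have : (s * (kk + kk)%:R - ln c) * (2 / s) <= m%:R.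
  by apply: (le_trans hM1); rewrite ler_nat; apply: leq_trans hm; rewrite leq_addl.
rewrite mulrA ler_pdivrMr// => h1.
have -> : N%:R = m%:R - (kk + kk)%:R :> R by rewrite mE [in RHS]natrD addrK.
lra.
Qed.

End BowenEntropy.

(** * Concatenating words to realise a rate exactly *)

Section LevelSets.
Context {R : realType} {q : nat} {Q : 'M[bool]_q} {k : nat}.
Implicit Types (x y z w : subshift Q).
Variables (phi : 'I_k -> subshift Q -> nat -> R) (M : R) (L : nat).
Hypothesis M_ge0 : 0 <= M.
Hypothesis phi0 : forall i x, `|phi i x 0| <= M.
Hypothesis phiS : forall i x n, `|phi i x n.+1 - phi i x n| <= M.
Hypothesis phi_word : forall i x y n, same_word n x y -> `|phi i x n - phi i y n| <= M.
Hypothesis phi_concat : forall x n y m, exists w g, [/\ (g <= L)%N,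
  forall i : int, i < n%:Z -> sval w i = sval x i,
  forall i : int, 0 <= i -> sval w ((n + g)%N%:Z + i) = sval y i &
  forall i, `|phi i w (n + g + m) - phi i x n - phi i y m| <= M].

Lemma phiD i x n d : `|phi i x (n + d) - phi i x n| <= M * d%:R.
Proof.
elim: d => [|d IH]; first by rewrite addn0 subrr normr0 mulr0.
rewrite addnS -natr1 mulrDr mulr1.
have -> : phi i x (n + d).+1 - phi i x n =
  (phi i x (n + d) - phi i x n) + (phi i x (n + d).+1 - phi i x (n + d)) by ring.
by apply: (le_trans (ler_normD _ _)); rewrite lerD.
Qed.

Lemma phi_bound i x n : `|phi i x n| <= M * n.+1%:R.
Proof.
have -> : phi i x n = phi i x 0 + (phi i x (0 + n) - phi i x 0) by rewrite add0n; ring.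
apply: (le_trans (ler_normD _ _)); rewrite -natr1 mulrDr mulr1 addrC.
by rewrite lerD// phiD.
Qed.

Definition rate_set (alpha : 'rV[R]_k) : set (subshift Q) :=
  [set x | forall i, (n%:R^-1 * phi i x n) @[n --> \oo] --> alpha 0 i].

(** At arbitrarily large lengths, exponentially many distinct words have average close to [alpha].
    With [s = 0] one word suffices, which gives nonempty level sets; [s > 0] is the source of
    entropy. *)
Definition approximable (alpha : 'rV[R]_k) (s : R) :=
  forall e, 0 < e -> forall m0 : nat, exists m K (u : 'I_K -> subshift Q),
  [/\ (m0 <= m)%N, expR (s * m%:R) <= K%:R,
      forall a b, same_word m (u a) (u b) -> a = b &
      forall a i, `|phi i (u a) m - m%:R * alpha 0 i| <= e * m%:R].

Lemma entry_le_rV (alpha : 'rV[R]_k) i : `|alpha 0 i| <= opnorm alpha.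
Proof. exact: entry_le_opnorm. Qed.

Section Construction.
Variables (alpha : 'rV[R]_k) (m K : nat -> nat) (u : forall t, 'I_(K t) -> subshift Q).
Hypothesis m_large : forall t, t.+1%:R * (M + L%:R * opnorm alpha) <= (m t)%:R.
Hypothesis m_gt0 : forall t, (0 < m t)%N.
Hypothesis u_dev : forall t a i,
  `|phi i (u (t := t) a) (m t) - (m t)%:R * alpha 0 i| <= t.+1%:R^-1 * (m t)%:R.

(** The largest [t] for which a block with its gap takes at most the fraction [1 / t.+1] of the
    present length. Stages advance so slowly that an unfinished block is negligible. *)
Definition stage (l : nat) : nat := \max_(t < l.+1 | ((m t + L) * t.+1 <= l)%N) t.

Lemma stageP l : (m 0 + L <= l)%N -> ((m (stage l) + L) * (stage l).+1 <= l)%N.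
Proof.
move=> h.
have c : (0 < #|[pred t : 'I_l.+1 | ((m t + L) * t.+1 <= l)%N]|)%N.
  by apply/card_gt0P; exists ord0; rewrite inE /= muln1.
rewrite /stage; have [t ht ->] := eq_bigmax_cond (fun t : 'I_l.+1 => t : nat) c.
by rewrite inE in ht.
Qed.

Lemma stage_large T l : (T + (m T + L) * T.+1 <= l)%N -> (T <= stage l)%N.
Proof.
move=> h; have Tl : (T < l.+1)%N by rewrite ltnS; apply: leq_trans h; rewrite leq_addr.
apply: (leq_bigmax_cond (Ordinal Tl)) => /=.
by apply: leq_trans h; rewrite leq_addl.
Qed.

(** The connecting word and its gap as data, so that [child] and [gap] read off the same choice. *)
Definition concat_pair x n y d : {w : subshift Q & {g : nat | [/\ (g <= L)%N,
  forall i : int, i < n%:Z -> sval w i = sval x i,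
  forall i : int, 0 <= i -> sval w ((n + g)%N%:Z + i) = sval y i &
  forall i, `|phi i w (n + g + d) - phi i x n - phi i y d| <= M]}}.
Proof.
have [w h] := cid (phi_concat x n y d); exists w.
by have [g h'] := cid h; exists g.
Defined.

(** A state [(x, n)] stands for the word of length [n] read on [x]; a child appends one block of the
    current stage. *)
Definition child (st : subshift Q * nat) (a : 'I_(K (stage st.2))) : subshift Q * nat :=
  let c := concat_pair st.1 st.2 (u a) (m (stage st.2)) in
  (projT1 c, st.2 + sval (projT2 c) + m (stage st.2))%N.

Definition gap (st : subshift Q * nat) (a : 'I_(K (stage st.2))) : nat :=
  sval (projT2 (concat_pair st.1 st.2 (u a) (m (stage st.2)))).

Arguments child : clear implicits.
Arguments gap : clear implicits.

Lemma childP st a : [/\ (gap st a <= L)%N,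
   (child st a).2 = (st.2 + gap st a + m (stage st.2))%N,
   forall i : int, i < st.2%:Z -> sval (child st a).1 i = sval st.1 i,
   forall i : int, 0 <= i -> sval (child st a).1 ((st.2 + gap st a)%N%:Z + i) = sval (u a) i &
   forall i, `|phi i (child st a).1 (child st a).2 - phi i st.1 st.2 - phi i (u a) (m (stage st.2))| <= M].
Proof.
by rewrite /child /gap; case: (concat_pair _ _ _ _) => w [g [h1 h2 h3 h4]].
Qed.

Lemma child_length st a : (m 0 + L <= st.2)%N ->
  (st.2 < (child st a).2)%N /\ (((child st a).2 - st.2) * (stage st.2).+1 <= st.2)%N.
Proof.
move=> h; have [gL -> _ _ _] := childP a; split.
  by have := m_gt0 (stage st.2); lia.
apply: leq_trans (stageP h); rewrite leq_mul2r; apply/orP; right.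
by move: gL; clear; lia.
Qed.

(** One share of [1 / t.+1] is the deviation of the block; the other covers the concatenation error
    and the gap, which [m_large] makes small compared with the block. *)
Lemma child_dev st a i : (m 0 + L <= st.2)%N ->
  `|phi i (child st a).1 (child st a).2 - phi i st.1 st.2 - ((child st a).2 - st.2)%:R * alpha 0 i|
   <= 2 / (stage st.2).+1%:R * ((child st a).2 - st.2)%:R.
Proof.
move=> h; have [gL e _ _ hphi] := childP a.
have d := u_dev a i; have ml := m_large (stage st.2).
have -> : ((child st a).2 - st.2)%:R = (gap st a)%:R + (m (stage st.2))%:R :> R.
  by rewrite e -natrD; congr (_%:R); lia.
set c := child st a in hphi *; set g := gap st a in gL *.
have -> : phi i c.1 c.2 - phi i st.1 st.2 - (g%:R + (m (stage st.2))%:R) * alpha 0 i =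
  (phi i c.1 c.2 - phi i st.1 st.2 - phi i (u a) (m (stage st.2))) +
  ((phi i (u a) (m (stage st.2)) - (m (stage st.2))%:R * alpha 0 i) - g%:R * alpha 0 i) by ring.
apply: (le_trans (ler_normD _ _)).
have h2 : `|(phi i (u a) (m (stage st.2)) - (m (stage st.2))%:R * alpha 0 i) - g%:R * alpha 0 i| <=
   (stage st.2).+1%:R^-1 * (m (stage st.2))%:R + L%:R * opnorm alpha.
  apply: (le_trans (ler_normB _ _)); apply: lerD => //.
  by rewrite normrM normr_nat; apply: ler_pM => //; rewrite ?ler_nat ?entry_le_rV.
have h3 : M + L%:R * opnorm alpha <= (stage st.2).+1%:R^-1 * (m (stage st.2))%:R.
  by rewrite ler_pdivlMl.
have h4 : 0 <= (stage st.2).+1%:R^-1 * g%:R :> R by rewrite mulr_ge0// invr_ge0.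
apply: (le_trans (lerD (hphi i) h2)).
have -> : 2 / (stage st.2).+1%:R * (g%:R + (m (stage st.2))%:R) =
  2 * ((stage st.2).+1%:R^-1 * g%:R) + 2 * ((stage st.2).+1%:R^-1 * (m (stage st.2))%:R) :> R by ring.
move: h3 h4; set X := _ * g%:R; set Y := _ * (m _)%:R; set Z := L%:R * _; clear.
lra.
Qed.

Variable Inv : subshift Q * nat -> Prop.
Variable st0 : subshift Q * nat.
Hypothesis st0_long : (m 0 + L <= st0.2)%N.
Hypothesis Inv0 : Inv st0.
Hypothesis InvS : forall st, (m 0 + L <= st.2)%N -> Inv st -> exists a, Inv (child st a).

(** [Inv] selects the branch: it is trivial when only a point is wanted, and lightness relative to a
    cover when entropy is estimated. A child keeps all coordinates below the current length,
    negative ones included, so a branch converges to a point. *)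
Lemma construction : exists2 x, rate_set alpha x &
  forall j : nat, exists st, [/\ (j <= st.2)%N, Inv st & same_word st.2 x st.1].
Proof.
have ex st : exists st', (m 0 + L <= st.2)%N -> Inv st -> exists2 a, st' = child st a & Inv st'.
  have [[h1 h2]|h] := pselect ((m 0 + L <= st.2)%N /\ Inv st).
    by have [a ha] := InvS h1 h2; exists (child st a) => _ _; exists a.
  by exists st => h1 h2; exfalso; apply: h.
have [f fP] := choice ex.
pose s j := iter j f st0.
have sP j : (m 0 + L <= (s j).2)%N /\ Inv (s j).
  elim: j => [|j [IH1 IH2]] //; rewrite /s iterS -/(s j).
  have [a -> h] := fP _ IH1 IH2; split => //.
  by have [/ltnW h' _] := child_length a IH1; exact: leq_trans h'.
have sS j : exists a, s j.+1 = child (s j) a.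
  by have [h1 h2] := sP j; have [a h _] := fP _ h1 h2; exists a.
have len j : ((s j).2 < (s j.+1).2)%N.
  by have [a ->] := sS j; have [h1 _] := sP j; have [] := child_length a h1.
have lenj j : (j <= (s j).2)%N by elim: j => // j IH; exact: leq_ltn_trans (len j).
have lenD j d : ((s j).2 <= (s (j + d)%N).2)%N.
  by elim: d => [|d IH]; rewrite ?addn0// addnS; apply: leq_trans IH (ltnW (len _)).
have wordS j (i : int) : i < (s j).2%:Z -> sval (s j.+1).1 i = sval (s j).1 i.
  by move=> hi; have [a ->] := sS j; have [_ _ h _ _] := childP a; exact: h.
have wordD j d (i : int) : i < (s j).2%:Z -> sval (s (j + d)%N).1 i = sval (s j).1 i.
  move=> hi; elim: d => [|d IH]; rewrite ?addn0// addnS wordS//.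
  by apply: (lt_le_trans hi); rewrite lez_nat.
have wordE j j' (i : int) : i < (s j).2%:Z -> i < (s j').2%:Z -> sval (s j).1 i = sval (s j').1 i.
  move=> h h'; case: (leqP j j') => [/subnKC|/ltnW/subnKC] <-; first by rewrite wordD.
  by rewrite wordD.
pose J (i : int) := (absz i).+1.
have Ji i : i < (s (J i)).2%:Z.
  by apply: (@lt_le_trans _ _ (J i)%:Z); [rewrite /J; lia|rewrite lez_nat].
have hx (i : int) : Q (sval (s (J i)).1 i) (sval (s (J (i + 1))).1 (i + 1)).
  pose n := addn (J i) (J (i + 1)).
  have ji : i < (s n).2%:Z by apply: (lt_le_trans (Ji i)); rewrite lez_nat; exact: lenD.
  have ji1 : i + 1 < (s n).2%:Z.
    by apply: (lt_le_trans (Ji _)); rewrite lez_nat /n addnC; exact: lenD.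
  by rewrite (wordE _ n i)// (wordE _ n (i + 1))//; exact: (svalP (s n).1).
pose x : subshift Q := exist _ (fun i => sval (s (J i)).1 i) hx.
have xw j (i : int) : i < (s j).2%:Z -> sval x i = sval (s j).1 i.
  by move=> hi; exact: (wordE (J i) j i (Ji i) hi).
have xword j : same_word (s j).2 x (s j).1 by move=> i /andP[_ hi]; exact: xw.
exists x; last by move=> j; exists (s j); split => //; case: (sP j).
move=> i.
have C0 : 0 <= M + opnorm alpha + 1 by rewrite !addr_ge0 ?opnorm_ge0.
pose dev j := `|phi i (s j).1 (s j).2 - (s j).2%:R * alpha 0 i|.
(* Beyond the length [l1] the relative deviation of each block and the proportion of the unfinished
   block are both at most [e]; what happened before contributes a constant. *)
have key e : 0 < e -> exists C n1, forall n, (n1 <= n)%N ->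
    `|phi i x n - n%:R * alpha 0 i| <= C + e * (M + opnorm alpha + 1) * n%:R.
  move=> e0; have [T hT] := nat_above (2 / e).
  pose l1 := (T + (m T + L) * T.+1)%N.
  have stT l : (l1 <= l)%N -> 2 / (stage l).+1%:R <= e.
    move=> /stage_large h; rewrite ler_pdivrMr// mulrC -ler_pdivrMr//.
    by apply: (le_trans hT); rewrite ler_nat; exact: leqW.
  have l1j j : (l1 <= j)%N -> (l1 <= (s j).2)%N by move=> h; apply: leq_trans h _.
  have devj d : dev (l1 + d)%N <= dev l1 + e * ((s (l1 + d)%N).2 - (s l1).2)%:R.
    elim: d => [|d IH]; first by rewrite addn0 subnn mulr0 addr0.
    rewrite addnS; set j := (l1 + d)%N in IH *.
    have [a sE] := sS j; have [h1 _] := sP j.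
    have := child_dev a i h1; rewrite -sE => h2.
    have h3 : 2 / (stage (s j).2).+1%:R * ((s j.+1).2 - (s j).2)%:R <= e * ((s j.+1).2 - (s j).2)%:R.
      by apply: ler_wpM2r => //; apply: stT; apply: l1j; rewrite /j leq_addr.
    have lj : ((s j).2 <= (s j.+1).2)%N by exact: ltnW.
    have lj' : ((s l1).2 <= (s j).2)%N by exact: lenD.
    rewrite (natrB R lj) in h2 h3; rewrite (natrB R lj') in IH.
    rewrite (natrB R (leq_trans lj' lj)).
    have : dev j.+1 <= dev j + `|phi i (s j.+1).1 (s j.+1).2 - phi i (s j).1 (s j).2 -
        ((s j.+1).2%:R - (s j).2%:R) * alpha 0 i|.
      rewrite /dev; apply: le_trans (ler_normD _ _); rewrite le_eqVlt; apply/orP; left.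
      by apply/eqP; congr `|_|; ring.
    move=> h4; apply: (le_trans h4); apply: (le_trans (lerD IH (le_trans h2 h3))).
    by rewrite le_eqVlt; apply/orP; left; apply/eqP; ring.
  exists (M + dev l1), (s l1).2 => n hn.
  have [j [jl1 jn nj]] : exists j, [/\ (l1 <= j)%N, ((s j).2 <= n)%N & (n < (s j.+1).2)%N].
    have exj : exists j, ((s j).2 <= n)%N && (l1 <= j)%N by exists l1; rewrite hn leqnn.
    have bd j : ((s j).2 <= n)%N && (l1 <= j)%N -> (j <= n)%N.
      by move=> /andP[h _]; exact: leq_trans (lenj j) h.
    case: (ex_maxnP exj bd) => j /andP[h1 h2] hmax; exists j; split => //.
    rewrite ltnNge; apply/negP => h3; have := hmax j.+1; rewrite h3 (leqW h2) => /(_ isT).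
    by rewrite ltnn.
  have [a sE] := sS j; have [h1 _] := sP j.
  have [_ hl] := child_length a h1; rewrite -sE in hl.
  have nd : (n - (s j).2)%:R <= e * (s j).2%:R.
    apply: (@le_trans _ _ ((s j.+1).2 - (s j).2)%:R); first by rewrite ler_nat; lia.
    apply: (@le_trans _ _ (2 / (stage (s j).2).+1%:R * (s j).2%:R)); last first.
      by apply: ler_wpM2r => //; apply: stT; exact: l1j.
    rewrite mulrAC ler_pdivlMr// -natrM (@le_trans _ _ (s j).2%:R)// ?ler_nat//.
    by rewrite mulr_natl mulr2n lerDl.
  have d1 := phiD i x (s j).2 (n - (s j).2); rewrite subnKC// in d1.
  have d2 := phi_word i (xword j).
  have d3 := devj (j - l1)%N; rewrite subnKC// in d3.
  have lj' : ((s l1).2 <= (s j).2)%N by rewrite -(subnKC jl1); exact: lenD.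
  rewrite (natrB R lj') in d3; rewrite (natrB R jn) in nd d1.
  have : `|phi i x n - n%:R * alpha 0 i| <= `|phi i x n - phi i x (s j).2| +
     `|phi i x (s j).2 - phi i (s j).1 (s j).2| + dev j + `|(n%:R - (s j).2%:R) * alpha 0 i|.
    have -> : phi i x n - n%:R * alpha 0 i = (phi i x n - phi i x (s j).2) +
      (phi i x (s j).2 - phi i (s j).1 (s j).2) + (phi i (s j).1 (s j).2 - (s j).2%:R * alpha 0 i)
      - (n%:R - (s j).2%:R) * alpha 0 i by ring.
    apply: (le_trans (ler_normB _ _)); rewrite lerD2r.
    by apply: (le_trans (ler_normD _ _)); rewrite lerD2r ler_normD.
  rewrite normrM => d4.
  have nj0 : 0 <= n%:R - (s j).2%:R :> R by rewrite subr_ge0 ler_nat.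
  rewrite (ger0_norm nj0) in d4.
  have d5 : (n%:R - (s j).2%:R) * `|alpha 0 i| <= e * (s j).2%:R * opnorm alpha.
    by apply: ler_pM => //; exact: entry_le_rV.
  have d6 : M * (n%:R - (s j).2%:R) <= M * (e * (s j).2%:R) by exact: ler_wpM2l.
  have d7 : e * (M + opnorm alpha + 1) * (s j).2%:R <= e * (M + opnorm alpha + 1) * n%:R.
    by apply: ler_wpM2l; rewrite ?ler_nat// mulr_ge0// ltW.
  have d8 : 0 <= e * (s l1).2%:R by rewrite mulr_ge0// ltW.
  have -> : M + dev l1 + e * (M + opnorm alpha + 1) * n%:R =
     M + dev l1 + e * (M + opnorm alpha + 1) * n%:R by [].
  have d9 : e * (M + opnorm alpha + 1) * (s j).2%:R =
     M * (e * (s j).2%:R) + e * (s j).2%:R * opnorm alpha + e * (s j).2%:R by ring.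
  lra.
apply/cvgrPdist_le => e e0.
have d0 : 0 < e / 2 / (M + opnorm alpha + 1).
  by rewrite divr_gt0 ?divr_gt0// ltr_wpDl// addr_ge0 ?opnorm_ge0.
have [C [n1 hC]] := key _ d0.
have [n2 hn2] := nat_above (C * (2 / e)).
exists (n1 + n2 + 1)%N => // n /= hn.
have n0 : 0 < n%:R :> R by rewrite ltr0n; lia.
have -> : alpha 0 i - n%:R^-1 * phi i x n = - (n%:R^-1 * (phi i x n - n%:R * alpha 0 i)).
  by field; rewrite gt_eqF.
rewrite normrN normrM ger0_norm ?invr_ge0 ?ler0n// mulrC ler_pdivrMr//.
have h1 : (n1 <= n)%N by move: hn; clear; lia.
apply: (le_trans (hC n h1)).
have -> : e / 2 / (M + opnorm alpha + 1) * (M + opnorm alpha + 1) = e / 2.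
  by rewrite divfK// gt_eqF// ltr_wpDl// addr_ge0 ?opnorm_ge0.
have : C * (2 / e) <= n%:R by apply: (le_trans hn2); rewrite ler_nat; move: hn; clear; lia.
rewrite mulrA ler_pdivrMr// => h2.
have -> : e * n%:R = n%:R * e / 2 + e / 2 * n%:R by field.
rewrite lerD2r; lra.
Qed.

End Construction.

End LevelSets.

(** * Nonempty level sets and lower bounds for their entropy *)

Section Spectrum.
Context {R : realType} {q : nat} {Q : 'M[bool]_q} {k : nat}.
Implicit Types (x y z w : subshift Q).
Variables (phi : 'I_k -> subshift Q -> nat -> R) (M : R) (L : nat).
Hypothesis M_ge0 : 0 <= M.
Hypothesis phi0 : forall i x, `|phi i x 0| <= M.
Hypothesis phiS : forall i x n, `|phi i x n.+1 - phi i x n| <= M.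
Hypothesis phi_word : forall i x y n, same_word n x y -> `|phi i x n - phi i y n| <= M.
Hypothesis phi_concat : forall x n y m, exists w g, [/\ (g <= L)%N,
  forall i : int, i < n%:Z -> sval w i = sval x i,
  forall i : int, 0 <= i -> sval w ((n + g)%N%:Z + i) = sval y i &
  forall i, `|phi i w (n + g + m) - phi i x n - phi i y m| <= M].

Lemma approximable_stages alpha s (f : nat -> nat) : approximable phi alpha s ->
  exists (m K : nat -> nat) (u : forall t, 'I_(K t) -> subshift Q), forall t,
  [/\ (f t <= m t)%N, expR (s * (m t)%:R) <= (K t)%:R,
    forall a b, same_word (m t) (u t a) (u t b) -> a = b &
    forall a i, `|phi i (u t a) (m t) - (m t)%:R * alpha 0 i| <= t.+1%:R^-1 * (m t)%:R].
Proof.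
move=> app.
have H t : exists D : {K : nat & (nat * ('I_K -> subshift Q))%type},
  [/\ (f t <= (projT2 D).1)%N, expR (s * ((projT2 D).1)%:R) <= (projT1 D)%:R,
    forall a b, same_word (projT2 D).1 ((projT2 D).2 a) ((projT2 D).2 b) -> a = b &
    forall a i, `|phi i ((projT2 D).2 a) (projT2 D).1 - ((projT2 D).1)%:R * alpha 0 i| <= t.+1%:R^-1 * ((projT2 D).1)%:R].
  have [|m [K [u h]]] := app t.+1%:R^-1 _ (f t); first by rewrite invr_gt0.
  by exists (existT _ K (m, u)).
have [g gP] := choice H.
exists (fun t => (projT2 (g t)).1), (fun t => projT1 (g t)), (fun t => (projT2 (g t)).2).
exact: gP.
Qed.

Lemma stage_bound (a : R) : exists f : nat -> nat, forall t m, (f t <= m)%N ->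
  (0 < m)%N /\ t.+1%:R * (M + L%:R * a) <= m%:R.
Proof.
have [f hf] := choice (fun t : nat => nat_above (t.+1%:R * (M + L%:R * a))).
exists (fun t => (f t).+1) => t m h; split; first by apply: leq_trans h.
by apply: (le_trans (hf t)); rewrite ler_nat; exact: ltnW.
Qed.

Lemma approximable_nonempty alpha : approximable phi alpha 0 -> rate_set phi alpha !=set0.
Proof.
move=> app; have [f hf] := stage_bound (opnorm alpha).
have [m [K [u h]]] := approximable_stages f app.
have K0 t : (0 < K t)%N.
  by have [_ + _ _] := h t; rewrite mul0r expR0 ler1n.
have m_gt0 t : (0 < m t)%N by have [/hf[]] := h t.
have m_large t : t.+1%:R * (M + L%:R * opnorm alpha) <= (m t)%:R by have [/hf[]] := h t.
have u_dev t a i : `|phi i (u t a) (m t) - (m t)%:R * alpha 0 i| <= t.+1%:R^-1 * (m t)%:R.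
  by have [_ _ _] := h t; exact.
have [|x xa _] := @construction R q Q k phi M L M_ge0 phiS phi_word phi_concat alpha m K u m_large m_gt0 u_dev
  (fun=> True) (u 0%N (Ordinal (K0 0%N)), (m 0 + L)%N) (leqnn _) I.
  by move=> st _ _; exists (Ordinal (K0 _)).
by exists x.
Qed.

Section EntropyBound.
Variables (omega : R) (alpha : 'rV[R]_k) (s : R).
Hypothesis omega01 : 0 < omega < 1.
Hypothesis s_gt0 : 0 < s.
Hypothesis app : approximable phi alpha (4 * s).

Variables (m K : nat -> nat) (u : forall t, 'I_(K t) -> subshift Q).
Hypothesis m_gt0 : forall t, (0 < m t)%N.
Hypothesis u_inj : forall t a b, same_word (m t) (u (t := t) a) (u b) -> a = b.
Hypothesis K_large : forall t, L.+2%:R * expR (2 * s * (m t + L)%:R) <= (K t)%:R.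

Local Notation chd st a := (@child R q Q k phi M L phi_concat m K u st a).
Local Notation gp st a := (@gap R q Q k phi M L phi_concat m K u st a).
Local Notation stg := (@stage L m).

Variable C : set (subshift Q * nat).

(** The ball can still cover points below the state: some point carries both the word of the state
    and the word of the ball. *)
Definition compat (st c : subshift Q * nat) :=
  exists y, same_word st.2 y st.1 /\ same_word c.2 c.1 y.

Definition weight (c : subshift Q * nat) : R := expR (- (s * c.2%:R)).

Definition mass (st : subshift Q * nat) : \bar R :=
  (\esum_(c in C `&` compat st) (weight c)%:E)%E.

(** The exponent [2 * s], against weights of exponent [s], forces compatible balls to have order at
    least twice the length of the state, which leaves room for a whole further block. *)
Definition light (st : subshift Q * nat) := (mass st <= (expR (- (2 * s * st.2%:R)))%:E)%E.

Lemma light_long st c : light st -> C c -> compat st c -> (2 * st.2 <= c.2)%N.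
Proof.
move=> h Cc cc.
have : ((weight c)%:E <= (expR (- (2 * s * st.2%:R)))%:E)%E.
  apply: le_trans h; apply: esum_ge; exists [set c]; last by rewrite fsbig_set1.
  by split => // _ ->.
rewrite lee_fin ler_expR lerN2 => h'.
rewrite -(ler_nat R) natrM -(ler_pM2l s_gt0); apply: le_trans h'.
by rewrite mulrCA mulrA.
Qed.

Lemma compat_child st a c : compat (chd st a) c -> compat st c.
Proof.
move=> [y [h1 h2]]; exists y; split => // i hi.
have [_ e h _ _] := childP phi_concat u a; rewrite h1; first by rewrite h//; case/andP: hi.
case/andP: hi => i0 i1; apply/andP; split => //; apply: (lt_le_trans i1).
by rewrite e lez_nat -addnA leq_addr.
Qed.

(** A ball at least as long as both children determines the appended block as soon as the gaps put
    it at the same place. *)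
Lemma compat_inj st a b c : compat (chd st a) c -> compat (chd st b) c ->
  ((chd st a).2 <= c.2)%N -> ((chd st b).2 <= c.2)%N -> gp st a = gp st b -> a = b.
Proof.
move=> [y [y1 y2]] [y' [y1' y2']] la lb gE.
have [_ ea _ ua _] := childP phi_concat u a; have [_ eb _ ub _] := childP phi_concat u b.
have lE : (chd st a).2 = (chd st b).2 by rewrite ea eb  gE.
apply: u_inj => i /andP[i0 im].
rewrite -ua// -ub//  -gE.
have hi : 0 <= (st.2 + gp st a)%N%:Z + i < (chd st a).2%:Z.
  by rewrite ea  ; move: i0 im; clear; lia.
rewrite -y1// -y2; last first.
  by case/andP: hi => h0 h; apply/andP; split => //; apply: (lt_le_trans h); rewrite lez_nat.
rewrite -y1'; last by rewrite -lE.
rewrite -y2'//; case/andP: hi => h0 h; apply/andP; split => //; apply: (lt_le_trans h).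
by rewrite lez_nat.
Qed.

(* The orders of the balls meeting a light state exceed twice its length, hence the length of any
   child; so each ball meets at most one child for each of the [L.+1] values of the gap. *)
Lemma light_step st : (m 0 + L <= st.2)%N -> light st -> exists a, light (chd st a).
Proof.
move=> hst hl; apply: contrapT => /forallNP H.
pose E := expR (- (2 * s * st.2%:R)).
have E0 : 0 < E by exact: expR_gt0.
pose rho := expR (- (2 * s * (st.2 + (m (stg st.2) + L))%:R)).
have s20 : 0 < 2 * s by rewrite mulr_gt0.
have long a : forall c, C c -> compat st c -> ((chd st a).2 <= c.2)%N.
  move=> c Cc /(light_long hl Cc) h; apply: leq_trans h.
  have [_ h] := child_length M_ge0 phi_concat u m_gt0 a hst.
  have : ((chd st a).2 - st.2 <= st.2)%N by apply: leq_trans h; rewrite leq_pmulr.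
  by move: (chd st a).2 st.2; clear; lia.
have cnt c : C c -> compat st c -> (#|[pred a | `[<compat (chd st a) c>]]| <= L.+1)%N.
  move=> Cc cc; pose D := [set a | `[<compat (chd st a) c>]]%SET.
  have gl a : (gp st a < L.+1)%N by have [] := childP phi_concat u a.
  have gi : {in D &, injective (fun a => Ordinal (gl a))}.
    move=> a b; rewrite !inE => /asboolP ha /asboolP hb /(congr1 val) e.
    move: ha hb => /asboolP ha /asboolP hb.
    exact: (compat_inj ha hb (long a _ Cc cc) (long b _ Cc cc) e).
  have -> : #|[pred a | `[<compat (chd st a) c>]]| = #|D| by apply: eq_card => a; rewrite !inE.
  by rewrite -(card_in_imset gi) (leq_trans (max_card _))// card_ord.
have big : (\sum_(a < K (stg st.2)) mass (chd st a) <= (L.+1%:R * E)%:E)%E.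
  have -> : (\sum_(a < K (stg st.2)) mass (chd st a) =
     \sum_(a < K (stg st.2)) \esum_(c in C `&` compat st)
        (if `[<compat (chd st a) c>] then weight c else 0)%:E)%E.
    apply: eq_bigr => a _; rewrite /mass.
    have -> : C `&` compat (chd st a) = (C `&` compat st) `&` compat (chd st a).
      by apply/seteqP; split => c; [move=> [? h]; split => //; split => //; exact: compat_child h|move=> [[? ?] ?]].
    rewrite esum_mkcondr; apply: eq_esum => c _.
    by case: asboolP => hc; [rewrite mem_set|rewrite memNset].
  rewrite -esum_sum; last by move=> c a _ _; rewrite lee_fin; case: ifP => _ //; exact: expR_ge0.
  apply: (@le_trans _ _ (\esum_(c in C `&` compat st) \sum_(g < L.+1) (weight c)%:E)%E).
    apply: le_esum => c [Cc cc]; rewrite !sumEFin lee_fin -big_mkcond /=.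
    rewrite !sumr_const card_ord; apply: ler_wpMn2l; first exact: expR_ge0.
    exact: cnt.
  rewrite esum_sum; last by move=> c a _ _; rewrite lee_fin expR_ge0.
  apply: (@le_trans _ _ (\sum_(g < L.+1) E%:E)%E); first by apply: lee_sum => g _; exact: hl.
  by rewrite sumEFin lee_fin sumr_const card_ord mulr_natl.
have small : ((K (stg st.2))%:R * rho <= L.+1%:R * E).
  rewrite -lee_fin; apply: le_trans big.
  apply: (@le_trans _ _ (\sum_(a < K (stg st.2)) rho%:E)%E).
    by rewrite sumEFin lee_fin sumr_const card_ord mulr_natl.
  apply: lee_sum => a _; have /negP := H a; rewrite -ltNge => /ltW; apply: le_trans.
  rewrite lee_fin ler_expR lerN2 ler_pM2l// ler_nat.
  have [gL e _ _ _] := childP phi_concat u a.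
  by rewrite e ; move: gL; clear; lia.
have rhoE : rho * expR (2 * s * (m (stg st.2) + L)%:R) = E.
  by rewrite /rho -expRD natrD mulrDr opprD addrNK.
have : L.+2%:R * E <= L.+1%:R * E.
  apply: le_trans small; rewrite -rhoE mulrCA mulrC.
  by apply: ler_wpM2r; [exact: expR_ge0|exact: K_large].
by rewrite ler_pM2r// ler_nat ltnn.
Qed.

End EntropyBound.

(** A cover cheaper than the threshold of the root makes the root light, and light children lead to
    a point of the level set. The ball covering this point would be compatible with a light state
    longer than its order, against [light_long]. The rate [4 * s] is twice what lightness consumes;
    the surplus pays for the gaps and the factor [L.+2]. *)
Lemma approximable_entropy (omega : R) alpha s : 0 < omega < 1 -> 0 < s ->
  approximable phi alpha (4 * s) -> (s%:E <= htop omega (rate_set phi alpha))%E.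
Proof.
move=> o01 s0 app; have [f hf] := stage_bound (opnorm alpha).
have [c hc] := nat_above ((ln L.+2%:R + 2 * s * L%:R) / (2 * s)).
have [m [K [u h]]] := approximable_stages (fun t => f t + c)%N app.
have s20 : 0 < 2 * s by rewrite mulr_gt0.
have fm t : (f t <= m t)%N by have [h1 _ _ _] := h t; apply: leq_trans h1; rewrite leq_addr.
have m_gt0 t : (0 < m t)%N by have [] := hf _ _ (fm t).
have m_large t : t.+1%:R * (M + L%:R * opnorm alpha) <= (m t)%:R by have [] := hf _ _ (fm t).
have u_dev t a i : `|phi i (u t a) (m t) - (m t)%:R * alpha 0 i| <= t.+1%:R^-1 * (m t)%:R.
  by have [_ _ _] := h t; exact.
have u_inj t a b : same_word (m t) (u t a) (u t b) -> a = b by have [_ _ + _] := h t; exact.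
have K_large t : L.+2%:R * expR (2 * s * (m t + L)%:R) <= (K t)%:R.
  have [h1 h2 _ _] := h t; apply: le_trans h2.
  rewrite -[X in X * _]lnK ?posrE ?ltr0n// -expRD ler_expR.
  have : (ln L.+2%:R + 2 * s * L%:R) / (2 * s) <= (m t)%:R.
    by apply: (le_trans hc); rewrite ler_nat; apply: leq_trans h1; rewrite leq_addl.
  rewrite ler_pdivrMr// natrD; set X := ln _; lra.
have K0 t : (0 < K t)%N.
  rewrite -(ltr_nat R); apply: lt_le_trans (K_large t).
  by rewrite mulr_gt0 ?expR_gt0// ltr0n.
apply: htop_ge => // s1 eps s1s /andP[e0 e1] S0.
pose st0 := (u 0%N (Ordinal (K0 0%N)), (m 0 + L)%N).
have : ((expR (- (2 * s * st0.2%:R)))%:E <= bowen_SN omega (rate_set phi alpha) s1 0 eps)%E.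
  apply: le_ereal_inf_tmp => _ [C [_ _ Ccov] <-]; rewrite leNgt; apply/negP => hC.
  have l0 : light s C st0.
    apply: le_trans (ltW hC); rewrite /mass.
    apply: (@le_trans _ _ (\esum_(c in C) (weight s c)%:E)%E).
      apply: ge_ereal_sup => _ [X [fX XC] <-]; apply: ereal_sup_ubound; exists X => //.
      by split => // d /XC[].
    apply: le_esum => d _; rewrite lee_fin ler_expR lerN2.
    by apply: ler_wpM2r.
  have [|x xa hx] := @construction R q Q k phi M L M_ge0 phiS phi_word phi_concat alpha m K u m_large m_gt0 u_dev
    (light s C) st0 (leqnn _) l0.
    by move=> st hst hlst; exact: (light_step s0 m_gt0 u_inj K_large hst hlst).
  have [d Cd dx] := Ccov x xa.
  have dw := bowen_ball_word o01 e1 dx.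
  have [st [st1 st2 st3]] := hx d.2.+1.
  have cc : compat st d by exists x.
  move: st1 st3 (light_long s0 st2 Cd cc); clear; lia.
move=> /le_trans/(_ (bowen_SN_le_S omega _ s1 0 eps)); rewrite S0 lee_fin leNgt expR_gt0.
by [].
Qed.

End Spectrum.

(** * Approximating rates, and the spectrum of an almost additive family *)

Section Approximation.
Context {R : realType} {q : nat} {Q : 'M[bool]_q} {k : nat}.
Implicit Types (x y z w : subshift Q) (alpha beta : 'rV[R]_k).
Variables (phi : 'I_k -> subshift Q -> nat -> R) (M : R) (L : nat).
Hypothesis M_ge0 : 0 <= M.
Hypothesis phi0 : forall i x, `|phi i x 0| <= M.
Hypothesis phiS : forall i x n, `|phi i x n.+1 - phi i x n| <= M.
Hypothesis phi_word : forall i x y n, same_word n x y -> `|phi i x n - phi i y n| <= M.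
Hypothesis phi_concat : forall x n y m, exists w g, [/\ (g <= L)%N,
  forall i : int, i < n%:Z -> sval w i = sval x i,
  forall i : int, 0 <= i -> sval w ((n + g)%N%:Z + i) = sval y i &
  forall i, `|phi i w (n + g + m) - phi i x n - phi i y m| <= M].

Lemma rate_set_dev alpha x e : rate_set phi alpha x -> 0 < e ->
  exists n0 : nat, forall n, (n0 <= n)%N -> forall i, `|phi i x n - n%:R * alpha 0 i| <= e * n%:R.
Proof.
move=> xa e0.
have [N _ hN] : \forall n \near \oo, forall i, `|alpha 0 i - n%:R^-1 * phi i x n| <= e.
  by apply: filter_forall => i; have /cvgrPdist_le := xa i; apply.
exists N.+1 => n Nn i.
have n0 : 0 < n%:R :> R by rewrite ltr0n; apply: leq_trans Nn.
have -> : phi i x n - n%:R * alpha 0 i = - (alpha 0 i - n%:R^-1 * phi i x n) * n%:R.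
  by field; rewrite gt_eqF.
rewrite normrM normrN normr_nat ler_pM2r//; apply: hN => /=; exact: ltnW.
Qed.

Lemma closed_approximable alpha :
  (forall e, 0 < e -> exists2 alpha', rate_set phi alpha' !=set0 &
     forall i, `|alpha 0 i - alpha' 0 i| <= e) -> approximable phi alpha 0.
Proof.
move=> h e e0 m0; have e2 : 0 < e / 2 by rewrite divr_gt0.
have [alpha' [x xa] d] := h _ e2.
have [n0 hn0] := rate_set_dev xa e2.
exists (maxn m0 n0), 1%N, (fun=> x); split.
- exact: leq_maxl.
- by rewrite mul0r expR0.
- by move=> a b _; rewrite !ord1.
move=> _ i; set m := maxn m0 n0.
have -> : phi i x m - m%:R * alpha 0 i =
  (phi i x m - m%:R * alpha' 0 i) - m%:R * (alpha 0 i - alpha' 0 i) by ring.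
apply: (le_trans (ler_normB _ _)); rewrite [e in X in _ <= X](splitr e) mulrDl; apply: lerD.
  by apply: hn0; exact: leq_maxr.
by rewrite normrM normr_nat mulrC ler_wpM2r.
Qed.

(** A prefix of length [N * m] of a point of rate [alpha] is followed by the words of length [m]
    approximating [beta]. Gaps depend on the word, so only a most frequent gap is kept; this costs a
    factor [L.+1] in the count, which, with the gap length, is absorbed by halving the rate. *)
Lemma approximable_mix alpha beta h (N : nat) : rate_set phi alpha !=set0 -> 0 < h ->
  approximable phi beta h ->
  approximable phi (N.+1%:R^-1 *: (N%:R *: alpha + beta)) (h / (2 * N.+1%:R)).
Proof.
move=> [x xa] h0 app e e0 m0.
set gam := N.+1%:R^-1 *: _.
have e2 : 0 < e / 2 by rewrite divr_gt0.
have [n0 hn0] := rate_set_dev xa e2.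
pose s := h / (2 * N.+1%:R).
have s0 : 0 <= s by rewrite divr_ge0 ?ltW// mulr_gt0.
have [c1 hc1] := nat_above ((M + M + L%:R * opnorm gam) / (e / 2)).
have [c2 hc2] := nat_above ((ln L.+1%:R + s * L%:R) / (h / 2)).
have [m [K [u [mm Kh uinj udev]]]] := app _ e2 (m0 + n0 + c1 + c2)%N.
pose W a := concat_pair phi_concat x (N * m) (u a) m.
have glt a : (sval (projT2 (W a)) < L.+1)%N by case: (W a) => w [g []].
pose gg a := Ordinal (glt a).
have [g gK] : exists g : 'I_L.+1, (K <= L.+1 * #|[pred a | gg a == g]|)%N.
  apply: contrapT => /forallNP H.
  have : (\sum_(g < L.+1) L.+1 * #|[pred a | gg a == g]| <= \sum_(g < L.+1) K.-1)%N.
    apply: leq_sum => g _; have /negP := H g; rewrite -ltnNge => hg.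
    by rewrite -ltnS; apply: leq_trans hg _; case: (K).
  rewrite -big_distrr /= sum_nat_const card_ord leq_mul2l /=.
  have -> : (\sum_(g < L.+1) #|[pred a | gg a == g]| = K)%N.
    rewrite -[RHS]card_ord -sum1_card (partition_big gg xpredT)//=.
    by apply: eq_bigr => g _; rewrite -sum1_card; apply: eq_bigl => a; rewrite inE.
  move=> hK; have K0 : K = 0%N by move: hK; case: (K) => //= n; rewrite ltnn.
  by move: Kh; rewrite K0 leNgt expR_gt0.
pose len := (N * m + g + m)%N.
exists len, #|[pred a | gg a == g]|, (fun b => projT1 (W (enum_val b))).
have Wg b : sval (projT2 (W (enum_val (A := [pred a | gg a == g]) b))) = g.
  by have := enum_valP b; rewrite inE => /eqP/(congr1 val).
have mR (c : nat) (r d : R) : 0 < d -> r / d <= c%:R -> (c <= m)%N -> r <= m%:R * d.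
  by move=> d0 h1 h2; rewrite -ler_pdivrMr// (le_trans h1)// ler_nat.
split.
- by move: mm; rewrite /len; clear; lia.
- have h1 : expR (h * m%:R) <= L.+1%:R * #|[pred a | gg a == g]|%:R.
    by apply: (le_trans Kh); rewrite -natrM ler_nat.
  rewrite -(ler_pM2l (x := L.+1%:R)) ?ltr0n//; apply: le_trans h1.
  rewrite -[X in X * _]lnK ?posrE ?ltr0n// -expRD ler_expR.
  have h2 : s * len%:R <= h / 2 * m%:R + s * L%:R.
    apply: (@le_trans _ _ (s * (N.+1 * m + L)%N%:R)).
      apply: ler_wpM2l => //; rewrite ler_nat /len.
      have := ltn_ord g; rewrite ltnS => h3.
      by rewrite mulSn [(m + _)%N]addnC -!addnA leq_add2l addnC leq_add2l.
    rewrite natrD mulrDr lerD2r natrM mulrA /s; apply: ler_wpM2r => //.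
    by rewrite le_eqVlt; apply/orP; left; apply/eqP; field.
  have h3 : ln L.+1%:R + s * L%:R <= m%:R * (h / 2).
    apply: (mR c2) => //; first by rewrite divr_gt0.
    by move: mm; clear; lia.
  rewrite -/s; have -> : h * m%:R = h / 2 * m%:R + m%:R * (h / 2) by field.
  move: h2 h3; set X := ln _; set Y := s * len%:R; set Z := s * L%:R; clear; lra.
- move=> b b' hbb; apply: enum_val_inj; apply: uinj => i /andP[i0 im].
  have [_ _ h3 _] := svalP (projT2 (W (enum_val b))).
  have [_ _ h3' _] := svalP (projT2 (W (enum_val b'))).
  rewrite -h3// -h3'// !Wg; apply: hbb.
  by rewrite /len; move: i0 im; clear; lia.
move=> b i.
have [gL _ _ h4] := svalP (projT2 (W (enum_val b))).
rewrite Wg in gL h4.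
have := h4 i; rewrite -/len; set w := projT1 _ => h5.
(* For [N = 0] the prefix is empty, and the bound on [phi i x 0] replaces the rate of [x]; hence the
   extra [M] below. *)
have nm : (n0 <= N * m)%N \/ N = 0%N.
  case: (N) => [|N']; [by right|left; rewrite mulSn].
  by apply: leq_trans (leq_addr _ _); move: mm; clear; lia.
have h6 : `|phi i x (N * m) - (N * m)%:R * alpha 0 i| <= e / 2 * (N * m)%:R + M.
  case: nm => [/hn0 h6|->]; first by apply: (le_trans (h6 i)); rewrite lerDl.
  by rewrite mul0n mul0r subr0 mulr0 add0r.
have h7 := udev (enum_val b) i.
have gamE : gam 0 i = N.+1%:R^-1 * (N%:R * alpha 0 i + beta 0 i) by rewrite !mxE.
have E : phi i w len - len%:R * gam 0 i =
  (phi i w len - phi i x (N * m) - phi i (u (enum_val b)) m) +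
  (phi i x (N * m) - (N * m)%:R * alpha 0 i) + (phi i (u (enum_val b)) m - m%:R * beta 0 i)
  - g%:R * gam 0 i.
  have -> : len%:R * gam 0 i = g%:R * gam 0 i + m%:R * (N%:R * alpha 0 i + beta 0 i).
    have -> : m%:R * (N%:R * alpha 0 i + beta 0 i) = m%:R * N.+1%:R * gam 0 i.
      by rewrite gamE mulrA mulfK// pnatr_eq0.
    by rewrite -natr1 /len !natrD natrM; ring.
  by rewrite natrM; ring.
have h8 : g%:R * `|gam 0 i| <= L%:R * opnorm gam.
  by apply: ler_pM => //; [rewrite ler_nat -ltnS|exact: entry_le_opnorm].
have : `|phi i w len - len%:R * gam 0 i| <= M + (e / 2 * (N * m)%:R + M) + e / 2 * m%:R + L%:R * opnorm gam.
  rewrite E; apply: (le_trans (ler_normB _ _)); apply: lerD; last by rewrite normrM normr_nat.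
  apply: (le_trans (ler_normD _ _)); apply: lerD => //.
  by apply: (le_trans (ler_normD _ _)); apply: lerD.
move=> h9; apply: (le_trans h9).
have h10 : M + M + L%:R * opnorm gam <= m%:R * (e / 2).
  by apply: (mR c1) => //; move: mm; clear; lia.
have h11 : e * ((N * m)%:R + m%:R) <= e * len%:R.
  by rewrite ler_pM2l// -natrD ler_nat /len; clear; lia.
apply: le_trans h11.
have -> : e * ((N * m)%:R + m%:R) = e / 2 * (N * m)%:R + (e / 2 * (N * m)%:R + e / 2 * m%:R) + m%:R * (e / 2).
  by field.
have h12 : 0 <= e / 2 * (N * m)%:R by rewrite mulr_ge0// ltW.
move: h10 h12; set X := L%:R * _; set Y := e / 2 * (N * m)%:R; set Z := e / 2 * _; set T := _ * (e / 2); clear; lra.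
Qed.

(* Otherwise every point of a compact box of growth rates would have a neighbourhood carrying few words, and compactness would bound the total number of words. *)
Lemma approximable_exists (h : R) (m1 : nat) : 0 < h ->
  (forall m, (m1 <= m)%N -> forall K (u : 'I_K -> subshift Q),
    (forall x, exists a, same_word m x (u a)) -> expR (h * m%:R) <= K%:R) ->
  exists beta, approximable phi beta (h / 2).
Proof.
move=> h0 grow.
have H (m : nat) : exists D : {K : nat & 'I_K -> subshift Q},
    (forall a b, same_word m (projT2 D a) (projT2 D b) -> a = b) /\ (forall x, exists a, same_word m x (projT2 D a)).
  by have [K [u hu]] := words_enum (Q := Q) m; exists (existT _ K u).
have [D hD] := choice H.
pose K m := projT1 (D m); pose u m : 'I_(K m) -> subshift Q := projT2 (D m).
pose vec m (a : 'I_(K m)) : 'rV[R]_k := \row_i (m%:R^-1 * phi i (u m a) m).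
pose few (U : set 'rV[R]_k) := exists c m0 : nat, forall m, (m0 <= m)%N ->
  #|[pred a : 'I_(K m) | `[<U (vec m a)>]]|%:R <= c%:R * expR (h / 2 * m%:R).
have few_sub U V : U `<=` V -> few V -> few U.
  move=> UV [c [m0 hc]]; exists c, m0 => m hm; apply: le_trans (hc m hm).
  rewrite ler_nat; apply/subset_leq_card/fintype.subsetP => a; rewrite !unfold_in.
  by move=> /asboolP hU; apply/asboolP; exact: UV.
have fewU U V : few U -> few V -> few (U `|` V).
  move=> [c [m0 hc]] [c' [m0' hc']]; exists (c + c')%N, (maxn m0 m0') => m.
  rewrite geq_max => /andP[hm hm']; rewrite natrD mulrDl.
  apply: le_trans (lerD (hc m hm) (hc' m hm')); rewrite -natrD ler_nat.
  rewrite -cardUI; apply: leq_trans (leq_addr _ _).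
  apply/subset_leq_card/fintype.subsetP => a; rewrite !unfold_in.
  by move=> /asboolP[hU|hV]; apply/orP; [left|right]; apply/asboolP.
have few0 : few set0.
  exists 0%N, 0%N => m _; rewrite mul0r (_ : #|_| = 0%N)//.
  by apply: eq_card0 => a; rewrite unfold_in; apply/asboolP.
pose B := [set v : 'rV[R]_k | forall i, (fun=> `[- (2 * M), 2 * M]%classic) i (v ord0 i)].
have cB : compact B by apply: rV_compact => _; exact: segment_compact.
have vecB m a : (0 < m)%N -> B (vec m a).
  move=> m0 i /=; rewrite in_itv /= -ler_norml mxE normrM normfV normr_nat.
  rewrite ler_pdivrMl ?ltr0n//; apply: (le_trans (phi_bound phi0 phiS _ _ _)).
  have -> : m%:R * (2 * M) = (2 * m)%N%:R * M by rewrite natrM; ring.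
  by rewrite mulrC; apply: ler_wpM2r => //; rewrite ler_nat; move: m0; clear; lia.
have nB : ~ few B.
  move=> [c [m0 hc]].
  have [c1 hc1] := nat_above (ln c.+1%:R * (2 / h)).
  pose m := (m0 + m1 + c1 + 1)%N.
  have := hc m; rewrite (_ : #|_| = K m); last first.
    rewrite -[RHS]card_ord; apply: eq_card => a; rewrite !unfold_in.
    by apply/asboolP; apply: vecB; rewrite /m addn1.
  have mm0 : (m0 <= m)%N by rewrite /m; clear; lia.
  move=> /(_ mm0); have mm1 : (m1 <= m)%N by rewrite /m; clear; lia.
  move/(le_trans (grow m mm1 _ _ (proj2 (hD m)))).
  rewrite leNgt => /negP; apply.
  apply: (@lt_le_trans _ _ (c.+1%:R * expR (h / 2 * m%:R))).
    by rewrite ltr_pM2r ?expR_gt0// ltr_nat.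
  rewrite -[X in X * _]lnK ?posrE ?ltr0n// -expRD ler_expR.
  have : ln c.+1%:R * (2 / h) <= m%:R.
    by apply: (le_trans hc1); rewrite ler_nat /m; clear; lia.
  rewrite mulrA ler_pdivrMr// => h1.
  have -> : h * m%:R = m%:R * h / 2 + h / 2 * m%:R by field.
  by rewrite lerD2r ler_pdivlMr.
pose F := [set U : set 'rV[R]_k | few (B `\` U)].
have FF : ProperFilter F.
  apply: Build_ProperFilter.
    by rewrite /F /= setD0.
  split.
  - by rewrite /F /= setDT.
  - move=> U V hU hV; rewrite /F /= setDIr; exact: fewU.
  - by move=> U V UV; apply: few_sub => v [Bv nV]; split => // /UV.
have [|beta [_ hb]] := cB F FF; first by rewrite /F /= setDv.
exists beta => e e0 m0.
have nfew : ~ few (ball beta e).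
  move=> hf; have FU : F (~` ball beta e) by apply: few_sub hf => v [_ /contrapT].
  have nb : nbhs beta (ball beta e) by exact: nbhsx_ballx.
  by have [v [h1 h2]] := hb _ _ FU nb.
have [m [hm hK]] : exists m, (m0 + 1 <= m)%N /\ expR (h / 2 * m%:R) <= #|[pred a : 'I_(K m) | `[<ball beta e (vec m a)>]]|%:R.
  apply: contrapT => /forallNP H'; apply: nfew; exists 1%N, (m0 + 1)%N => m hm.
  rewrite mul1r leNgt; apply/negP => hlt; apply: (H' m); split => //; exact: ltW.
exists m, #|[pred a : 'I_(K m) | `[<ball beta e (vec m a)>]]|, (fun b => u m (enum_val b)); split => //.
- by move: hm; clear; lia.
- by move=> a b hab; apply: enum_val_inj; exact: (proj1 (hD m)).
move=> b i; have := enum_valP b; rewrite unfold_in => /asboolP[_ /(_ 0 i)].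
rewrite /ball /= mxE => hbi.
have mp : 0 < m%:R :> R by rewrite ltr0n; move: hm; clear; lia.
have -> : phi i (u m (enum_val b)) m - m%:R * beta 0 i =
   - (beta 0 i - m%:R^-1 * phi i (u m (enum_val b)) m) * m%:R by field; rewrite gt_eqF.
by rewrite normrM normrN normr_nat ler_pM2r// ltW.
Qed.

Theorem rate_spectrum (omega : R) : 0 < omega < 1 ->
  (0 < htop omega [set: subshift Q])%E ->
  closure [set alpha : 'rV[R]_k | (0 < htop omega (rate_set phi alpha))%E]
    = [set alpha | rate_set phi alpha !=set0].
Proof.
move=> o01 hT; apply/seteqP; split => alpha /=.
  move=> ca; apply: (approximable_nonempty M_ge0 phiS phi_word phi_concat).
  apply: closed_approximable => e e0.
  have [alpha' [h1 [_ h2]]] := ca _ (nbhsx_ballx alpha e e0).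
  exists alpha'; first exact: htop_gt0_nonempty h1.
  by move=> i; apply: ltW; exact: h2.
move=> na V /nbhs_ballP[e /= e0 hV].
have [h [h0 [m1 grow]]] := words_growth o01 hT.
have [beta hb] := approximable_exists h0 grow.
(* The mixture differs from [alpha] by [(beta - alpha) / N.+1], which this [N] makes smaller than
   [e]. *)
have [N hN] := nat_above (opnorm (beta - alpha) / e).
have h20 : 0 < h / 2 by rewrite divr_gt0.
have app := approximable_mix N na h20 hb.
set gam := N.+1%:R^-1 *: _ in app.
exists gam; split.
  pose s := h / 2 / (2 * N.+1%:R) / 4.
  have s0 : 0 < s by rewrite /s divr_gt0// divr_gt0// mulr_gt0.
  have app' : approximable phi gam (4 * s).
    by have -> : 4 * s = h / 2 / (2 * N.+1%:R) by rewrite /s mulrC divfK.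
  apply: lt_le_trans (approximable_entropy M_ge0 phiS phi_word phi_concat o01 s0 app').
  by rewrite lte_fin.
apply: hV; split => // i j; rewrite ord1 /ball /=.
have -> : alpha 0 j - gam 0 j = - (N.+1%:R^-1 * (beta - alpha) 0 j).
  rewrite !mxE -natr1; field; by rewrite natr1 pnatr_eq0.
rewrite normrN normrM normfV normr_nat ltr_pdivrMl ?ltr0n//.
apply: (le_lt_trans (entry_le_opnorm (beta - alpha) 0 j)).
move: hN; rewrite ler_pdivrMr// => /le_lt_trans; apply.
by rewrite ltr_pM2r// ltr_nat.
Qed.

End Approximation.

(** * Logarithmic norms of exterior powers as an almost additive family *)

Section LogNorms.
Context {R : realType} {q : nat} {Q : 'M[bool]_q} {k : nat}.
Implicit Types (x y z w : subshift Q).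
Variables (theta tau c0 C : R) (A : subshift Q -> 'M[R]_k).
Hypothesis domA : forall b, dominated theta tau c0 C (time_map A b).

Notation fwd := (orbit_prod A true).

Definition log_norm (i : 'I_k) x n : R := ln (opnorm (extpow i.+1 (fwd n x))).

Lemma ln_dist (a b E : R) : 0 < a -> 0 < b -> 1 <= E -> a <= E * b -> b <= E * a -> `|ln a - ln b| <= ln E.
Proof.
move=> a0 b0 E1 h1 h2; have E0 : 0 < E by apply: lt_le_trans E1.
have i1 : ln a <= ln E + ln b by rewrite -lnM ?posrE// ler_ln ?posrE// mulr_gt0.
have i2 : ln b <= ln E + ln a by rewrite -lnM ?posrE// ler_ln ?posrE// mulr_gt0.
rewrite ler_norml; apply/andP; split; lra.
Qed.

Lemma ln_dist_mul (a b d E : R) : 0 < a -> 0 < b -> 0 < d -> 1 <= E ->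
  a <= E * (b * d) -> b * d <= E * a -> `|ln a - ln b - ln d| <= ln E.
Proof.
move=> a0 b0 d0 E1 h1 h2; rewrite -addrA -opprD -lnM ?posrE//.
by apply: ln_dist => //; exact: mulr_gt0.
Qed.

Lemma ext_fwd_gt0 (i : 'I_k) n x : 0 < opnorm (extpow i.+1 (fwd n x)).
Proof. by apply: ext_gt0 => //; exact: (fwd_unit domA). Qed.

(** One constant for all exterior powers: the sum of the absolute values dominates each of them. *)
Lemma uniform_ord_bound (P : 'I_k -> R -> Prop) :
  (forall i (a b : R), a <= b -> P i a -> P i b) -> (forall i, exists a, P i a) ->
  exists2 a, 0 <= a & forall i, P i a.
Proof.
move=> Pmono h; have [f fP] := choice h.
exists (\sum_i `|f i|); first exact: sumr_ge0.
move=> i; apply: Pmono (fP i); rewrite (bigD1 i)//= (le_trans (ler_norm _))// lerDl.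
exact: sumr_ge0.
Qed.

Lemma log_norm0 : exists2 M, 0 <= M & forall i x, `|log_norm i x 0| <= M.
Proof.
apply: uniform_ord_bound (fun i a => forall x, `|log_norm i x 0| <= a) _ _.
  by move=> i a b ab h x; exact: le_trans (h x) ab.
by move=> i; exists `|ln (opnorm (extpow i.+1 (1%:M : 'M[R]_k)))| => x.
Qed.

Lemma log_normS : exists2 M, 0 <= M & forall i x n, `|log_norm i x n.+1 - log_norm i x n| <= M.
Proof.
apply: uniform_ord_bound (fun i a => forall x n, `|log_norm i x n.+1 - log_norm i x n| <= a) _ _.
  by move=> i a b ab h x n; exact: le_trans (h x n) ab.
move=> i; have [_ _ c00 _ [Au _ A1 A2 _]] := domA true.
pose E := Order.max 1 (ext_bound i.+1 k c0).
have E1 : 1 <= E by rewrite le_max lexx.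
have extE (B : 'M[R]_k) : opnorm B <= c0 -> opnorm (extpow i.+1 B) <= E.
  by move=> hB; rewrite /E le_max; apply/orP; right; exact: opnorm_ext_le.
exists (ln E) => x n.
have S : fwd n.+1 x = A (Tpow n%:Z x) *m fwd n x by [].
apply: ln_dist; rewrite ?ext_fwd_gt0//.
  rewrite S extpowM; apply: (le_trans (opnormM _ _)).
  by apply: ler_wpM2r; [exact: opnorm_ge0|apply: extE; exact: A1].
have -> : fwd n x = invmx (A (Tpow n%:Z x)) *m fwd n.+1 x by rewrite S mulKmx//; exact: Au.
rewrite extpowM; apply: (le_trans (opnormM _ _)).
by apply: ler_wpM2r; [exact: opnorm_ge0|apply: extE; exact: A2].
Qed.

Lemma log_norm_word : exists2 M, 0 <= M & forall i x y n, same_word n x y ->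
  `|log_norm i x n - log_norm i y n| <= M.
Proof.
apply: uniform_ord_bound (fun i a => forall x y n, same_word n x y -> `|log_norm i x n - log_norm i y n| <= a) _ _.
  by move=> i a b ab h x y n xy; exact: le_trans (h x y n xy) ab.
move=> i; have [D [D0 hD]] := ext_distortion domA.
exists (ln (Order.max 1 (D i.+1))) => x y n xy.
have DE : D i.+1 <= Order.max 1 (D i.+1) by rewrite le_max lexx orbT.
apply: ln_dist; rewrite ?ext_fwd_gt0 ?le_max ?lexx//.
  apply: (le_trans (hD _ _ y x (same_word_sym xy))).
  by apply: ler_wpM2r; rewrite ?opnorm_ge0.
apply: (le_trans (hD _ _ x y xy)).
by apply: ler_wpM2r; rewrite ?opnorm_ge0.
Qed.

(** The lower estimate is quasi-multiplicativity. The upper one is submultiplicativity, with bounded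
    distortion on both words and a bounded factor across the gap. *)
Lemma log_norm_concat (L : nat) (B : nat -> R) : (forall t, 0 < B t) ->
  (forall x n y m, exists w g, [/\ (g <= L)%N,
    forall i : int, i < n%:Z -> sval w i = sval x i,
    forall i : int, 0 <= i -> sval w ((n + g)%N%:Z + i) = sval y i &
    forall t, (1 <= t <= k)%N ->
      opnorm (extpow t (fwd n x)) * opnorm (extpow t (fwd m y)) <=
      B t * opnorm (extpow t (fwd (n + g + m) w))]) ->
  exists2 M, 0 <= M & forall x n y m, exists w g, [/\ (g <= L)%N,
    forall i : int, i < n%:Z -> sval w i = sval x i,
    forall i : int, 0 <= i -> sval w ((n + g)%N%:Z + i) = sval y i &
    forall i, `|log_norm i w (n + g + m) - log_norm i x n - log_norm i y m| <= M].
Proof.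
move=> B0 qm; have [D [D0 hD]] := ext_distortion domA.
have [c c1 hc] := controlled_fwd domA.
have [|M M0 hM] := @uniform_ord_bound (fun i a => forall x n y m w g, (g <= L)%N ->
    (forall i : int, i < n%:Z -> sval w i = sval x i) ->
    (forall i : int, 0 <= i -> sval w ((n + g)%N%:Z + i) = sval y i) ->
    opnorm (extpow i.+1 (fwd n x)) * opnorm (extpow i.+1 (fwd m y)) <=
      B i.+1 * opnorm (extpow i.+1 (fwd (n + g + m) w)) ->
    `|log_norm i w (n + g + m) - log_norm i x n - log_norm i y m| <= a)
  (fun i a b ab h x n y m w g h1 h2 h3 h4 => le_trans (h x n y m w g h1 h2 h3 h4) ab).
  move=> i; set t := i.+1.
  pose E := Order.max 1 (Order.max (B t) (D t * ext_bound t k (c ^+ L) * D t)).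
  exists (ln E) => x n y m w g gL wx wy h.
  have E1 : 1 <= E by rewrite le_max lexx.
  have xp : 0 < opnorm (extpow t (fwd n x)) by exact: ext_fwd_gt0.
  have yp : 0 < opnorm (extpow t (fwd m y)) by exact: ext_fwd_gt0.
  have wp : 0 < opnorm (extpow t (fwd (n + g + m) w)) by exact: ext_fwd_gt0.
  apply: (ln_dist_mul wp xp yp E1); last first.
    by apply: (le_trans h); apply: ler_wpM2r; [exact: ltW|rewrite !le_max lexx orbT].
  have -> : fwd (n + g + m) w = fwd m (Tpow (n + g)%N%:Z w) *m fwd g (Tpow n%:Z w) *m fwd n w.
    by rewrite fwdD fwdD mulmxA.
  have h1 : opnorm (extpow t (fwd n w)) <= D t * opnorm (extpow t (fwd n x)).
    by apply: hD => j /andP[_ jn]; rewrite wx.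
  have h2 : opnorm (extpow t (fwd m (Tpow (n + g)%N%:Z w))) <= D t * opnorm (extpow t (fwd m y)).
    by apply: hD => j /andP[j0 _] /=; rewrite addrC wy.
  have h3 : opnorm (extpow t (fwd g (Tpow n%:Z w))) <= ext_bound t k (c ^+ L).
    apply: opnorm_ext_le; have [_ + _] := hc g (Tpow n%:Z w) => /le_trans; apply.
    exact: ler_weXn2l.
  apply: (@le_trans _ _ (D t * opnorm (extpow t (fwd m y)) * ext_bound t k (c ^+ L) * (D t * opnorm (extpow t (fwd n x))))).
    rewrite !extpowM; apply: (le_trans (opnormM _ _)); apply: (ler_pM (opnorm_ge0 _) (opnorm_ge0 _) _ h1).
    exact: (le_trans (opnormM _ _) (ler_pM (opnorm_ge0 _) (opnorm_ge0 _) h2 h3)).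
  have -> : D t * opnorm (extpow t (fwd m y)) * ext_bound t k (c ^+ L) * (D t * opnorm (extpow t (fwd n x))) =
    D t * ext_bound t k (c ^+ L) * D t * (opnorm (extpow t (fwd n x)) * opnorm (extpow t (fwd m y))) by ring.
  apply: ler_wpM2r; first by rewrite mulr_ge0 ?opnorm_ge0.
  by rewrite !le_max lexx !orbT.
exists M => // x n y m; have [w [g [gL wx wy h]]] := qm x n y m.
by exists w, g; split => // i; apply: hM => //; apply: h; rewrite /= ltn_ord.
Qed.

End LogNorms.

(** * Conclusion for typical cocycles *)

Theorem theorem4p6 (R : realType) (q : nat) (Q : 'M[bool]_q) (k : nat)
    (omega r : R) (A : subshift Q -> 'M[R]_k) :
  (0 < k)%N ->
  0 < omega < 1 ->
  0 < r ->
  @topologically_mixing R q Q omega ->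
  (0 < htop omega [set: subshift Q])%E ->
  typical_cocycles omega r A ->
  closure [set alpha : 'rV[R]_k | (0 < htop omega (level_set A alpha))%E]
    = Lspectrum A.
Proof.
move=> k0 o01 r0 mix hT typ.
have [tau [c0 [C domA]]] := dominated_time_map o01 r0 (proj1 typ).
have [L [B [B0 qm]]] := quasi_multiplicative k0 o01 r0 mix typ.
have [M1 M10 h1] := @log_norm0 R q Q k A.
have [M2 M20 h2] := log_normS domA.
have [M3 M30 h3] := log_norm_word domA.
have [M4 M40 h4] := log_norm_concat domA B0 qm.
have levelE alpha : level_set A alpha = rate_set (log_norm A) alpha.
  have e (i : 'I_k) x : (fun n : nat => n%:R^-1 * ln (opnorm (extpow i.+1 (cocycle A n%:Z x)))) =
      (fun n => n%:R^-1 * log_norm A i x n).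
    by apply/funext => n; rewrite /log_norm cocycle_posE.
  by apply/seteqP; split => x hx i; [rewrite -e|rewrite e]; exact: hx.
pose M := M1 + M2 + M3 + M4.
rewrite /Lspectrum.
rewrite (_ : [set alpha | (0 < htop omega (level_set A alpha))%E] =
  [set alpha | (0 < htop omega (rate_set (log_norm A) alpha))%E]); last first.
  by apply/funext => alpha /=; rewrite levelE.
rewrite (_ : [set alpha | level_set A alpha !=set0] =
  [set alpha | rate_set (log_norm A) alpha !=set0]); last first.
  by apply/funext => alpha /=; rewrite levelE.
apply: (@rate_spectrum R q Q k (log_norm A) M L) => //.
- by rewrite !addr_ge0.
- by move=> i x; apply: (le_trans (h1 i x)); rewrite /M; lra.
- by move=> i x n; apply: (le_trans (h2 i x n)); rewrite /M; lra.
- by move=> i x y n xy; apply: (le_trans (h3 i x y n xy)); rewrite /M; lra.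
- move=> x n y m; have [w [g [gL wx wy hw]]] := h4 x n y m; exists w, g; split => // i.
  by apply: (le_trans (hw i)); rewrite /M; lra.
Qed.
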